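(* Let $(E,|\cdot|)$ be a Banach space with $\dim E\ge2$ and let $D\subsetneq E$ be an unbounded proper domain (an open and connected set), with quasihyperbolic metric $k$. Then $D$ is $A$-uniform if and only if $(D,k)$ is $\delta$-hyperbolic and there is a natural map $\phi\colon\partial_kD\to\partial D\cup\{\infty\}$ and a point $\xi\in\partial_kD$ with $\phi(\xi)=\infty$ such that $$\phi\colon(\partial_kD\setminus\{\xi\},k_{b,\varepsilon})\to(\partial D,|\cdot|)$$ is $\eta$-quasisymmetric, where $k_{b,\varepsilon}$ is a Hamenstädt metric on $\partial_kD\setminus\{\xi\}$ based at a Busemann function $b\in\mathcal B_k(\xi)$ with (admissible) parameter $\varepsilon$. The parameters $A$ and $\delta,\eta,\varepsilon$ depend only on each other. That is: if $D$ is $A$-uniform, then $(D,k)$ is $\delta$-hyperbolic with $\delta=\delta(A)$ and there exist a natural map $\phi\colon\partial_kD\to\partial D\cup\{\infty\}$ and a point $\xi\in\partial_kD$ with $\phi(\xi)=\infty$ such that $\phi\colon(\partial_kD\setminus\{\xi\},k_{b,\varepsilon})\to(\partial D,|\cdot|)$ is $\eta$-quasisymmetric for every Hamenstädt metric $k_{b,\varepsilon}$, $b\in\mathcal B_k(\xi)$, with $\eta$ depending only on $A$ and $\varepsilon$; conversely, if $(D,k)$ is $\delta$-hyperbolic and there exist a natural map $\phi\colon\partial_kD\to\partial D\cup\{\infty\}$ and a point $\xi\in\partial_kD$ with $\phi(\xi)=\infty$ such that $\phi\colon(\partial_kD\setminus\{\xi\},k_{b,\varepsilon})\to(\partial D,|\cdot|)$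 is $\eta$-quasisymmetric for some Hamenstädt metric $k_{b,\varepsilon}$, $b\in\mathcal B_k(\xi)$, then $D$ is $A$-uniform with $A$ depending only on $\delta,\eta,\varepsilon$.
   Context: **Domains.** $D$ carries the metric $d(x,y)=|x-y|$; $\partial D$ is its norm boundary, $\overline D=D\cup\partial D$, and $d(x)$ denotes the distance from $x\in D$ to $\partial D$. **Uniformity and quasihyperbolic metric.** $\ell(\gamma)$ denotes the length of a curve. $D$ is $A$-uniform ($A\ge1$) if any $x,y\in D$ can be joined by a rectifiable curve $\gamma$ in $D$ with $\ell(\gamma)\le A\,|x-y|$ and $\min\{\ell(\gamma[x,z]),\ell(\gamma[z,y])\}\le A\,d(z)$ for all $z\in\gamma$, where $\gamma[u,v]$ is the subcurve between $u$ and $v$. The quasihyperbolic metric is $k(x,y)=\inf_\gamma\int_\gamma\frac{ds}{d(z)}$, the infimum over rectifiable curves $\gamma$ in $D$ joining $x$ and $y$. **Gromov hyperbolicity.** For a metric space $(X,m)$, $(x|y)_w=\frac12[m(x,w)+m(y,w)-m(x,y)]$. $(X,m)$ is $\delta$-hyperbolic if $(x|y)_w\ge\min\{(x|z)_w,(z|y)_w\}-\delta$ for all $x,y,z,w\in X$, and Gromov hyperbolic if this holds for some $\delta\ge0$. A sequence $\{x_i\}$ is a Gromov sequence if $(x_i|x_j)_w\to\infty$ as $i,j\to\infty$; Gromov sequences $\{x_i\},\{y_i\}$ are equivalent if $(x_i|y_i)_w\to\infty$. The Gromov boundary ($\partial_\infty X$, or $\partial_mX$ to indicate the metric $m$) is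 the set of equivalence classes. For $x\in X$, $\xi,\zeta\in\partial_mX$: $(x|\xi)_w=\inf\{\liminf_i(x|y_i)_w:\{y_i\}\in\xi\}$ and $(\xi|\zeta)_w=\inf\{\liminf_i(x_i|y_i)_w:\{x_i\}\in\xi,\{y_i\}\in\zeta\}$. **Busemann functions and Hamenstädt metrics.** Let $(X,m)$ be $\delta$-hyperbolic and $\xi\in\partial_mX$. A Busemann function based at $\xi$ is a function $b=b_{\xi,w}\colon X\to\mathbb R$, $b(x)=(\xi|w)_x-(\xi|x)_w$, for some $w\in X$; the set of these is $\mathcal B_m(\xi)$. Put $(x|y)_b=\frac12(b(x)+b(y)-m(x,y))$ for $x,y\in X$, and for $\xi_1,\xi_2\in\partial_mX\setminus\{\xi\}$, $(\xi_1|\xi_2)_b=\inf\{\liminf_i(x_i|y_i)_b:\{x_i\}\in\xi_1,\{y_i\}\in\xi_2\}$. A parameter $\varepsilon>0$ is admissible if $e^{22\varepsilon\delta}\le2$. For admissible $\varepsilon$ let $\rho_{b,\varepsilon}(\xi_1,\xi_2)=e^{-\varepsilon(\xi_1|\xi_2)_b}$ (with $e^{-\infty}=0$). The Hamenstädt metric based at $b$ with parameter $\varepsilon$ on $\partial_mX\setminus\{\xi\}$, denoted $m_{b,\varepsilon}$, is $m_{b,\varepsilon}(\xi_1,\xi_2)=\inf\sum_{i=1}^n\rho_{b,\varepsilon}(\zeta_{i-1},\zeta_i)$, the infimum over all $n\ge1$ and all chains $\xi_1=\zeta_0,\dots,\zeta_n=\xi_2$ in $\partial_mX\setminus\{\xi\}$.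 It is a metric with $\frac12\rho_{b,\varepsilon}\le m_{b,\varepsilon}\le\rho_{b,\varepsilon}$. **Natural maps.** Equip $\overline D\cup\{\infty\}$ with the topology whose open sets are the (relatively) open sets of $\overline D$ and the sets $U\ni\infty$ whose complement is a closed bounded subset of $\overline D$. If $(D,k)$ is Gromov hyperbolic, a map $\psi\colon\partial_kD\to\partial D\cup\{\infty\}$ is natural if it is a continuous extension of the identity map $(D,k)\to(D,|\cdot|)$, i.e. the identity together with $\psi$ is continuous from $D\cup\partial_kD$ to $\overline D\cup\{\infty\}$. Here $D\cup\partial_kD$ has its usual topology: $D$ is open with the $k$-topology, and the sets $\{z:(z|\zeta)_w>t\}$, $t>0$, form a neighbourhood base at $\zeta\in\partial_kD$. In particular $x_i\to\psi(\zeta)$ for every Gromov sequence $\{x_i\}\in\zeta$. **Quasisymmetry.** A homeomorphism $f\colon(Y,\sigma)\to(Y',\sigma')$ is $\eta$-quasisymmetric, for a homeomorphism $\eta\colon[0,\infty)\to[0,\infty)$, if $\sigma(x,y)\le t\,\sigma(x,z)$ implies $\sigma'(f(x),f(y))\le\eta(t)\,\sigma'(f(x),f(z))$ for all $t>0$ and $x,y,z\in Y$. *)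

(* Defs.v *)
From HB Require Import structures.
From mathcomp Require Export all_boot all_order all_algebra.
From mathcomp Require Export all_classical all_reals all_analysis.
Export Order.TTheory GRing.Theory Num.Theory.
Export numFieldNormedType.Exports.

Set Implicit Arguments.
Unset Strict Implicit.
Unset Printing Implicit Defensive.

Local Open Scope classical_set_scope.
Local Open Scope ring_scope.

Definition dim_ge2 (R : realType) (E : completeNormedModType R) : Prop :=
  exists u v : E, forall a c : R, a *: u + c *: v = 0 -> a = 0 /\ c = 0.

Section Domains.
Context {R : realType} {E : completeNormedModType R}.
Implicit Types (D : set E) (x y z : E) (g : R -> E).

Definition frontier D : set E := closure D `\` D°.

(* [D] is automatically nonempty, since [set0] is bounded *)
Definition unbounded_domain D : Prop :=
  [/\ open D, connected D, D != setT & ~ bounded_set D].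

Definition bdist D x : R := inf [set `|x - z| | z in frontier D].

(* Curves are parametrized by [0, 1]; values outside [0, 1] are irrelevant. *)
Definition curve_in D x y g : Prop :=
  [/\ {within `[0, 1]%classic, continuous g}, g 0 = x, g 1 = y &
      forall t : R, t \in `[0, 1] -> D (g t)].

Definition curve_length g (a b : R) : \bar R :=
  ereal_sup [set (\sum_(0 <= i < size s)
                    `|g (nth b (a :: s) i.+1) - g (nth b (a :: s) i)|)%:E
            | s in itv_partition a b].

Definition rectifiable g : Prop := (curve_length g 0 1 < +oo)%E.

Definition uniform_domain (A : R) D : Prop :=
  forall x y, D x -> D y -> exists g,
    [/\ curve_in D x y g, rectifiable g,
        (curve_length g 0 1 <= (A * `|x - y|)%:E)%E &
        forall t : R, t \in `[0, 1] ->
          (Order.min (curve_length g 0 t) (curve_length g t 1)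
             <= (A * bdist D (g t))%:E)%E].

Definition arclength g (t : R) : R := fine (curve_length g 0 t).

(* Arc length parametrization on [0, arclength g 1].  All the [t] selected by
   [arclength g t = u] have the same image under [g], so that the choice made
   by [xget] is irrelevant. *)
Definition arcparam g (u : R) : E :=
  g (xget 0 [set t : R | t \in `[0, 1] /\ arclength g t = u]).

(* line integral of [f] along [g] with respect to arc length *)
Definition line_integral (f : E -> R) g : \bar R :=
  (\int[lebesgue_measure]_(u in `[0%R, arclength g 1])
     (f (arcparam g u))%:E)%E.

Definition quasihyp D (x y : D) : R :=
  fine (ereal_inf [set line_integral (fun z => (bdist D z)^-1) g
                  | g in [set g | curve_in D (set_val x) (set_val y) g
                                  /\ rectifiable g]]).

End Domains.

Section Gromov.
Context {R : realType} {T : Type}.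
Variable m : T -> T -> R.
Implicit Types (x y z w : T) (u v : nat -> T).

Definition gprod w x y : R := (m x w + m y w - m x y) / 2.

Definition hyperbolic (delta : R) : Prop :=
  forall x y z w,
    Num.min (gprod w x z) (gprod w z y) - delta <= gprod w x y.

(* For a metric [m] the next two conditions do not depend on [w]. *)
Definition gromov_seq u : Prop :=
  forall w, gprod w (u p.1) (u p.2) @[p --> (\oo, \oo)] --> +oo.

Definition gromov_equiv u v : Prop :=
  forall w, gprod w (u i) (v i) @[i --> \oo] --> +oo.

Definition gromov_class u : set (nat -> T) :=
  [set v | gromov_seq v /\ gromov_equiv u v].

Definition gboundary : Type :=
  set_type [set c | exists2 u, gromov_seq u & c = gromov_class u].

Definition seqs_of (xi : gboundary) : set (nat -> T) := set_val xi.

(* (x|xi)_w *)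
Definition gprod_pt w x (xi : gboundary) : \bar R :=
  ereal_inf [set limn_einf (fun i => (gprod w x (v i))%:E) | v in seqs_of xi].

(* (xi|zeta)_w *)
Definition gprod_bd w (xi zeta : gboundary) : \bar R :=
  ereal_inf [set limn_einf (fun i => (gprod w (p.1 i) (p.2 i))%:E)
            | p in seqs_of xi `*` seqs_of zeta].

(* (p|zeta)_w for p in the disjoint union of the space and its boundary *)
Definition gprod_ext w (p : T + gboundary) (zeta : gboundary) : \bar R :=
  match p with
  | inl x => gprod_pt w x zeta
  | inr xi => gprod_bd w xi zeta
  end.

(* At boundary points, replacing [w] by [w'] changes the products by at most
   [m w w'], so all base points yield the same neighbourhoods. *)
Definition nbhs_ext (p : T + gboundary) (U : set (T + gboundary)) : Prop :=
  match p with
  | inl x => exists2 r : R, 0 < r & forall y, m x y < r -> U (inl y)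
  | inr zeta => exists w (t : R),
      0 < t /\ forall q, (t%:E < gprod_ext w q zeta)%E -> U q
  end.

Definition busemann (xi : gboundary) w x : R :=
  fine (gprod_pt x w xi) - fine (gprod_pt w x xi).

Definition busemann_functions (xi : gboundary) : set (T -> R) :=
  range (busemann xi).

Definition bprod (b : T -> R) x y : R := (b x + b y - m x y) / 2.

Definition bprod_bd (b : T -> R) (xi1 xi2 : gboundary) : \bar R :=
  ereal_inf [set limn_einf (fun i => (bprod b (p.1 i) (p.2 i))%:E)
            | p in seqs_of xi1 `*` seqs_of xi2].

Definition rho (b : T -> R) (eps : R) (xi1 xi2 : gboundary) : R :=
  fine (expeR (- (eps%:E * bprod_bd b xi1 xi2))%E).

(* Hamenstaedt metric on the boundary with [xi] removed; the chains have to
   avoid [xi]. *)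
Definition hamenstadt (xi : gboundary) (b : T -> R) (eps : R)
    (xi1 xi2 : gboundary) : R :=
  inf [set s : R | exists (n : nat) (c : nat -> gboundary),
    [/\ (1 <= n)%N, c 0%N = xi1, c n = xi2,
        forall i, (i <= n)%N -> c i <> xi &
        s = \sum_(0 <= i < n) rho b eps (c i) (c i.+1)]].

End Gromov.

Definition admissible (R : realType) (delta eps : R) : Prop :=
  0 < eps /\ expR (22 * eps * delta) <= 2.

Section Quasisymmetry.
Context {R : realType}.

Definition dcontinuous (S S' : Type) (Y : set S) (s : S -> S -> R)
    (s' : S' -> S' -> R) (f : S -> S') : Prop :=
  forall x, Y x -> forall e : R, 0 < e -> exists2 d : R, 0 < d &
    forall y, Y y -> s x y < d -> s' (f x) (f y) < e.

Definition dhomeo (S S' : Type) (Y : set S) (s : S -> S -> R)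
    (Y' : set S') (s' : S' -> S' -> R) (f : S -> S') : Prop :=
  [/\ set_bij Y Y' f, dcontinuous Y s s' f &
      forall g : S' -> S, {in Y, cancel f g} -> dcontinuous Y' s' s g].

(* homeomorphism of [0, +oo[ onto itself *)
Definition gauge (eta : R -> R) : Prop :=
  dhomeo `[0, +oo[ (fun a c => `|a - c|) `[0, +oo[ (fun a c => `|a - c|) eta.

Definition quasisymmetric (S S' : Type) (eta : R -> R)
    (Y : set S) (s : S -> S -> R) (Y' : set S') (s' : S' -> S' -> R)
    (f : S -> S') : Prop :=
  dhomeo Y s Y' s' f /\
  forall (t : R) x y z, 0 < t -> Y x -> Y y -> Y z ->
    s x y <= t * s x z -> s' (f x) (f y) <= eta t * s' (f x) (f z).

End Quasisymmetry.

Section NaturalMaps.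
Context {R : realType} {E : completeNormedModType R} (D : set E).

(* Open sets of the closure of [D] with a point at infinity added; [None] is
   the point at infinity. *)
Definition open_infty (V : set (option E)) : Prop :=
  let V0 := [set x | V (Some x)] in
  V0 `<=` closure D /\
  ((~ V None /\ exists2 U, open U & V0 = U `&` closure D) \/
   (V None /\ closed (closure D `\` V0) /\ bounded_set (closure D `\` V0))).

Notation k := (@quasihyp R E D).

Definition extend_id (psi : gboundary k -> option E) (z : D + gboundary k) :
    option E :=
  match z with
  | inl x => Some (set_val x)
  | inr zeta => psi zeta
  end.

Definition natural_map (psi : gboundary k -> option E) : Prop :=
  (forall zeta z, psi zeta = Some z -> frontier D z) /\
  forall z V, open_infty V -> V (extend_id psi z) ->
    nbhs_ext z (extend_id psi @^-1` V).

(* The restriction of [psi] to the boundary minus [xi] takes finite values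
   and is [eta]-quasisymmetric onto the norm boundary of [D]. *)
Definition boundary_qs (psi : gboundary k -> option E) (xi : gboundary k)
    (b : D -> R) (eps : R) (eta : R -> R) : Prop :=
  exists f : gboundary k -> E,
    (forall zeta, zeta <> xi -> psi zeta = Some (f zeta)) /\
    quasisymmetric eta [set zeta | zeta <> xi] (hamenstadt xi b eps)
      (frontier D) (fun x y => `|x - y|) f.

End NaturalMaps.

(* Main.v *)
(* Write d for the distance to the boundary and r(x, y) = |x - y| + d(x) + d(y).

   If D is uniform, k(x, y) is at most a multiple of ln (r(x, y)^2 / (d(x) d(y))) plus
   a constant.  Hence k-geodesics rise to height r(x, y) and come down again (Gehring
   and Osgood), so that for o high above x, y and z with r(x, y) <= 2 r(x, z) the
   difference (x|y)_o - (x|z)_o of Gromov products is comparable, up to additive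
   constants, to ln r(x, z) - ln r(x, y).  This gives Gromov hyperbolicity; it identifies Gromov
   sequences with the sequences converging in norm to a boundary point or to infinity;
   and, since the products based at b are limits of products based at points tending to
   xi, it gives the quasisymmetry of the natural map.

   Conversely, every x is the origin of a near-geodesic ray x_i descending to a boundary
   point p_x with |x_i - p_x| <= 2 d(x_i).  Since dim E >= 2, two points of an annulus
   around a boundary point are either close for k, or the first is close for k to a
   point very near the boundary but far from the centre.  Together with the
   quasisymmetry condition this shows that (i) the ray of x followed by a geodesic
   from x to xi is a near-geodesic, (ii) r(x, y) <= M min(d(x), d(y)) bounds k(x, y),
   and (iii) moving a bounded k-distance from x towards xi multiplies d by at least 4.
   Climbing in this way from x and from y up to the height r(x, y), and joining the
   two tops, gives a uniform curve. *)

(* A Banach space need not be locally compact, so neither [k]-geodesics nor nearest boundary points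
   need exist. Finite chains replace geodesics: a curve whose integral is below S is cut into equal
   arcs whose discrete costs still sum to less than S, and a chain is turned back into a curve by
   segments. Rays aim at almost nearest boundary points, with steps of relative size 1/(i + 10): the
   sizes have infinite sum, so the boundary is reached; their squares have finite sum, so the ray
   stays near-geodesic.

   For uniform domains, most of the work needs only [k], the norm distance, the height d and a few
   inequalities between them, and is done for abstract functions. Base points high above all others
   are convenient since Gromov products behave there like - ln r, hence like a quasi-ultrametric;
   other base points follow by a change of base.

   In the converse, quasisymmetry enters only through two implications between ratios of norm
   distances and differences of Gromov products based at points tending to xi. All constants are
   explicit expressions in which D does not occur; this is what makes the theorem quantitative. *)
Require Import Defs.
From mathcomp Require Import ring lra measurable_realfun.

Set Implicit Arguments.
Unset Strict Implicit.
Unset Printing Implicit Defensive.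

Local Open Scope classical_set_scope.
Local Open Scope ring_scope.

(** * Length of curves *)

Section CurveLength.
Context {R : realType} {E : completeNormedModType R}.
Implicit Types (g : R -> E) (a b c t : R).

(** Recursion on the partition suits induction better than the [nth]-indexed sum in
    [curve_length]. *)
Fixpoint polylength g a s : R :=
  if s is x :: s' then `|g x - g a| + polylength g x s' else 0.

Lemma polylengthE g b a s :
  \sum_(0 <= i < size s) `|g (nth b (a :: s) i.+1) - g (nth b (a :: s) i)|
  = polylength g a s.
Proof.
elim: s a => [|x s IH] a /=; first by rewrite big_geq.
by rewrite big_nat_recl //= -IH.
Qed.

Lemma polylength_cat g a s1 s2 :
  polylength g a (s1 ++ s2) = polylength g a s1 + polylength g (last a s1) s2.
Proof. by elim: s1 a => [|x s IH] a /=; rewrite ?add0r // IH addrA. Qed.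

Lemma curve_length_ge g a b s : path <%R a s -> last a s = b ->
  ((polylength g a s)%:E <= curve_length g a b)%E.
Proof.
move=> ps lb; apply: ereal_sup_ubound; exists s; last by rewrite polylengthE.
by split => //; rewrite lb.
Qed.

Lemma curve_length_le g a b (M : \bar R) :
  (forall s, path <%R a s -> last a s = b -> ((polylength g a s)%:E <= M)%E) ->
  (curve_length g a b <= M)%E.
Proof.
move=> H; apply: ge_ereal_sup => _ [s [ps /eqP lb] <-].
by rewrite polylengthE; exact: H.
Qed.

Lemma path_last_le a s : path <%R a s -> a <= last a s.
Proof.
elim: s a => [|x s IH] a //= /andP[ax /IH]; exact/le_trans/ltW.
Qed.

Lemma curve_length_xx g a : curve_length g a a = 0%E.
Proof.
apply/eqP; rewrite eq_le; apply/andP; split; last first.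
  by rewrite -[leLHS]/((polylength g a [::])%:E) curve_length_ge.
apply: curve_length_le => -[|x s] //= /andP[ax ps] e; exfalso.
by have := path_last_le ps; rewrite e leNgt ax.
Qed.

Lemma curve_length_ge_dist g a b : a <= b ->
  (`|g b - g a|%:E <= curve_length g a b)%E.
Proof.
rewrite le_eqVlt => /predU1P[<-|ab]; first by rewrite subrr normr0 curve_length_xx.
have -> : `|g b - g a| = polylength g a [:: b] by rewrite /= addr0.
by apply: curve_length_ge => //=; rewrite ab.
Qed.

Lemma curve_length_ge0 g a b : a <= b -> (0 <= curve_length g a b)%E.
Proof. by move/(curve_length_ge_dist g); apply: le_trans; rewrite lee_fin. Qed.

(** Inserting [c] into a partition can only lengthen the inscribed polygon, by the triangle
    inequality; hence length is additive. *)
Lemma partition_split g a b c s : path <%R a s -> last a s = b ->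
  a <= c <= b -> exists s1 s2,
  [/\ path <%R a s1, last a s1 = c, path <%R c s2, last c s2 = b &
      polylength g a s <= polylength g a s1 + polylength g c s2].
Proof.
elim: s a => [|x s IH] a /=.
  move=> _ <- /andP[ac ca]; have {ca ac}<- : a = c by apply/eqP; rewrite eq_le ac.
  by exists [::], [::]; rewrite /= addr0.
move=> /andP[ax ps] lb /andP[ac cb]; have [cx|xc] := ltP c x.
  move: ac; rewrite le_eqVlt => /predU1P[<-|ac].
    by exists [::], (x :: s); split; rewrite //= ?ax // add0r.
  exists [:: c], (x :: s); split; rewrite //= ?ac ?cx // addr0 addrA lerD2r.
  by rewrite addrC -[g x - g a](subrKA (g c)) ler_normD.
have [|s1 [s2 [p1 l1 p2 l2 H]]] := IH x ps lb; first by rewrite xc.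
by exists (x :: s1), s2; split; rewrite //= ?ax // -addrA lerD2l.
Qed.

Lemma curve_lengthD g a b c : a <= c <= b ->
  curve_length g a b = (curve_length g a c + curve_length g c b)%E.
Proof.
move=> /andP[ac cb]; apply/eqP; rewrite eq_le; apply/andP; split.
  apply: curve_length_le => s ps lb.
  have [|s1 [s2 [p1 l1 p2 l2 H]]] := @partition_split g a b c s ps lb.
    by rewrite ac.
  apply: (@le_trans _ _ (polylength g a s1 + polylength g c s2)%:E).
    by rewrite lee_fin.
  by rewrite EFinD leeD // curve_length_ge.
have [/eqP ->|fin] := boolP (curve_length g a b == +oo%E); first by rewrite leey.
have ab := le_trans ac cb.
have [L eL] : exists L, curve_length g a b = L%:E.
  exists (fine (curve_length g a b)); rewrite fineK // ge0_fin_numE ?curve_length_ge0 //.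
  by rewrite lt_neqAle fin leey.
have H s1 s2 : path <%R a s1 -> last a s1 = c -> path <%R c s2 -> last c s2 = b ->
    polylength g a s1 + polylength g c s2 <= L.
  move=> p1 l1 p2 l2; rewrite -lee_fin -eL.
  have -> : polylength g a s1 + polylength g c s2 = polylength g a (s1 ++ s2).
    by rewrite polylength_cat l1.
  by apply: curve_length_ge; rewrite ?cat_path ?last_cat l1 ?p1.
have H2 s2 : path <%R c s2 -> last c s2 = b ->
    (curve_length g a c <= (L - polylength g c s2)%:E)%E.
  move=> p2 l2; apply: curve_length_le => s1 p1 l1.
  by rewrite lee_fin lerBrDr H.
(* Any single partition of [c, b] shows that the length over [a, c] is finite, so that it can be
   moved to the other side. *)
have [s0 [p0 l0]] : exists s0, path <%R c s0 /\ last c s0 = b.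
  move: cb; rewrite le_eqVlt => /predU1P[<-|cb]; first by exists [::].
  by exists [:: b]; rewrite /= cb.
have [L1 eL1] : exists L1, curve_length g a c = L1%:E.
  exists (fine (curve_length g a c)); rewrite fineK // ge0_fin_numE ?curve_length_ge0 //.
  by apply: le_lt_trans (H2 _ p0 l0) _; rewrite ltey.
rewrite eL1 eL -leeBrDl // -EFinB; apply: curve_length_le => s2 p2 l2.
by have := H2 _ p2 l2; rewrite eL1 !lee_fin; lra.
Qed.

Lemma curve_length_sub g a b c d : a <= c -> c <= d -> d <= b ->
  (curve_length g c d <= curve_length g a b)%E.
Proof.
move=> ac cd db; have ad := le_trans ac cd.
rewrite (@curve_lengthD g a b d) ?ad // (@curve_lengthD g a d c) ?ac //.
apply: (@le_trans _ _ (curve_length g a c + curve_length g c d)%E).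
  by rewrite leeDr // curve_length_ge0.
by rewrite leeDl // curve_length_ge0.
Qed.

Lemma curve_length_lip g a b (K : R) :
  (forall s t : R, a <= s -> s <= t -> t <= b -> `|g t - g s| <= K * (t - s)) ->
  a <= b -> (curve_length g a b <= (K * (b - a))%:E)%E.
Proof.
move=> H ab; apply: curve_length_le => s; rewrite lee_fin.
elim: s a ab H => [|x s IH] a ab H /=; first by move=> _ ->; rewrite subrr mulr0.
move=> /andP[ax ps] lb.
have xb : x <= b by rewrite -lb path_last_le.
have := IH x xb _ ps lb; have := H a x (lexx _) (ltW ax) xb => H1 H2.
have {}H2 := H2 (fun (s' t' : R) h => H s' t' (le_trans (ltW ax) h)).
have -> : K * (b - a) = K * (x - a) + K * (b - x) by ring.
exact: lerD.
Qed.

Lemma curve_length_eq g1 g2 a b :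
  (forall t, a <= t <= b -> g1 t = g2 t) -> curve_length g1 a b = curve_length g2 a b.
Proof.
have H (h1 h2 : R -> E) : (forall t, a <= t <= b -> h1 t = h2 t) ->
    (curve_length h1 a b <= curve_length h2 a b)%E.
  move=> e; apply: curve_length_le => s ps lb.
  apply: le_trans (@curve_length_ge h2 a b s ps lb); rewrite lee_fin.
  elim: s a ps lb e => [|x s IH] a //= /andP[ax ps] lb e.
  have xb : x <= b by rewrite -lb path_last_le.
  rewrite !e ?lexx ?xb ?(ltW ax) ?(le_trans (ltW ax)) // lerD2l IH // => t /andP[xt tb].
  by rewrite e // tb (le_trans (ltW ax)).
by move=> e; apply/eqP; rewrite eq_le !H // => t /e.
Qed.

Lemma curve_length_affine g (al be a b : R) : 0 < al ->
  curve_length (fun t => g (al * t + be)) a b = curve_length g (al * a + be) (al * b + be).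
Proof.
have H (h : R -> E) (al' be' a' b' : R) : 0 < al' -> (curve_length (fun t => h (al' * t + be')%R) a' b'
     <= curve_length h (al' * a' + be')%R (al' * b' + be')%R)%E.
  move=> al0; apply: curve_length_le => s ps lb.
  have [-> pt lt] : [/\ polylength (fun t => h (al' * t + be')) a' s =
      polylength h (al' * a' + be') (map (fun t => al' * t + be') s),
      path <%R (al' * a' + be') (map (fun t => al' * t + be') s) &
      last (al' * a' + be') (map (fun t => al' * t + be') s) = al' * b' + be'].
    elim: s a' ps lb => [|x s IH] a' /= => [_ -> //|/andP[ax ps] lb].
    by have [-> -> ->] := IH x ps lb; rewrite ltrD2r ltr_pM2l // ax.
  exact: curve_length_ge.
move=> al0; apply/eqP; rewrite eq_le H //=.
have al0' : 0 < al^-1 by rewrite invr_gt0.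
have := H (fun t => g (al * t + be)) al^-1 (- be / al) (al * a + be) (al * b + be) al0'.
have e t : al^-1 * (al * t + be) + - be / al = t.
  by have := lt0r_neq0 al0 => nz; field.
rewrite !e; apply: le_trans; rewrite le_eqVlt; apply/orP; left; apply/eqP.
by congr curve_length; apply/funext => t; congr g; have := lt0r_neq0 al0 => nz; field.
Qed.

Lemma curve_length_rev g (be a b : R) :
  curve_length (fun t => g (be - t)) a b = curve_length g (be - b) (be - a).
Proof.
have H (h : R -> E) (be' a' b' : R) : (curve_length (fun t => h (be' - t)%R) a' b'
     <= curve_length h (be' - b')%R (be' - a')%R)%E.
  apply: curve_length_le => s ps lb.
  have [s' [-> pt lt]] : exists s', [/\ polylength (fun t => h (be' - t)) a' s =
      polylength h (be' - b') s', path <%R (be' - b') s' &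
      last (be' - b') s' = be' - a'].
    elim: s a' ps lb => [|x s IH] a' /= => [_ ->|/andP[ax ps] lb].
      by exists [::].
    have [s' [-> pt lt]] := IH x ps lb; exists (rcons s' (be' - a')).
    rewrite -cats1 polylength_cat cat_path last_cat /= lt pt addr0 distrC addrC.
    by split => //=; rewrite andbT ltrD2l ltrN2.
  exact: curve_length_ge.
apply/eqP; rewrite eq_le H /=.
have := H (fun t => g (be - t)) be (be - b) (be - a); rewrite !subKr; apply: le_trans.
rewrite le_eqVlt; apply/orP; left; apply/eqP; congr curve_length.
by apply/funext => t; rewrite subKr.
Qed.

Lemma continuous_itvP g : {within `[0, 1]%classic, continuous g} <->
  forall t, 0 <= t <= 1 -> forall e : R, 0 < e -> exists2 d : R, 0 < d &
    forall s : R, 0 <= s <= 1 -> `|s - t| < d -> `|g s - g t| < e.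
Proof.
have mem t : `[0, 1]%classic t = (0 <= t <= 1) by rewrite /= in_itv.
split=> [/subspace_continuousP H t t01 e e0|H].
  have /cvgrPdist_lt /(_ _ e0) := H t (eq_ind_r id t01 (mem t)).
  rewrite /prop_near1 /= => /nbhs_ballP[d /= d0 B].
  exists d => // s s01 std; rewrite distrC; apply: (B s); last by rewrite in_itv.
  by rewrite -ball_normE /= distrC.
apply/subspace_continuousP => t; rewrite mem => t01; apply/cvgrPdist_lt => e e0.
have [d d0 B] := H t t01 e e0; apply/nbhs_ballP; exists d => // s.
by rewrite -ball_normE /= in_itv /= => st s01; rewrite distrC B // distrC.
Qed.

Section RectifiableCurve.
Variable g : R -> E.
Hypothesis gr : rectifiable g.

Lemma curve_length_arclength s t : 0 <= s -> s <= t -> t <= 1 ->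
  curve_length g s t = (arclength g t - arclength g s)%:E.
Proof.
move=> s0 st t1.
have fin u v : 0 <= u -> u <= v -> v <= 1 -> curve_length g u v \is a fin_num.
  move=> u0 uv v1; rewrite ge0_fin_numE ?curve_length_ge0 //.
  exact: le_lt_trans (curve_length_sub g u0 uv v1) gr.
have s1 := le_trans st t1; have t0 := le_trans s0 st.
have -> : arclength g t = fine (curve_length g 0 s) + fine (curve_length g s t).
  by rewrite -fineD ?fin // /arclength (@curve_lengthD g 0 t s) ?s0.
by rewrite /arclength addrC addKr fineK ?fin.
Qed.

Lemma arclength0 : arclength g 0 = 0.
Proof. by rewrite /arclength curve_length_xx. Qed.

Lemma dist_le_arclength s t : 0 <= s -> s <= t -> t <= 1 ->
  `|g t - g s| <= arclength g t - arclength g s.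
Proof.
by move=> s0 st t1; rewrite -lee_fin -curve_length_arclength // curve_length_ge_dist.
Qed.

Lemma arclength_homo s t : 0 <= s -> s <= t -> t <= 1 ->
  arclength g s <= arclength g t.
Proof.
by move=> s0 st t1; rewrite -subr_ge0; apply: le_trans (dist_le_arclength s0 st t1).
Qed.

Hypothesis gc : {within `[0, 1]%classic, continuous g}.
Notation L := (arclength g).

(** If the polygon through [sq] misses at most [e] of the length, every arc inside one cell exceeds
    its chord by at most [e], because the defects of all other pieces are non-negative. At a
    partition point the two adjacent cells are treated separately. Together with the continuity of
    [g] this gives the continuity of arc length. *)
Lemma arclength_near_chord (e a : R) sq t0 : 0 <= a <= 1 ->
  path <%R a sq -> last a sq = 1 -> L 1 - L a <= polylength g a sq + e ->
  a <= t0 <= 1 -> exists2 d : R, 0 < d & forall t, a <= t <= 1 -> `|t - t0| < d ->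
    `|L t - L t0| <= `|g t - g t0| + e.
Proof.
elim: sq a => [|x sq IH] a /andP[a0 a1] /=.
  move=> _ a1'; rewrite -a1' subrr add0r => e0 /andP[at0 t0a].
  exists 1 => // t /andP[at1 ta] _.
  have -> : t = a by apply/eqP; rewrite eq_le ta.
  have -> : t0 = a by apply/eqP; rewrite eq_le t0a.
  by rewrite !subrr !normr0 add0r.
move=> /andP[ax ps] lb Le /andP[at0 t01].
have x1 : x <= 1 by rewrite -lb path_last_le.
have x0 : 0 <= x := le_trans a0 (ltW ax).
have H1 : polylength g x sq <= L 1 - L x.
  by rewrite -lee_fin -curve_length_arclength // curve_length_ge.
have H2 := dist_le_arclength a0 (ltW ax) x1.
have cell u v : a <= u -> u <= v -> v <= x -> L v - L u <= `|g v - g u| + e.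
  move=> au uv vx.
  have h1 := dist_le_arclength a0 au (le_trans uv (le_trans vx x1)).
  have h2 := dist_le_arclength (le_trans a0 (le_trans au uv)) vx x1.
  have h3 : `|g x - g a| <= `|g x - g v| + (`|g v - g u| + `|g u - g a|).
    rewrite -(subrKA (g v)) (le_trans (ler_normD _ _)) // lerD2l.
    by rewrite -(subrKA (g u)) (le_trans (ler_normD _ _)).
  lra.
have cell' u v : a <= u <= x -> a <= v <= x -> `|L v - L u| <= `|g v - g u| + e.
  move=> /andP[au ux] /andP[av vx]; have [uv|vu] := leP u v.
    rewrite ger0_norm ?cell // subr_ge0 arclength_homo //.
      exact: le_trans au.
    exact: le_trans x1.
  rewrite distrC (distrC (g v)) ger0_norm ?cell // ?(ltW vu) // subr_ge0.
  by apply: arclength_homo (ltW vu) _; [exact: le_trans av|exact: le_trans x1].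
have [t0x|xt0] := ltP t0 x.
  exists (x - t0); first by rewrite subr_gt0.
  move=> t /andP[at_ t1] tt; apply: cell'; rewrite ?at0 ?at_ ?(ltW t0x) //=.
  by move: tt; rewrite ltr_norml => /andP[_]; lra.
have [|||d d0 Hd] := IH x _ ps lb _ _; rewrite ?x0 ?x1 ?xt0 //; first lra.
exists (if t0 == x then d else Num.min d (t0 - x)).
  by case: eqVneq => // nx; rewrite lt_min d0 subr_gt0 lt_neqAle eq_sym nx.
move=> t /andP[at_ t1]; have [e0|nx] := eqVneq t0 x => td.
  have [tx|xt] := leP x t; first by apply: Hd; rewrite ?tx.
  by apply: cell'; rewrite ?e0 ?lexx ?(ltW ax) ?at_ ?(ltW xt).
move: td; rewrite lt_min => /andP[td tx]; apply: Hd => //; rewrite t1 andbT.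
by move: tx; rewrite ltr_norml => /andP[+ _]; lra.
Qed.

Lemma arclength_continuous t0 (e : R) : 0 <= t0 <= 1 -> 0 < e ->
  exists2 d : R, 0 < d & forall t, 0 <= t <= 1 -> `|t - t0| < d -> `|L t - L t0| < e.
Proof.
move=> t01 e0; have e2 : 0 < e / 2 by rewrite divr_gt0.
have [sq [ps lb H]] : exists sq, [/\ path <%R 0 sq, last 0 sq = 1 &
    L 1 - L 0 <= polylength g 0 sq + e / 2].
  apply: contrapT => H.
  have : (curve_length g 0 1 <= (L 1 - e / 2)%:E)%E.
    apply: curve_length_le => s ps lb; rewrite lee_fin leNgt; apply/negP => h.
    by apply: H; exists s; split => //; rewrite arclength0; lra.
  by rewrite curve_length_arclength ?lexx ?ler01 // arclength0 lee_fin; lra.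
have [|d d0 Hd] := arclength_near_chord _ ps lb H t01; rewrite ?lexx ?ler01 //.
have [d' d'0 Hd'] := (continuous_itvP g).1 gc t0 t01 _ e2.
exists (Num.min d d'); first by rewrite lt_min d0.
move=> t t01'; rewrite lt_min => /andP[/(Hd _ t01') h1 /(Hd' _ t01')]; lra.
Qed.

Lemma arclength_attained u : 0 <= u <= L 1 -> exists2 t, 0 <= t <= 1 & L t = u.
Proof.
move=> /andP[u0 uL].
pose A := [set t | 0 <= t <= 1 /\ L t <= u].
have A0 : A 0 by split; rewrite ?lexx ?ler01 ?arclength0.
have hA : has_sup A by split; [exists 0|exists 1 => t [/andP[]]].
have s0 : 0 <= sup A by apply: ub_le_sup => //; case: hA.
have s1 : sup A <= 1 by apply: ge_sup; [exists 0|move=> t [/andP[]]].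
have s01 : 0 <= sup A <= 1 by rewrite s0.
exists (sup A) => //; apply/eqP; rewrite eq_le; apply/andP; split; rewrite leNgt; apply/negP => h.
  have [|d d0 Hd] := @arclength_continuous (sup A) (L (sup A) - u) s01; first by rewrite subr_gt0.
  have [t [t01 Lt] ht] := sup_adherent d0 hA.
  have ts : t <= sup A by apply: ub_le_sup; [case: hA|].
  have := Hd t t01; rewrite distrC ger0_norm ?subr_ge0 //.
  rewrite ltr_norml => /(_ _)/andP[]; lra.
have [|d d0 Hd] := @arclength_continuous (sup A) (u - L (sup A)) s01; first by rewrite subr_gt0.
have s1' : sup A < 1.
  by rewrite lt_neqAle s1 andbT; apply/eqP => e; move: h; rewrite e; lra.
pose t := Num.min 1 (sup A + d / 2).
have st : sup A < t by rewrite lt_min s1'; lra.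
have t01 : 0 <= t <= 1 by rewrite (le_trans s0 (ltW st)) /= ge_min lexx.
suff : t <= sup A by rewrite leNgt st.
apply: ub_le_sup; first by case: hA.
split => //; have td : t <= sup A + d / 2 by rewrite ge_min lexx orbT.
have := Hd t t01; rewrite ger0_norm ?subr_ge0; last exact: ltW.
rewrite ltr_norml => /(_ _)/andP[]; lra.
Qed.

Lemma arcparamP u : 0 <= u <= L 1 -> exists2 t, 0 <= t <= 1 & L t = u /\ arcparam g u = g t.
Proof.
move=> /arclength_attained[t t01 Lt].
have [|t'01 Lt'] := @xgetPex _ 0 [set t : R | t \in `[0, 1] /\ arclength g t = u].
  by exists t; split; rewrite ?in_itv.
by eexists; last (split; [exact: Lt'|reflexivity]); move: t'01; rewrite in_itv.
Qed.

Lemma arcparam_lip u v : 0 <= u <= L 1 -> 0 <= v <= L 1 ->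
  `|arcparam g u - arcparam g v| <= `|u - v|.
Proof.
move=> /arcparamP[t /andP[t0 t1] [<- ->]] /arcparamP[s /andP[s0 s1] [<- ->]].
have [ts|/ltW st] := leP t s; last first.
  by apply: le_trans (ler_norm _); exact: dist_le_arclength.
by rewrite distrC (distrC (L t)); apply: le_trans (ler_norm _); exact: dist_le_arclength.
Qed.

Lemma arcparam_arclength t : 0 <= t <= 1 -> arcparam g (L t) = g t.
Proof.
move=> /andP[t0 t1].
have [|s /andP[s0 s1] [Ls ->]] := @arcparamP (L t).
  by rewrite -{1}arclength0 !arclength_homo ?lexx.
apply/eqP; rewrite -subr_eq0 -normr_le0; have [ts|/ltW st] := leP t s.
  by apply: le_trans (dist_le_arclength t0 ts s1) _; rewrite Ls subrr.
by rewrite distrC; apply: le_trans (dist_le_arclength s0 st t1) _; rewrite Ls subrr.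
Qed.

End RectifiableCurve.
End CurveLength.

(** * Integrals along curves *)

Section LineIntegral.
Context {R : realType} {E : completeNormedModType R}.
Implicit Types (f : E -> R) (g : R -> E) (a b c t u v : R).

(** Certificates for upper bounds of the line integral: each piece contributes a bound for [f] times
    a bound for the length. They are stable under concatenation, reversal and affine
    reparametrization, so the triangle inequality for [k] needs no change of variables in a Lebesgue
    integral. *)
Inductive upper_sum f g : R -> R -> R -> Prop :=
| UpperSum1 a b M l : a <= b -> 0 <= M -> (forall t, a <= t <= b -> f (g t) <= M) ->
    (curve_length g a b <= l%:E)%E -> upper_sum f g a b (M * l)
| UpperSumD a c b S T : upper_sum f g a c S -> upper_sum f g c b T ->
    upper_sum f g a b (S + T).

Lemma upper_sum_le f g a b S : upper_sum f g a b S -> a <= b.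
Proof. by elim=> // {a b S} a c b S T _ ac _; exact: le_trans. Qed.

Lemma upper_sum_fin f g a b S : upper_sum f g a b S -> (curve_length g a b < +oo)%E.
Proof.
elim=> {a b S} [a b M l ab _ _|a c b S T /upper_sum_le ac h1 /upper_sum_le cb h2].
  by move/le_lt_trans; apply; rewrite ltey.
by rewrite (@curve_lengthD _ _ g a b c) ?ac // lte_add_pinfty.
Qed.

Lemma upper_sum_affine f g1 g2 al be a b S : 0 < al ->
  upper_sum f g1 a b S -> forall a' b', a = al * a' + be -> b = al * b' + be ->
  (forall t, a' <= t <= b' -> g2 t = g1 (al * t + be)) -> upper_sum f g2 a' b' S.
Proof.
move=> al0; elim=> {a b S} [a b M l ab M0 Mf gl|a c b S T h1 IH1 h2 IH2] a' b' ea eb e.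
  have a'b' : a' <= b' by move: ab; rewrite ea eb lerD2r ler_pM2l.
  constructor => //.
    by move=> t /[dup] /e -> /andP[t1 t2]; apply: Mf; rewrite ea eb !lerD2r !ler_pM2l ?t1.
  by rewrite (curve_length_eq e) curve_length_affine // -ea -eb.
have [ac cb] := (upper_sum_le h1, upper_sum_le h2).
pose c' := (c - be) / al.
have ec : c = al * c' + be by have := lt0r_neq0 al0 => nz; rewrite /c'; field.
have a'c' : a' <= c' by move: ac; rewrite ea ec lerD2r ler_pM2l.
have c'b' : c' <= b' by move: cb; rewrite eb ec lerD2r ler_pM2l.
apply: (@UpperSumD _ _ _ c'); [apply: IH1|apply: IH2] => // t /andP[t1 t2]; apply: e.
  by rewrite t1 (le_trans t2).
by rewrite t2 (le_trans a'c').
Qed.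

Lemma upper_sum_rev f g be a b S :
  upper_sum f g a b S -> upper_sum f (fun t => g (be - t)) (be - b) (be - a) S.
Proof.
elim=> {a b S} [a b M l ab M0 Mf gl|a c b S T h1 IH1 h2 IH2]; last first.
  by rewrite (addrC S); apply: UpperSumD IH2 IH1.
constructor => //; first by rewrite lerD2l lerN2.
  by move=> t /andP[t1 t2]; apply: Mf; lra.
by rewrite curve_length_rev !subKr.
Qed.

Definition concat g1 g2 t := if t <= 1/2 then g1 (2 * t) else g2 (2 * t - 1).

Lemma concatl g1 g2 t : t <= 1/2 -> concat g1 g2 t = g1 (2 * t).
Proof. by rewrite /concat => ->. Qed.

Lemma concatr g1 g2 t : g1 1 = g2 0 -> 1/2 <= t -> concat g1 g2 t = g2 (2 * t - 1).
Proof.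
move=> e; rewrite le_eqVlt => /predU1P[<-|h].
  by rewrite concatl // mulrCA divff // mulr1 e subrr.
by rewrite /concat leNgt h.
Qed.

Lemma concat_continuous g1 g2 : g1 1 = g2 0 ->
  {within `[0, 1]%classic, continuous g1} -> {within `[0, 1]%classic, continuous g2} ->
  {within `[0, 1]%classic, continuous (concat g1 g2)}.
Proof.
move=> e12 /continuous_itvP c1 /continuous_itvP c2; apply/continuous_itvP => t /andP[t0 t1] e e0.
have H1 : exists2 d : R, 0 < d & forall s, 0 <= s <= 1/2 -> `|s - t| < d ->
    t <= 1/2 -> `|concat g1 g2 s - concat g1 g2 t| < e.
  have [t2|t2] := leP t (1/2); last by exists 1 => // *; lra.
  have [|d d0 Hd] := c1 (2 * t) _ e e0; first lra.
  exists (d/2); first lra.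
  move=> s /andP[s0 s2]; rewrite ltr_norml => /andP[h1 h2] _; rewrite !concatl //; apply: Hd; first lra.
  by rewrite ltr_norml; apply/andP; split; lra.
have H2 : exists2 d : R, 0 < d & forall s, 1/2 <= s <= 1 -> `|s - t| < d ->
    1/2 <= t -> `|concat g1 g2 s - concat g1 g2 t| < e.
  have [t2|t2] := leP (1/2) t; last by exists 1 => // *; lra.
  have [|d d0 Hd] := c2 (2 * t - 1) _ e e0; first lra.
  exists (d/2); first lra.
  move=> s /andP[s0 s2]; rewrite ltr_norml => /andP[h1 h2] _; rewrite !concatr //; apply: Hd; first lra.
  by rewrite ltr_norml; apply/andP; split; lra.
have [d1 d10 {}H1] := H1; have [d2 d20 {}H2] := H2.
(* Away from 1/2 this radius keeps [s] in the same half of the interval as [t]. *)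
pose d3 := if t == 1/2 then 1 else `|t - 1/2|.
have d30 : 0 < d3 by rewrite /d3; case: eqVneq => // nt; rewrite normr_gt0 subr_eq0.
exists (Num.min d3 (Num.min d1 d2)); first by rewrite !lt_min d10 d20 d30.
move=> s /andP[s0 s1]; rewrite !lt_min => /and3P[h3 h1 h2].
have : (s <= 1/2 /\ t <= 1/2) \/ (1/2 <= s /\ 1/2 <= t).
  move: h3; rewrite /d3; case: eqVneq => [-> _|nt].
    by have [h|/ltW h] := leP s (1/2); [left|right].
  rewrite ltr_norml => /andP[ha hb]; have [h|h] := leP t (1/2).
    by left; split => //; move: hb; rewrite ler0_norm; lra.
  by right; split; [move: ha; rewrite gtr0_norm; lra|lra].
by case=> -[hs ht]; [apply: H1|apply: H2]; rewrite ?s0 ?s1 ?hs.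
Qed.

Lemma upper_sum_concat f g1 g2 S T : g1 1 = g2 0 ->
  upper_sum f g1 0 1 S -> upper_sum f g2 0 1 T -> upper_sum f (concat g1 g2) 0 1 (S + T).
Proof.
move=> e12 h1 h2; apply: (@UpperSumD _ _ _ (1/2)).
  apply: (@upper_sum_affine f g1 _ 2 0 _ _ _ _ h1); [lra|lra|lra|] => t /andP[_ t2].
  by rewrite concatl // addr0.
apply: (@upper_sum_affine f g2 _ 2 (-1) _ _ _ _ h2); [lra|lra|lra|] => t /andP[t1 _].
by rewrite concatr.
Qed.

Lemma curve_length_concatl g1 g2 t : 0 <= t -> t <= 1/2 ->
  curve_length (concat g1 g2) 0 t = curve_length g1 0 (2 * t).
Proof.
move=> t0 t2; transitivity (curve_length (fun s => g1 (2 * s + 0)) 0 t).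
  by apply: curve_length_eq => s /andP[_ s2]; rewrite addr0 concatl // (le_trans s2).
by rewrite curve_length_affine // mulr0 !addr0.
Qed.

Lemma curve_length_concatr g1 g2 t u : g1 1 = g2 0 -> 1/2 <= t ->
  curve_length (concat g1 g2) t u = curve_length g2 (2 * t - 1) (2 * u - 1).
Proof.
move=> e t0; transitivity (curve_length (fun s => g2 (2 * s + -1)) t u).
  by apply: curve_length_eq => s /andP[s1 _]; rewrite concatr // (le_trans t0).
by rewrite curve_length_affine.
Qed.

Section Integral.
Variables (f : E -> R) (g : R -> E) (c : R).
Hypothesis gr : rectifiable g.
Hypothesis gc : {within `[0, 1]%classic, continuous g}.
Hypothesis f0 : forall t, 0 <= t <= 1 -> 0 <= f (g t).
Hypothesis f_lip : forall s t, 0 <= s <= 1 -> 0 <= t <= 1 ->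
  `|f (g s) - f (g t)| <= c * `|g s - g t|.
Notation L := (arclength g).
Notation I a b := (\int[lebesgue_measure]_(u in `[a, b]%classic) (f (arcparam g u))%:E)%E.

Lemma arcparam_sub a b u : 0 <= a -> a <= b -> b <= 1 -> L a <= u <= L b ->
  exists2 t, a <= t <= b & arcparam g u = g t.
Proof.
move=> a0 ab b1 /andP[au ub].
have L0 : 0 <= L a by rewrite -(arclength0 g) arclength_homo // (le_trans ab).
have L1 : L b <= L 1 by rewrite arclength_homo // (le_trans a0).
have [|t /andP[t0 t1] [Lt ->]] := arcparamP gr gc (u := u).
  by rewrite (le_trans L0 au) (le_trans ub).
(* The parameter selected by [arcparam] may lie outside [a, b]; then [g] has no length between it
   and the nearer endpoint, which can replace it. *)
have [ta|at_] := ltP t a.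
  exists a; first by rewrite lexx.
  apply/eqP; rewrite eq_sym -subr_eq0 -normr_le0.
  by apply: le_trans (dist_le_arclength gr t0 (ltW ta) (le_trans ab b1)) _; lra.
have [bt|tb] := ltP b t; last by exists t; rewrite ?at_.
exists b; first by rewrite ab lexx.
apply/eqP; rewrite -subr_eq0 -normr_le0.
by apply: le_trans (dist_le_arclength gr (le_trans a0 ab) (ltW bt) t1) _; lra.
Qed.

Lemma arc_nonneg u : 0 <= u <= L 1 -> 0 <= f (arcparam g u).
Proof. by move=> /(arcparamP gr gc)[t t01 [_ ->]]; exact: f0. Qed.

Lemma arc_measurable a b : 0 <= a -> b <= L 1 ->
  measurable_fun `[a, b]%classic (fun u => f (arcparam g u)).
Proof.
move=> a0 b1; have c0 : 0 <= Num.max c 1 by rewrite le_max ler01 orbT.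
have m1 : 0 < Num.max c 1 by rewrite lt_max ltr01 orbT.
apply: subspace_continuous_measurable_fun => //.
apply/subspace_continuousP => u uab; apply/cvgrPdist_lt => e e0.
apply/nbhs_ballP; exists (e / Num.max c 1); first by rewrite /= divr_gt0.
move=> v; rewrite -ball_normE /= => uv vab.
have sub w : w \in `[a, b] -> 0 <= w <= L 1.
  by rewrite in_itv /= => /andP[h1 h2]; rewrite (le_trans a0 h1) (le_trans h2).
have [s s01 [_ es]] := arcparamP gr gc (sub _ uab).
have [t t01 [_ et]] := arcparamP gr gc (sub _ vab).
have h := arcparam_lip gr gc (sub _ uab) (sub _ vab).
change (`|f (arcparam g u) - f (arcparam g v)| < e).
rewrite es et; apply: le_lt_trans (f_lip s01 t01) _; rewrite -es -et.
apply: (@le_lt_trans _ _ (Num.max c 1 * `|u - v|)).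
  by apply: le_trans (ler_wpM2l c0 h); rewrite ler_wpM2r // le_max lexx.
by move: uv; rewrite ltr_pdivlMr // mulrC.
Qed.

Lemma arc_integralD a b u : 0 <= a -> a <= u -> u <= b -> b <= L 1 ->
  I a b = (I a u + I u b)%E.
Proof.
move=> a0 au ub bL.
have m := arc_measurable a0 bL.
have e : `[a, b]%classic = `[a, u]%classic `|` `]u, b]%classic :> set R.
  by rewrite -itv_bndbnd_setU // bnd_simp.
rewrite {1}e ge0_integral_setU //=; last 3 first.
- by rewrite -e; apply/measurable_EFinP.
- move=> x xab; have {xab} : `[a, b]%classic x by rewrite e.
  rewrite /= in_itv /= => /andP[h1 h2]; rewrite lee_fin arc_nonneg //.
  by rewrite (le_trans a0 h1) (le_trans h2).
- apply/disj_setPS => x [] /=; rewrite !in_itv /= => /andP[_ h1] /andP[h2 _].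
  by move: h1; rewrite leNgt h2.
congr (_ + _)%E; apply: integral_itv_obnd_cbnd; apply/measurable_EFinP.
apply: (@measurable_funS _ _ _ _ `[u, b]%classic) => //.
  by apply: subset_itvr; rewrite bnd_simp.
by apply: arc_measurable => //; exact: le_trans au.
Qed.

Lemma arc_integral_cst a b (M : R) : a <= b ->
  (\int[lebesgue_measure]_(u in `[a, b]%classic) M%:E)%E = (M * (b - a))%:E.
Proof.
move=> ab; rewrite integral_cst //= lebesgue_measure_itv /= lte_fin.
move: ab; rewrite le_eqVlt => /predU1P[->|->]; last by [].
by rewrite ltxx subrr mulr0 mule0.
Qed.

Lemma arc_integral_le a b M : 0 <= a -> a <= b -> b <= L 1 ->
  (forall u, a <= u <= b -> f (arcparam g u) <= M) -> (I a b <= (M * (b - a))%:E)%E.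
Proof.
move=> a0 ab bL H; rewrite -arc_integral_cst //; apply: ge0_le_integral => //=.
- move=> x; rewrite in_itv /= => /andP[h1 h2]; rewrite lee_fin arc_nonneg //.
  by rewrite (le_trans a0 h1) (le_trans h2).
- by apply/measurable_EFinP; exact: arc_measurable.
Qed.

Lemma arc_integral_ge a b M : 0 <= M -> 0 <= a -> a <= b -> b <= L 1 ->
  (forall u, a <= u <= b -> M <= f (arcparam g u)) -> ((M * (b - a))%:E <= I a b)%E.
Proof.
move=> M0 a0 ab bL H; rewrite -arc_integral_cst //; apply: ge0_le_integral => //=.
- by apply/measurable_EFinP; exact: arc_measurable.
Qed.

Lemma arc_integral_ge0 a b : 0 <= a -> b <= L 1 -> (0 <= I a b)%E.
Proof.
move=> a0 bL; apply: integral_ge0 => x; rewrite /= in_itv /= => /andP[h1 h2].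
by rewrite lee_fin arc_nonneg // (le_trans a0 h1) (le_trans h2).
Qed.

Lemma upper_sum_integral a b S : upper_sum f g a b S -> 0 <= a -> b <= 1 ->
  (I (L a) (L b) <= S%:E)%E.
Proof.
have L0 t : 0 <= t -> t <= 1 -> 0 <= L t.
  by move=> t0 t1; rewrite -(arclength0 g) arclength_homo.
have L1 t : 0 <= t -> t <= 1 -> L t <= L 1 by move=> t0 t1; rewrite arclength_homo.
elim=> {a b S} [a b M l ab M0 Mf gl|a u b S T h1 IH1 h2 IH2] a0 b1.
  have a1 := le_trans ab b1; have b0 := le_trans a0 ab.
  have Lab : L a <= L b by exact: arclength_homo.
  apply: (@le_trans _ _ (M * (L b - L a))%:E).
    apply: arc_integral_le; rewrite ?L0 ?L1 // => v vab.
    by have [t tab ->] := arcparam_sub a0 ab b1 vab; exact: Mf.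
  rewrite lee_fin ler_wpM2l // -lee_fin -curve_length_arclength //.
have [au ub] := (upper_sum_le h1, upper_sum_le h2).
have u0 := le_trans a0 au; have u1 := le_trans ub b1.
have a1 := le_trans au u1; have b0 := le_trans u0 ub.
rewrite (@arc_integralD _ _ (L u)) ?L0 ?L1 ?(arclength_homo gr) //.
by rewrite EFinD leeD ?IH1 ?IH2.
Qed.

End Integral.
End LineIntegral.

(** * The distance to the boundary of a domain *)

Section BoundaryDistance.
Context {R : realType} {E : completeNormedModType R}.
Implicit Types (D : set E) (x y z p : E).

Lemma closureP_dist (A : set E) x :
  closure A x <-> forall e : R, 0 < e -> exists2 y, A y & `|x - y| < e.
Proof.
split=> [cl e e0|H].
  by have [y [Ay]] := cl _ (nbhsx_ballx x e e0); rewrite -ball_normE /=; exists y.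
move=> B /nbhs_ballP[e /= e0 eB]; have [y Ay xy] := H e e0.
by exists y; split => //; apply: eB; rewrite -ball_normE.
Qed.

Lemma openP_dist (A : set E) x : open A -> A x ->
  exists2 e : R, 0 < e & forall y, `|x - y| < e -> A y.
Proof.
move=> oA Ax; have /nbhs_ballP[e /= e0 eB] := open_nbhs_nbhs (conj oA Ax).
by exists e => // y xy; apply: eB; rewrite -ball_normE.
Qed.

Lemma frontier_open D p : open D -> frontier D p <->
  (forall e : R, 0 < e -> exists2 y, D y & `|p - y| < e) /\ ~ D p.
Proof.
move=> oD; rewrite /frontier (interior_id _).1 //.
by split=> [[/closureP_dist]|[/closureP_dist]].
Qed.

(** The supremum of the parameters up to which the segment stays in [D] gives the boundary point: it
    is a limit of points of [D], and if it lay in the open set [D], the segment would stay in [D] a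
    little longer. *)
Lemma segment_frontier D x y : open D -> D x -> ~ D y ->
  exists2 s : R, 0 <= s <= 1 & frontier D (x + s *: (y - x)).
Proof.
move=> oD Dx Dy; pose h (s : R) := x + s *: (y - x).
have hB s t : h s - h t = (s - t) *: (y - x).
  by rewrite /h opprD addrACA subrr add0r -scalerBl.
pose A := [set s : R | 0 <= s <= 1 /\ forall t, 0 <= t <= s -> D (h t)].
have A0 : A 0.
  split; rewrite ?lexx ?ler01 // => t /andP[t0 t0'].
  have -> : t = 0 by apply/eqP; rewrite eq_le t0'.
  by rewrite /h scale0r addr0.
have hA : has_sup A by split; [exists 0|exists 1 => s [/andP[]]].
have s0 : 0 <= sup A by apply: ub_le_sup => //; case: hA.
have s1 : sup A <= 1 by apply: ge_sup; [exists 0|move=> s [/andP[]]].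
have nyx : 0 < `|y - x|.
  by rewrite normr_gt0 subr_eq0; apply/eqP => e; apply: Dy; rewrite e.
have below t : 0 <= t -> t < sup A -> D (h t).
  move=> t0 ts; have [|u [u01 Hu] tu] := @sup_adherent _ A (sup A - t) _ hA.
    by rewrite subr_gt0.
  by apply: Hu; rewrite t0 /=; lra.
exists (sup A); first by rewrite s0.
apply/frontier_open => //; split.
  move=> e e0; exists (h (Num.max 0 (sup A - e / 2 / `|y - x|))).
    have [->|sn] := eqVneq (sup A) 0.
      rewrite max_l; first by rewrite /h scale0r addr0.
      by rewrite sub0r oppr_le0 !divr_ge0 ?ltW.
    have sp : 0 < sup A by rewrite lt_neqAle eq_sym sn.
    apply: below; first by rewrite le_max lexx.
    by rewrite gt_max sp /= ltrBlDr ltrDl !divr_gt0.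
  rewrite -/(h _) hB normrZ -ltr_pdivlMr // ger0_norm; last first.
    rewrite subr_ge0 ge_max s0 /= lerBlDr lerDl !divr_ge0 ?ltW //.
  rewrite ltrBlDr -ltrBlDl lt_max; apply/orP; right.
  rewrite ltrD2l ltrN2 ltr_pM2r ?invr_gt0 //; lra.
rewrite -/(h _) => Dh.
have sl1 : sup A < 1.
  rewrite lt_neqAle s1 andbT; apply/eqP => e; apply: Dy.
  by move: Dh; rewrite e /h scale1r addrC subrK.
have [e e0 He] := openP_dist oD Dh.
pose t := Num.min 1 (sup A + e / 2 / `|y - x|).
have st : sup A < t by rewrite lt_min sl1 ltrDl !divr_gt0.
suff : t <= sup A by rewrite leNgt st.
apply: ub_le_sup; first by case: hA.
split; first by rewrite (le_trans s0 (ltW st)) ge_min lexx.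
move=> u /andP[u0 ut]; have [us|su] := ltP u (sup A); first exact: below.
apply: He; rewrite hB normrZ -ltr_pdivlMr // distrC ger0_norm ?subr_ge0 //.
have : u <= sup A + e / 2 / `|y - x| by apply: le_trans ut _; rewrite ge_min lexx orbT.
move=> hu; apply: (@le_lt_trans _ _ (e / 2 / `|y - x|)); first lra.
by rewrite ltr_pM2r ?invr_gt0 //; lra.
Qed.

Lemma bounded_setP (A : set E) : bounded_set A <-> exists M : R, forall x, A x -> `|x| <= M.
Proof.
split=> [[M [_ H]]|[M H]]; first by exists (M + 1); apply: H; rewrite ltrDl.
exists M; split; first exact: num_real.
by move=> N MN x /H h; apply: le_trans (ltW MN).
Qed.

Section Domain.
Variable D : set E.
Hypothesis uD : unbounded_domain D.
Notation d := (bdist D).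

Let oD : open D. Proof. by case: uD. Qed.

Lemma domain_neq0 : D !=set0.
Proof.
case: uD => _ _ _ ub; apply/set0P/negP => /eqP D0; apply: ub; rewrite D0.
by apply/bounded_setP; exists 0.
Qed.

Lemma frontier_neq0 : frontier D !=set0.
Proof.
have [x Dx] := domain_neq0; have [y Dy] : exists y, ~ D y.
  apply: contrapT => H; case: uD => _ _ /eqP + _; apply.
  by rewrite -subTset => y _; apply: contrapT => Dy; apply: H; exists y.
by have [s _ fs] := segment_frontier oD Dx Dy; exists (x + s *: (y - x)).
Qed.

Let hI x : has_inf [set `|x - z| | z in frontier D].
Proof.
have [p fp] := frontier_neq0; split; first by exists `|x - p|, p.
by exists 0 => _ [z _ <-].
Qed.

Lemma bdist_le x p : frontier D p -> d x <= `|x - p|.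
Proof. by move=> fp; apply: ge_inf; [case: (hI x)|exists p]. Qed.

Lemma bdist_ge0 x : 0 <= d x.
Proof. by apply: lb_le_inf; [case: (hI x)|move=> _ [z _ <-]]. Qed.

Lemma bdist_approx x (e : R) : 0 < e -> exists2 p, frontier D p & `|x - p| < d x + e.
Proof. by move=> e0; have [_ [p fp <-] h] := inf_adherent e0 (hI x); exists p. Qed.

Lemma bdist_lip x y : d x <= d y + `|x - y|.
Proof.
apply/ler_addgt0Pr => e e0; have [p fp h] := bdist_approx y e0.
apply: le_trans (bdist_le x fp) _; rewrite -(subrKA y).
by apply: le_trans (ler_normD _ _) _; lra.
Qed.

Lemma bdist_frontier p : frontier D p -> d p = 0.
Proof.
move=> fp; apply/eqP; rewrite eq_le bdist_ge0 andbT.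
by apply: le_trans (bdist_le p fp) _; rewrite subrr normr0.
Qed.

Lemma bdist_gt0 x : D x -> 0 < d x.
Proof.
move=> Dx; have [e e0 He] := openP_dist oD Dx; apply: (lt_le_trans e0).
apply: lb_le_inf; first by case: (hI x).
move=> _ [z fz <-]; rewrite leNgt; apply/negP => h.
by have [_ +] := (frontier_open _ oD).1 fz; apply; exact: He.
Qed.

Lemma domain_ball x y : D x -> `|x - y| < d x -> D y.
Proof.
move=> Dx h; apply: contrapT => Dy; have [s /andP[s0 s1] fs] := segment_frontier oD Dx Dy.
have := bdist_le x fs; rewrite opprD addrA subrr add0r normrN normrZ ger0_norm //.
rewrite distrC leNgt => /negP; apply; apply: le_lt_trans h.
by rewrite ler_piMl.
Qed.

Lemma frontier_of_limit p : (forall e : R, 0 < e -> exists2 y, D y & `|p - y| < e /\ d y < e) ->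
  frontier D p.
Proof.
move=> H; apply/frontier_open => //; split=> [e /H[y Dy [h _]]|Dp]; first by exists y.
have dp := bdist_gt0 Dp; have [|y Dy [h1 h2]] := H (d p / 2); first by rewrite divr_gt0.
by have := bdist_lip p y; lra.
Qed.

Lemma domain_far (M : R) : exists2 x, D x & M < `|x|.
Proof.
apply: contrapT => H; case: uD => _ _ _; apply; apply/bounded_setP; exists M => x Dx.
by rewrite leNgt; apply/negP => h; apply: H; exists x.
Qed.

(** Certified upper bounds for [k]. Unlike an infimum they can be concatenated and reversed
    directly; [quasihyp_le] and [quasihyp_lt_qh_le] translate to [k] and back. *)
Definition qh_le x y (S : R) := exists g, curve_in D x y g /\
  upper_sum (fun z => (d z)^-1) g 0 1 S.

Lemma curve_in_concat x y z g1 g2 : curve_in D x y g1 -> curve_in D y z g2 ->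
  curve_in D x z (concat g1 g2).
Proof.
move=> [c1 g10 g11 D1] [c2 g20 g21 D2]; have e : g1 1 = g2 0 by rewrite g11.
split; [exact: concat_continuous| | |].
- by rewrite concatl ?divr_ge0 // mulr0.
- by rewrite concatr // ?mulr1 ?ler_pdivrMr ?mul1r ?ler1n // -[2 - 1]/(1 + 1 - 1) addrK.
- move=> t; rewrite in_itv /= => /andP[t0 t1]; have [h|/ltW h] := leP t (1 / 2).
    by rewrite concatl //; apply: D1; rewrite in_itv /=; lra.
  by rewrite concatr //; apply: D2; rewrite in_itv /=; lra.
Qed.

Lemma curve_in_rev x y g : curve_in D x y g -> curve_in D y x (fun t => g (1 - t)).
Proof.
move=> [/continuous_itvP gc g0 g1 Dg]; split; rewrite ?subrr ?subr0 //; last first.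
  by move=> t; rewrite in_itv /= => t01; apply: Dg; rewrite in_itv /=; lra.
apply/continuous_itvP => t t01 e e0; have [|c c0 Hc] := gc (1 - t) _ e e0; first lra.
exists c => // s s01 st; apply: Hc; first lra.
have -> : 1 - s - (1 - t) = - (s - t) by ring.
by rewrite normrN.
Qed.

Lemma segment_curve x y : D x -> `|x - y| < d x -> exists g, [/\ curve_in D x y g,
  forall s t : R, s <= t -> (curve_length g s t <= (`|x - y| * (t - s))%:E)%E &
  forall t, 0 <= t <= 1 -> `|x - g t| <= `|x - y|].
Proof.
move=> Dx h; pose g (t : R) := x + t *: (y - x).
have hB s t : g s - g t = (s - t) *: (y - x).
  by rewrite /g opprD addrACA subrr add0r -scalerBl.
have g0 : g 0 = x by rewrite /g scale0r addr0.
have g1 : g 1 = y by rewrite /g scale1r addrC subrK.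
have lip s t : `|g s - g t| = `|s - t| * `|x - y| by rewrite hB normrZ (distrC x).
have xg t : 0 <= t <= 1 -> `|x - g t| <= `|x - y|.
  move=> /andP[t0 t1]; rewrite -{1}g0 lip sub0r normrN ger0_norm //.
  by rewrite ler_piMl.
exists g; split => //; last first.
  move=> s t st; apply: curve_length_lip => // a b _ ab _.
  by rewrite lip mulrC ger0_norm // subr_ge0.
split => //.
  apply/continuous_itvP => t t01 e e0; have n0 : 0 < `|x - y| + 1 by rewrite ltr_wpDl.
  exists (e / (`|x - y| + 1)); first by rewrite divr_gt0.
  move=> s s01; rewrite lip ltr_pdivlMr // => h1; apply: le_lt_trans h1.
  by rewrite ler_wpM2l // lerDl.
move=> t; rewrite in_itv /= => t01; apply: (domain_ball Dx).
exact: le_lt_trans (xg t t01) h.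
Qed.

Lemma qh_le_trans x y z S T : qh_le x y S -> qh_le y z T -> qh_le x z (S + T).
Proof.
move=> [g1 [c1 h1]] [g2 [c2 h2]]; exists (concat g1 g2).
split; first exact: curve_in_concat c1 c2.
by apply: upper_sum_concat => //; case: c1 => _ _ -> _; case: c2.
Qed.

Lemma qh_le_sym x y S : qh_le x y S -> qh_le y x S.
Proof.
move=> [g [gi h]]; exists (fun t => g (1 - t)); split; first exact: curve_in_rev.
by have := upper_sum_rev 1 h; rewrite subrr subr0.
Qed.

Lemma qh_le_segment x y S : D x -> `|x - y| < d x ->
  `|x - y| / (d x - `|x - y|) <= S -> qh_le x y S.
Proof.
move=> Dx h hS; have [g [gi gl xg]] := segment_curve Dx h; exists g; split => //.
have dp : 0 < d x - `|x - y| by rewrite subr_gt0.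
(* The first factor bounds 1/d on the segment, the second its length. *)
have -> : S = (d x - `|x - y|)^-1 * (S * (d x - `|x - y|)).
  by rewrite mulrC mulfK // lt0r_neq0.
constructor; rewrite ?ler01 ?invr_ge0 ?(ltW dp) //.
  move=> t t01; rewrite lef_pV2 ?posrE //.
    by have := bdist_lip x (g t); have := xg t t01; lra.
  by have := bdist_lip x (g t); have := xg t t01; lra.
apply: le_trans (gl 0 1 ler01) _.
by rewrite subr0 mulr1 lee_fin -ler_pdivrMr.
Qed.

(** Connectedness: the points reachable from [x] form a set that is open and closed in [D], since
    every point is joined by segments to the points near it. *)
Lemma qh_le_ex x y : D x -> D y -> exists S, qh_le x y S.
Proof.
move=> Dx Dy; pose B := [set y | D y /\ exists S, qh_le x y S].
suff : B = D by move=> e; have [] : B y by rewrite e.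
case: uD => _ cD _ _; apply: cD.
- exists x; split=> //; exists 0; apply: qh_le_segment => //; rewrite ?subrr ?normr0.
    exact: bdist_gt0.
  by rewrite mul0r.
- exists B; last by apply/seteqP; split => [z Bz|z [_]] //; split=> //; case: Bz.
  rewrite openE => z [Dz [S hS]]; apply/nbhs_ballP; exists (d z); first exact: bdist_gt0.
  move=> w; rewrite -ball_normE /= => zw; split; first exact: (domain_ball Dz).
  by eexists; apply: qh_le_trans hS (qh_le_segment Dz zw (lexx _)).
- exists (closure B); first exact: closed_closure.
  apply/seteqP; split=> [z Bz|z [Dz /closureP_dist cl]].
    by split; [case: Bz|exact: subset_closure].
  have dz := bdist_gt0 Dz; have [|w [Dw [S hS]] zw] := cl (d z / 2); first by rewrite divr_gt0.
  split => //; have h : `|w - z| < d w by rewrite distrC; have := bdist_lip z w; lra.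
  by eexists; apply: qh_le_trans hS (qh_le_segment Dw h (lexx _)).
Qed.

Lemma inv_bdist_lip c x y : 0 < c -> c <= d x -> c <= d y ->
  `|(d x)^-1 - (d y)^-1| <= c^-1 * c^-1 * `|x - y|.
Proof.
move=> c0 cx cy; have x0 := lt_le_trans c0 cx; have y0 := lt_le_trans c0 cy.
have nx := lt0r_neq0 x0; have ny := lt0r_neq0 y0.
have -> : (d x)^-1 - (d y)^-1 = (d y - d x) * ((d x)^-1 * (d y)^-1) by field; rewrite nx ny.
have i0 : 0 <= (d x)^-1 * (d y)^-1 by rewrite mulr_ge0 ?invr_ge0 ?bdist_ge0.
rewrite normrM mulrC (ger0_norm i0); apply: ler_pM => //.
  by apply: ler_pM; rewrite ?invr_ge0 ?bdist_ge0 // lef_pV2 ?posrE.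
rewrite ler_norml; have := bdist_lip x y; have := bdist_lip y x; rewrite distrC; lra.
Qed.

(** By compactness of [0, 1]; it makes 1/d bounded and Lipschitz along the curve, as the integral
    estimates require. *)
Lemma curve_bdist_min x y g : curve_in D x y g ->
  exists2 c : R, 0 < c & forall t, 0 <= t <= 1 -> c <= d (g t).
Proof.
move=> [/continuous_itvP gc _ _ Dg].
have [|t t01 Ht] := @EVT_min R (fun t => d (g t)) 0 1 ler01.
  apply/subspace_continuousP => t; rewrite /= in_itv /= => t01; apply/cvgrPdist_lt => e e0.
  have [c c0 Hc] := gc t t01 e e0; apply/nbhs_ballP; exists c => // s.
  rewrite -ball_normE /= in_itv /= => st s01.
  have := Hc s s01; rewrite distrC => /(_ st); rewrite distrC => h.
  change (`|d (g t) - d (g s)| < e); rewrite ltr_norml.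
  by have := bdist_lip (g t) (g s); have := bdist_lip (g s) (g t); rewrite (distrC (g s)); lra.
exists (d (g t)); first by apply: bdist_gt0; exact: Dg.
by move=> s s01; apply: Ht; rewrite in_itv.
Qed.

Lemma qh_le_integral x y S : qh_le x y S -> exists g,
  [/\ curve_in D x y g, rectifiable g & (line_integral (fun z => (d z)^-1)%R g <= S%:E)%E].
Proof.
move=> [g [gi h]]; exists g; have gr : rectifiable g by exact: upper_sum_fin h.
split => //; have [gc _ _ _] := gi; have [c c0 Hc] := curve_bdist_min gi.
rewrite /line_integral -{1}(arclength0 g).
apply: (@upper_sum_integral _ _ (fun z => (d z)^-1) g (c^-1 * c^-1)) => //.
  by move=> t /Hc h0; rewrite invr_ge0 (le_trans (ltW c0)).
by move=> s t /Hc hs /Hc ht; exact: inv_bdist_lip.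
Qed.

(** The converse of [upper_sum_integral]. The curve is cut into [n] arcs of equal length [l]. Since
    d is 1-Lipschitz, an arc starting at [c i] contributes at least l / (d + l) to the integral, and
    this differs from l / (d - l) only to second order in [l]. The strict inequality leaves room for
    the total error once [n] is large. *)
Lemma line_integral_chain x y g S h : curve_in D x y g -> rectifiable g ->
  (line_integral (fun z => (d z)^-1)%R g < S%:E)%E -> 0 < h ->
  exists n (c : nat -> E) (l : R),
  [/\ c 0%N = x, c n = y, forall i, D (c i),
      forall i, (i < n)%N -> `|c i - c i.+1| <= l /\ l <= h * d (c i) &
      0 <= l /\ \sum_(0 <= i < n) l / (d (c i) - l) < S].
Proof.
move=> gi gr gS h0; have [gc g0 g1 Dg] := gi; have [c c0 Hc] := curve_bdist_min gi.
set L := arclength g 1.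
have L0 : 0 <= L by rewrite -(arclength0 g) arclength_homo.
set F := fun u => (d (arcparam g u))^-1.
have Fc u : 0 <= u <= L -> c <= d (arcparam g u) /\ D (arcparam g u).
  by move=> /(arcparamP gr gc)[t t01 [_ ->]]; split; [exact: Hc|exact: Dg].
pose I a b := (\int[lebesgue_measure]_(u in `[a, b]%classic) (F u)%:E)%E.
have F0 t : 0 <= t <= 1 -> 0 <= (d (g t))^-1.
  by move=> /Hc hh; rewrite invr_ge0 (le_trans (ltW c0)).
have Flip s t : 0 <= s <= 1 -> 0 <= t <= 1 ->
    `|(d (g s))^-1 - (d (g t))^-1| <= c^-1 * c^-1 * `|g s - g t|.
  by move=> /Hc hs /Hc ht; exact: inv_bdist_lip.
have ID a b u : 0 <= a -> a <= u -> u <= b -> b <= L -> I a b = (I a u + I u b)%E.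
  exact: (@arc_integralD _ _ (fun z => (d z)^-1) g _ gr gc F0 Flip).
have Ige a b M : 0 <= M -> 0 <= a -> a <= b -> b <= L ->
    (forall u, a <= u <= b -> M <= F u) -> ((M * (b - a))%:E <= I a b)%E.
  exact: (@arc_integral_ge _ _ (fun z => (d z)^-1) g _ gr gc Flip).
have [s0 sI] : exists s0 : R, line_integral (fun z => (d z)^-1)%R g = s0%:E.
  exists (fine (line_integral (fun z => (d z)^-1)%R g)); rewrite fineK //.
  rewrite ge0_fin_numE; first exact: lt_trans gS (ltey _).
  exact: (@arc_integral_ge0 _ _ (fun z => (d z)^-1) g gr gc F0).
have s0S : s0 < S by rewrite -lte_fin -sI.
(* The bound 1/4 gives [l <= c / 4], so that d - l and d + l stay comparable to d. *)
pose h1 := Num.min h (1/4).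
have h10 : 0 < h1 by rewrite lt_min h0 /= divr_gt0.
have [n nP] : exists n : nat, [/\ (0 < n)%N, L / n%:R <= h1 * c &
    3 * L * (L / n%:R) / c ^+ 2 < S - s0].
  pose X := L / (h1 * c) + 3 * L * L / c ^+ 2 / (S - s0) + 1.
  exists (Num.truncn X).+1; have hX := truncnS_gt X.
  have n0 : 0 < (Num.truncn X).+1%:R :> R by [].
  have hA : 0 <= L / (h1 * c).
    by rewrite divr_ge0 // mulr_ge0 // ltW.
  have sp : 0 < S - s0 by rewrite subr_gt0.
  have c2 : 0 < c ^+ 2 by rewrite exprn_gt0.
  have hB : 0 <= 3 * L * L / c ^+ 2 / (S - s0).
    by rewrite !divr_ge0 ?(ltW sp) ?(ltW c2) // ?mulr_ge0.
  split => //.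
    rewrite ler_pdivrMr // mulrC -ler_pdivrMr ?mulr_gt0 //.
    by move: hX; rewrite /X; lra.
  have -> : 3 * L * (L / (Num.truncn X).+1%:R) / c ^+ 2 = 3 * L * L / c ^+ 2 / (Num.truncn X).+1%:R.
    by rewrite mulrA mulrAC.
  rewrite ltr_pdivrMr // [ltRHS]mulrC -ltr_pdivrMr //.
  by move: hX; rewrite /X; lra.
have [n0 nh nS] := nP; pose l := L / n%:R.
have nR : 0 < n%:R :> R by rewrite ltr0n.
have l0 : 0 <= l by rewrite divr_ge0 // ltW.
have lc : l <= c / 4.
  apply: le_trans nh _; rewrite mulrC ler_wpM2l ?(ltW c0) //.
  by rewrite /h1 ge_min; apply/orP; right; lra.
(* The chain must lie in [D] at every index, so the parameter is truncated at [L]; up to index [n]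
   the truncation has no effect. *)
pose p i := arcparam g (Num.min L (i%:R * l)).
have pr i : 0 <= Num.min L (i%:R * l) <= L.
  by rewrite le_min L0 ge_min lexx mulr_ge0.
have pin i : (i <= n)%N -> Num.min L (i%:R * l) = i%:R * l.
  move=> ni; apply: min_r; rewrite /l mulrCA ler_piMr // ler_pdivrMr // mul1r ler_nat //.
have nl : n%:R * l = L by rewrite /l mulrC divfK // lt0r_neq0.
exists n, p, l; split.
- have := arcparam_arclength gr gc (t := 0); rewrite arclength0 lexx ler01 g0 => <- //.
  by rewrite /p mul0r min_r.
- by rewrite /p pin // nl arcparam_arclength ?lexx ?ler01.
- by move=> i; case: (Fc _ (pr i)).
- move=> i ni; split.
    apply: le_trans (arcparam_lip gr gc (pr i) (pr i.+1)) _.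
    rewrite !pin ?(ltnW ni) // -mulrBl -opprB -natrB // subSnn normrM normrN normr1 mul1r.
    by rewrite ger0_norm.
  apply: le_trans nh _; apply: ler_pM; rewrite ?(ltW h10) ?(ltW c0) //.
    by rewrite /h1 ge_min lexx.
  by have [] := Fc _ (pr i).
split => //.
(* The error per arc is 2 l^2 / (d^2 - l^2), at most 3 l^2 / c^2 because l <= c / 4 and d >= c; as n
   l = L, the errors sum to 3 L l / c^2. *)
have key i : (i <= n)%N -> ((\sum_(0 <= j < i) l / (d (p j) - l) - i%:R * (3 * l * l / c ^+ 2))%:E
    <= I 0%R (i%:R * l)%R)%E.
  elim: i => [|i IH] ni.
    rewrite big_geq // !mul0r subr0; exact: (@arc_integral_ge0 _ _ (fun z => (d z)^-1) g gr gc F0).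
  have ilL : i.+1%:R * l <= L by rewrite -nl ler_wpM2r // ler_nat.
  have ile : i%:R * l <= i.+1%:R * l by rewrite ler_wpM2r // ler_nat.
  rewrite (ID _ _ (i%:R * l)) ?mulr_ge0 //.
  rewrite big_nat_recr //=.
  have -> : \sum_(0 <= j < i) l / (d (p j) - l) + l / (d (p i) - l) - i.+1%:R * (3 * l * l / c ^+ 2)
   = (\sum_(0 <= j < i) l / (d (p j) - l) - i%:R * (3 * l * l / c ^+ 2)) +
     (l / (d (p i) - l) - 3 * l * l / c ^+ 2).
    by rewrite -natr1; ring.
  rewrite EFinD leeD ?(IH (ltnW ni)) //.
  have [cpi _] := Fc _ (pr i); rewrite -/(p i) in cpi.
  apply: le_trans (Ige _ _ (d (p i) + l)^-1 _ _ _ _ _); rewrite ?mulr_ge0 ?invr_ge0 //.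
  - have -> : i.+1%:R * l - i%:R * l = l by rewrite -mulrBl -natrB // subSnn mul1r.
    rewrite lee_fin; have q1 : 0 < d (p i) - l by lra.
    have q2 : 0 < d (p i) + l by lra.
    rewrite -subr_ge0.
    have -> : (d (p i) + l)^-1 * l - (l / (d (p i) - l) - 3 * l * l / c ^+ 2) =
      l * l * (3 * ((d (p i) - l) * (d (p i) + l)) - 2 * c ^+ 2) /
      ((d (p i) - l) * (d (p i) + l) * c ^+ 2).
      by field; rewrite !lt0r_neq0.
    rewrite divr_ge0 ?mulr_ge0 ?(ltW q1) ?(ltW q2) ?exprn_ge0 ?(ltW c0) //.
    nra.
  - by have := bdist_ge0 (p i); lra.
  - move=> u /andP[u1 u2].
    have uL : 0 <= u <= L by rewrite (le_trans _ u1) ?mulr_ge0 // (le_trans u2).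
    have [cu _] := Fc _ uL; rewrite /F lef_pV2 ?posrE; last 2 first.
    + by lra.
    + by lra.
    have := bdist_lip (arcparam g u) (p i).
    have := arcparam_lip gr gc uL (pr i); rewrite -/(p i) pin ?(ltnW ni) //.
    rewrite (ger0_norm (x := u - _)) ?subr_ge0 //.
    by move: u2; rewrite -natr1 mulrDl mul1r; lra.
have := key n (leqnn n); rewrite nl.
have -> : I 0%R L = s0%:E by rewrite -sI.
rewrite lee_fin.
have -> : n%:R * (3 * l * l / c ^+ 2) = 3 * L * l / c ^+ 2 by rewrite -nl; ring.
by move: nS; rewrite -/l; lra.
Qed.

End Domain.
End BoundaryDistance.

(** * The quasihyperbolic metric *)

Section QuasihyperbolicMetric.
Context {R : realType} {E : completeNormedModType R}.
Variable D : set E.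
Hypothesis uD : unbounded_domain D.
Notation k := (@quasihyp R E D).
Notation d := (bdist D).
Implicit Types x y z : D.

Let V (x : D) : E := set_val x.
Let DV x : D (V x). Proof. exact: set_valP. Qed.

Let inf_ge0 x y : (0 <= ereal_inf [set line_integral (fun p => (d p)^-1)%R g
  | g in [set g | curve_in D (V x) (V y) g /\ rectifiable g]])%E.
Proof.
apply: le_ereal_inf_tmp => _ [g [gi gr] <-].
have [gc _ _ Dg] := gi; have [c c0 Hc] := curve_bdist_min uD gi.
apply: (@arc_integral_ge0 _ _ (fun p => (d p)^-1) g gr gc) => //.
by move=> t /Hc h; rewrite invr_ge0 (le_trans (ltW c0)).
Qed.

Lemma quasihyp_le x y S : qh_le D (V x) (V y) S -> k x y <= S.
Proof.
move=> /(qh_le_integral uD)[g [gi gr gS]].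
have h : (ereal_inf [set line_integral (fun p => (d p)^-1)%R g
    | g in [set g | curve_in D (V x) (V y) g /\ rectifiable g]] <= S%:E)%E.
  by apply: le_trans gS; apply: ereal_inf_lbound; exists g.
rewrite -lee_fin /quasihyp fineK // ge0_fin_numE ?inf_ge0 //.
exact: le_lt_trans h (ltey _).
Qed.

Lemma quasihyp_ge0 x y : 0 <= k x y.
Proof. by apply: fine_ge0; exact: inf_ge0. Qed.

Lemma quasihyp_lt x y S : k x y < S -> exists g,
  [/\ curve_in D (V x) (V y) g, rectifiable g & (line_integral (fun p => (d p)^-1)%R g < S%:E)%E].
Proof.
move=> kS; have [T /(qh_le_integral uD)[g [gi gr gT]]] := qh_le_ex uD (DV x) (DV y).
have : (ereal_inf [set line_integral (fun p => (d p)^-1)%R g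
    | g in [set g | curve_in D (V x) (V y) g /\ rectifiable g]] < S%:E)%E.
  rewrite -[ltLHS]fineK ?lte_fin // ge0_fin_numE ?inf_ge0 //.
  apply: (@le_lt_trans _ _ T%:E); last exact: ltey.
  by apply: le_trans gT; apply: ereal_inf_lbound; exists g.
by move/ereal_inf_lt => [_ [g' [gi' gr'] <-] h]; exists g'.
Qed.

Lemma quasihyp_chain x y S h : k x y < S -> 0 < h ->
  exists n (c : nat -> D) (l : R),
  [/\ c 0%N = x, c n = y,
      forall i, (i < n)%N -> `|V (c i) - V (c i.+1)| <= l /\ l <= h * d (V (c i)) &
      0 <= l /\ \sum_(0 <= i < n) l / (d (V (c i)) - l) < S].
Proof.
move=> /quasihyp_lt[g [gi gr gS]] h0.
have [n [c [l [c0 cn Dc Hc HS]]]] := line_integral_chain uD gi gr gS h0.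
exists n, (fun i => SigSub (mem_set (Dc i))), l.
by split => //; apply: val_inj.
Qed.

Lemma quasihyp_segment x y : `|V x - V y| < d (V x) ->
  k x y <= `|V x - V y| / (d (V x) - `|V x - V y|).
Proof. by move=> h; apply: quasihyp_le; exact: (qh_le_segment uD (DV x)). Qed.

Lemma quasihyp_small x y : `|V x - V y| <= d (V x) / 2 -> k x y <= 1.
Proof.
have dx := bdist_gt0 uD (DV x) => h.
apply: le_trans (quasihyp_segment _) _; first lra.
by rewrite ler_pdivrMr; lra.
Qed.

Lemma quasihypxx x : k x x = 0.
Proof.
apply/eqP; rewrite eq_le quasihyp_ge0 andbT; apply: le_trans (quasihyp_segment _) _.
  by rewrite subrr normr0 bdist_gt0.
by rewrite subrr normr0 mul0r.
Qed.

Lemma chain_step l (a b : E) h : 0 <= l -> h < 1 -> D a -> `|a - b| <= l -> l <= h * d a ->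
  `|a - b| < d a /\ `|a - b| / (d a - `|a - b|) <= l / (d a - l).
Proof.
move=> l0 h1 Da ab lh; have da := bdist_gt0 uD Da.
have ld : l < d a by apply: le_lt_trans lh _; rewrite gtr_pMl.
split; first exact: le_lt_trans ab ld.
apply: ler_pM => //; first by rewrite invr_ge0 subr_ge0 (le_trans ab) // ltW.
by rewrite lef_pV2 ?posrE; lra.
Qed.

Lemma quasihyp_lt_qh_le x y S : k x y < S -> qh_le D (V x) (V y) S.
Proof.
move=> kS; have [|n [c [l [c0 cn Hc [l0 HS]]]]] := @quasihyp_chain x y S (1/2) kS.
  by rewrite divr_gt0.
have key i : (i <= n)%N ->
    qh_le D (V x) (V (c i)) (\sum_(0 <= j < i) l / (d (V (c j)) - l)).
  elim: i => [|i IH] ni.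
    rewrite c0; apply: qh_le_segment => //; rewrite ?subrr ?normr0 ?bdist_gt0 //.
    by rewrite mul0r big_geq.
  rewrite big_nat_recr //=; apply: qh_le_trans (IH (ltnW ni)) _.
  have [h1 h2] := Hc i ni.
  have [|h3 h4] := chain_step l0 _ (DV (c i)) h1 h2; first lra.
  exact: qh_le_segment h4.
have := key n (leqnn n); rewrite cn.
move: HS; set T := \sum_(_ <= _ < _) _ => TS hT.
have -> : S = T + (S - T) by rewrite addrC subrK.
apply: qh_le_trans hT _; apply: qh_le_segment => //; rewrite ?subrr ?normr0 ?bdist_gt0 //.
by rewrite mul0r subr_ge0 ltW.
Qed.

Lemma quasihyp_sym x y : k x y = k y x.
Proof.
have H a b : k a b <= k b a.
  apply/ler_addgt0Pr => e e0; apply: quasihyp_le; apply: qh_le_sym.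
  by apply: quasihyp_lt_qh_le; rewrite ltrDl.
by apply/eqP; rewrite eq_le !H.
Qed.

Lemma quasihyp_triangle y x z : k x z <= k x y + k y z.
Proof.
apply/ler_addgt0Pr => e e0; have e2 : 0 < e / 2 by rewrite divr_gt0.
have -> : k x y + k y z + e = (k x y + e / 2) + (k y z + e / 2) by lra.
by apply: quasihyp_le; apply: (@qh_le_trans _ _ _ _ (V y)); apply: quasihyp_lt_qh_le; rewrite ltrDl.
Qed.

(** A discrete Gronwall argument. Along a chain the quantity d(x) + |x - c_i| is at least d(c_i), so
    a step of length l multiplies it by at most 1 + l / (d(c_i) - l), which is at most the
    exponential of the cost of that step. *)
Lemma quasihyp_dist x y : `|V x - V y| <= (expR (k x y) - 1) * d (V x).
Proof.
have dx := bdist_gt0 uD (DV x).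
suff H S : k x y < S -> d (V x) + `|V x - V y| <= d (V x) * expR S.
  have q0 : 0 < (d (V x) + `|V x - V y|) / d (V x) by rewrite divr_gt0 // ltr_wpDr.
  have : ln ((d (V x) + `|V x - V y|) / d (V x)) <= k x y.
    apply/ler_addgt0Pr => e e0; rewrite -ler_expR lnK ?posrE //.
    by rewrite ler_pdivrMr // mulrC H // ltrDl.
  rewrite -ler_expR lnK ?posrE // ler_pdivrMr // => h.
  by rewrite mulrBl mul1r; lra.
move=> kS; have [|n [c [l [c0 cn Hc [l0 HS]]]]] := @quasihyp_chain x y S (1/2) kS.
  by rewrite divr_gt0.
have key i : (i <= n)%N -> d (V x) + `|V x - V (c i)| <=
    d (V x) * expR (\sum_(0 <= j < i) l / (d (V (c j)) - l)).
  elim: i => [|i IH] ni.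
    by rewrite c0 subrr normr0 addr0 big_geq // expR0 mulr1.
  have {}IH := IH (ltnW ni); have [h1 h2] := Hc i ni.
  rewrite big_nat_recr //= expRD mulrA.
  set F := _ * expR (\sum_(_ <= _ < _) _) in IH *; set q := l / _.
  have dci := bdist_gt0 uD (DV (c i)).
  have q1 : 0 < d (V (c i)) - l by lra.
  have q0 : 0 <= q by rewrite divr_ge0 // ltW.
  have lF : l <= q * F.
    apply: (@le_trans _ _ (q * (d (V (c i)) - l))); first by rewrite divfK // lt0r_neq0.
    rewrite ler_wpM2l //; have := bdist_lip uD (V (c i)) (V x); rewrite distrC; lra.
  apply: (@le_trans _ _ (F * (1 + q))); last first.
    rewrite ler_wpM2l ?expR_ge1Dx //; apply: le_trans IH; rewrite addr_ge0 // ltW //.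
  have : `|V x - V (c i.+1)| <= `|V x - V (c i)| + `|V (c i) - V (c i.+1)|.
    by rewrite -{1}(subrKA (V (c i))) ler_normD.
  by rewrite mulrDr mulr1 (mulrC F); lra.
have := key n (leqnn n); rewrite cn => /le_trans; apply.
by rewrite ler_wpM2l ?(ltW dx) // ler_expR ltW.
Qed.

(** Here [t] is the accumulated cost along a chain whose total cost is below [k x y + h]. No
    subchain costs less than the [k]-distance of its ends, so the excess [h] of the whole chain
    bounds the excess of each subchain. *)
Lemma quasihyp_geodesic x y h : 0 < h -> exists n (c : nat -> D) (t : nat -> R),
  [/\ c 0%N = x, c n = y,
      forall i j, (i <= j <= n)%N -> k (c i) (c j) <= t j - t i <= k (c i) (c j) + h &
      forall i, (i < n)%N -> t i.+1 <= t i + h].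
Proof.
move=> h0; pose h1 := Num.min (1/2) (h/2).
have h10 : 0 < h1 by rewrite lt_min !divr_gt0.
have [|n [c [l [c0 cn Hc [l0 HS]]]]] := @quasihyp_chain x y (k x y + h) h1 _ h10.
  by rewrite ltrDl.
pose t i := \sum_(0 <= j < i) l / (d (V (c j)) - l).
have step i : (i < n)%N -> k (c i) (c i.+1) <= t i.+1 - t i.
  move=> ni; have [a1 a2] := Hc i ni.
  have [|b1 b2] := chain_step l0 _ (DV (c i)) a1 a2.
    by rewrite gt_min; apply/orP; left; lra.
  rewrite /t big_nat_recr //= addrAC subrr add0r; apply: le_trans b2.
  exact: quasihyp_segment.
have upper i j : (i <= j <= n)%N -> k (c i) (c j) <= t j - t i.
  move=> /andP[ij jn]; elim: j ij jn => [|j IH] ij jn.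
    by move: ij; rewrite leqn0 => /eqP ->; rewrite quasihypxx subrr.
  move: ij; rewrite leq_eqVlt => /predU1P[->|ij]; first by rewrite quasihypxx subrr.
  apply: le_trans (quasihyp_triangle (c j) _ _) _.
  by have := IH ij (ltnW jn); have := step j jn; lra.
exists n, c, t; split => //.
- move=> i j /andP[ij jn]; rewrite upper ?ij //=.
  have := upper 0%N i; rewrite (leq_trans ij jn) /= => /(_ isT).
  have := upper j n; rewrite jn leqnn /= => /(_ isT).
  have t0 : t 0%N = 0 by rewrite /t big_geq.
  have := quasihyp_triangle (c i) x y; have := quasihyp_triangle (c j) (c i) y.
  by move: HS; rewrite -/(t n) c0 cn t0; lra.
- move=> i ni; rewrite /t big_nat_recr //= lerD2l; have [a1 a2] := Hc i ni.
  have dci := bdist_gt0 uD (DV (c i)).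
  have e1 : l <= d (V (c i)) / 2.
    by apply: le_trans a2 _; rewrite mulrC ler_wpM2l ?(ltW dci) // /h1 ge_min; apply/orP; left; lra.
  have e2 : l <= h / 2 * d (V (c i)).
    by apply: le_trans a2 _; rewrite ler_wpM2r ?(ltW dci) // /h1 ge_min lexx orbT.
  rewrite ler_pdivrMr; last lra.
  by apply: le_trans e2 _; nra.
Qed.

End QuasihyperbolicMetric.

(** * The Gromov boundary of a hyperbolic space *)

Section LimInf.
Context {R : realType}.
Implicit Types (a : nat -> R) (c : R).

Lemma limn_einfE (u : nat -> \bar R) : limn_einf u = ereal_sup (range (einfs u)).
Proof.
rewrite limn_einf_lim; apply/cvg_lim => //; apply: ereal_nondecreasing_cvgn.
exact: nondecreasing_einfs.
Qed.

Lemma le_limn_einf a c : (\forall i \near \oo, c <= a i) ->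
  (c%:E <= limn_einf (fun i => (a i)%:E))%E.
Proof.
move=> [N _ HN]; rewrite limn_einfE.
apply: (@le_trans _ _ (einfs (fun i => (a i)%:E) N)); last first.
  by apply: ereal_sup_ubound; exists N.
by apply: le_ereal_inf_tmp => _ [i /= Ni <-]; rewrite lee_fin HN.
Qed.

Lemma lt_limn_einf a c : (c%:E < limn_einf (fun i => (a i)%:E))%E ->
  \forall i \near \oo, c < a i.
Proof.
rewrite limn_einfE => /ereal_sup_gt[_ [N _ <-] h]; exists N => // i /= Ni.
by rewrite -lte_fin; apply: lt_le_trans h _; apply: ereal_inf_lbound; exists i.
Qed.

Lemma limn_einf_lt a c : (limn_einf (fun i => (a i)%:E) < c%:E)%E ->
  forall N, exists2 i, (N <= i)%N & a i < c.
Proof.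
move=> h N; apply: contrapT => H; move: h; rewrite ltNge => /negP; apply.
apply: le_limn_einf; exists N => // i /= Ni; rewrite leNgt; apply/negP => ai.
by apply: H; exists i.
Qed.

End LimInf.

Section GromovBoundary.
Context {R : realType} {T : Type}.
Variable m : T -> T -> R.
Hypothesis mxx : forall x, m x x = 0.
Hypothesis m_sym : forall x y, m x y = m y x.
Hypothesis m_tri : forall y x z, m x z <= m x y + m y z.
Variable delta : R.
Hypothesis hyp : hyperbolic m delta.
Implicit Types (x y z w : T) (u v : nat -> T).

Lemma m_ge0 x y : 0 <= m x y.
Proof. by have := m_tri y x x; rewrite mxx (m_sym y x); lra. Qed.

Lemma gprod_sym w x y : gprod m w x y = gprod m w y x.
Proof. by rewrite /gprod (m_sym x y) (addrC (m x w)). Qed.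

Lemma gprod_ge0 w x y : 0 <= gprod m w x y.
Proof. by rewrite /gprod; have := m_tri w x y; rewrite (m_sym w y); lra. Qed.

Lemma gprod_le w x y : gprod m w x y <= m x w.
Proof. by rewrite /gprod; have := m_tri x y w; rewrite (m_sym y x); lra. Qed.

Lemma gprod_base w w' x y : gprod m w x y <= gprod m w' x y + m w w'.
Proof.
by rewrite /gprod; have := m_tri w' x w; have := m_tri w' y w; rewrite (m_sym w' w); lra.
Qed.

Lemma delta_ge0 (w : T) : 0 <= delta.
Proof. by have := hyp w w w w; rewrite /gprod !mxx minxx; lra. Qed.

Lemma gprod_min3 w x y z z' (a : R) : a <= gprod m w x z -> a <= gprod m w z z' ->
  a <= gprod m w z' y -> a - 2 * delta <= gprod m w x y.
Proof.
move=> h1 h2 h3; have := hyp x y z w; have := hyp z y z' w.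
by rewrite /Num.min; do 2 case: ifP => _; have := delta_ge0 w; lra.
Qed.

Lemma four_point x y z w : m x y + m z w <= m x z + m y w + 2 * delta \/
  m x y + m z w <= m x w + m y z + 2 * delta.
Proof.
have := hyp x y z w; rewrite /gprod (m_sym z y); rewrite /Num.min; case: ifP => _; lra.
Qed.

Lemma gromov_seqP u : gromov_seq m u <-> forall w (M : R), exists N, forall i j,
  (N <= i)%N -> (N <= j)%N -> M <= gprod m w (u i) (u j).
Proof.
split=> [H w M|H w].
  have /cvgryPge /(_ M) := H w; case=> -[A B] /= [[N1 _ h1] [N2 _ h2]] AB.
  exists (maxn N1 N2) => i j; rewrite !geq_max => /andP[i1 i2] /andP[j1 j2].
  by apply: (AB (i, j)); split => /=; [apply: h1|apply: h2].
apply/cvgryPge => M; have [N HN] := H w M.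
exists ([set i | (N <= i)%N], [set i | (N <= i)%N]); first by split; exists N.
by move=> [i j] [/= ?]; exact: HN.
Qed.

Lemma gromov_equivP u v : gromov_equiv m u v <-> forall w (M : R),
  \forall i \near \oo, M <= gprod m w (u i) (v i).
Proof. by split=> H w; [move=> M; have /cvgryPge := H w; exact|apply/cvgryPge]. Qed.

(* [u] and [v] converge to the same boundary point; for Gromov sequences this
   is [gromov_equiv], with indices allowed to vary independently. *)
Definition asymptotic u v := forall w (M : R), exists N, forall i j,
  (N <= i)%N -> (N <= j)%N -> M <= gprod m w (u i) (v j).

Lemma gromov_equiv_asymptotic u v : gromov_seq m u -> gromov_seq m v ->
  gromov_equiv m u v -> asymptotic u v.
Proof.
move=> /gromov_seqP gu /gromov_seqP gv /gromov_equivP uv w M.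
have [N1 h1] := gu w (M + 2 * delta); have [N2 h2] := gv w (M + 2 * delta).
have [N3 _ h3] := uv w (M + 2 * delta).
exists (maxn N1 (maxn N2 N3)) => i j; rewrite !geq_max => /and3P[i1 i2 i3] /and3P[j1 j2 j3].
have -> : M = M + 2 * delta - 2 * delta by lra.
by apply: (@gprod_min3 w (u i) (v j) (u j) (v j)); [exact: h1|exact: h3|exact: h2].
Qed.

Lemma asymptotic_sym u v : asymptotic u v -> asymptotic v u.
Proof.
move=> H w M; have [N HN] := H w M; exists N => i j Ni Nj.
by rewrite gprod_sym HN.
Qed.

Lemma asymptotic_trans u v v' : asymptotic u v -> asymptotic v v' -> asymptotic u v'.
Proof.
move=> H1 H2 w M; have [N1 h1] := H1 w (M + delta); have [N2 h2] := H2 w (M + delta).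
exists (maxn N1 N2) => i j; rewrite !geq_max => /andP[i1 i2] /andP[j1 j2].
have := hyp (u i) (v' j) (v i) w; have := h1 i i i1 i1; have := h2 i j i2 j2.
by rewrite /Num.min; case: ifP => _; lra.
Qed.

Lemma gromov_seq_asymptotic u : gromov_seq m u <-> asymptotic u u.
Proof. exact: gromov_seqP. Qed.

Lemma asymptotic_equiv u v : asymptotic u v -> gromov_equiv m u v.
Proof.
by move=> H; apply/gromov_equivP => w M; have [N HN] := H w M; exists N => // i /= Ni; exact: HN.
Qed.

Notation bd := (gboundary m).
Implicit Types zeta xi : bd.

Lemma seqs_ofP zeta : exists2 u, gromov_seq m u & seqs_of zeta = gromov_class m u.
Proof. exact: set_valP zeta. Qed.

Lemma seqs_of_asymptotic zeta u v : seqs_of zeta u -> seqs_of zeta v -> asymptotic u v.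
Proof.
have [w gw ->] := seqs_ofP zeta => -[gu wu] [gv wv].
apply: (@asymptotic_trans _ w); last exact: gromov_equiv_asymptotic.
by apply: asymptotic_sym; exact: gromov_equiv_asymptotic.
Qed.

Lemma seqs_of_gromov zeta u : seqs_of zeta u -> gromov_seq m u.
Proof. by move=> zu; apply/gromov_seq_asymptotic; exact: (seqs_of_asymptotic zu zu). Qed.

Lemma seqs_of_neq0 zeta : exists u, seqs_of zeta u.
Proof.
have [u gu e] := seqs_ofP zeta; exists u; rewrite e.
by split => //; apply: asymptotic_equiv; exact/gromov_seq_asymptotic.
Qed.

Lemma seqs_of_closed zeta u v : seqs_of zeta u -> asymptotic u v -> seqs_of zeta v.
Proof.
have [w gw ->] := seqs_ofP zeta => -[gu wu] uv; split.
  by apply/gromov_seq_asymptotic; apply: asymptotic_trans (asymptotic_sym uv) uv.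
by apply: asymptotic_equiv; apply: asymptotic_trans uv; exact: gromov_equiv_asymptotic.
Qed.

Lemma gboundary_eq zeta xi u v : seqs_of zeta u -> seqs_of xi v -> asymptotic u v -> zeta = xi.
Proof.
move=> zu xv uv; apply: val_inj; apply/seteqP; split=> w zw.
  apply: (seqs_of_closed xv); apply: asymptotic_trans (asymptotic_sym uv) _.
  exact: seqs_of_asymptotic zu zw.
by apply: (seqs_of_closed zu); apply: asymptotic_trans uv _; exact: seqs_of_asymptotic xv zw.
Qed.

Lemma gboundary_of u : gromov_seq m u -> exists zeta, seqs_of zeta u.
Proof.
move=> gu; have cP : gromov_class m u \in [set c | exists2 u, gromov_seq m u & c = gromov_class m u].
  by apply/mem_set; exists u.
exists (SigSub cP); split => //; apply: asymptotic_equiv; exact/gromov_seq_asymptotic.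
Qed.

(** Some sequence of the class comes close to the infimum at infinitely many indices. Any other
    sequence [v] of the class has large products with it, so by hyperbolicity the products with [v]
    exceed the infimum by at most about [delta]. *)
Lemma gprod_pt_bounds w x zeta v (e : R) : seqs_of zeta v -> 0 < e ->
  exists g : R, gprod_pt w x zeta = g%:E /\
  \forall i \near \oo, g - e <= gprod m w x (v i) <= g + delta + e.
Proof.
move=> zv e0; have G0 : (0 <= gprod_pt w x zeta)%E.
  apply: le_ereal_inf_tmp => _ [v' zv' <-]; apply: le_limn_einf.
  by apply: nearW => i; exact: gprod_ge0.
have GM : (gprod_pt w x zeta < (m x w + 1)%:E)%E.
  apply: (@le_lt_trans _ _ (limn_einf (fun i => (gprod m w x (v i))%:E))).
    by apply: ereal_inf_lbound; exists v.
  rewrite ltNge; apply/negP => h.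
  have : ((m x w)%:E < limn_einf (fun i => (gprod m w x (v i))%:E))%E.
    by apply: lt_le_trans h; rewrite lte_fin ltrDl.
  by move/lt_limn_einf => [N _ /(_ N (leqnn N))]; rewrite ltNge gprod_le.
have [g eg] : exists g : R, gprod_pt w x zeta = g%:E.
  exists (fine (gprod_pt w x zeta)); rewrite fineK // ge0_fin_numE //.
  exact: lt_trans GM (ltey _).
exists g; split => //.
have lower v' : seqs_of zeta v' -> \forall i \near \oo, g - e < gprod m w x (v' i).
  move=> zv'; apply: lt_limn_einf; apply: (@lt_le_trans _ _ (gprod_pt w x zeta)).
    by rewrite eg lte_fin; lra.
  by apply: ereal_inf_lbound; exists v'.
have : (gprod_pt w x zeta < (g + e)%:E)%E by rewrite eg lte_fin; lra.
move=> /ereal_inf_lt[_ [v' zv' <-]] /limn_einf_lt fr.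
have [N HN] := seqs_of_asymptotic zv zv' w (g + e + delta).
have [j Nj hj] := fr N.
have [N' _ HN'] := lower v zv; exists (maxn N N') => // i /=.
rewrite geq_max => /andP[Ni N'i]; rewrite (ltW (HN' i N'i)) /=.
have := hyp x (v' j) (v i) w; have := HN i j Ni Nj.
by rewrite /Num.min; case: ifP => _; lra.
Qed.

Lemma lt_gprod_pt w zeta u (t : R) : seqs_of zeta u ->
  \forall i \near \oo, (t%:E < gprod_pt w (u i) zeta)%E.
Proof.
(* The summand [delta] pays for one use of hyperbolicity, the summand 1 keeps the infimum strictly
   above [t]. *)
move=> zu; have [N HN] := seqs_of_asymptotic zu zu w (t + 1 + delta).
exists N => // i /= Ni; apply: (@lt_le_trans _ _ (t + 1)%:E).
  by rewrite lte_fin ltrDl.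
apply: le_ereal_inf_tmp => _ [v zv <-]; apply: le_limn_einf.
have [N' HN'] := seqs_of_asymptotic zu zv w (t + 1 + delta).
exists (maxn N N') => // j /=; rewrite geq_max => /andP[Nj N'j].
have := hyp (u i) (v j) (u j) w; have := HN i j Ni Nj; have := HN' j j N'j N'j.
by rewrite /Num.min; case: ifP => _; lra.
Qed.

(** For a point v in place of [xi], the difference (o|v)_x - (x|v)_o is exactly m(x,v) - m(o,v).
    Each of the two products is approximated with an error between about 0 and [delta], so the
    errors do not add up. *)
Lemma busemann_approx xi o x v (e : R) : seqs_of xi v -> 0 < e ->
  \forall i \near \oo, `|busemann xi o x - (m x (v i) - m o (v i))| <= delta + e.
Proof.
move=> xv e0; have e2 : 0 < e / 2 by rewrite divr_gt0.
have [g1 [eg1 h1]] := gprod_pt_bounds x o xv e2.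
have [g2 [eg2 h2]] := gprod_pt_bounds o x xv e2.
near=> i.
have /andP[a1 a2] : g1 - e / 2 <= gprod m x o (v i) <= g1 + delta + e / 2 by near: i.
have /andP[b1 b2] : g2 - e / 2 <= gprod m o x (v i) <= g2 + delta + e / 2 by near: i.
rewrite /busemann eg1 eg2 /= ler_norml; move: a1 a2 b1 b2; rewrite /gprod.
by rewrite (m_sym (v i) x) (m_sym (v i) o) (m_sym x o); lra.
Unshelve. all: end_near. Qed.

(** Sequences to different boundary points have a bounded product at infinitely many indices. From
    such an index far enough out, moving along either sequence goes through much larger products, so
    by [gprod_min3] the product changes by at most [2 * delta]. *)
Lemma gprod_stable w zeta xi : zeta <> xi -> exists t : R, forall u v,
  seqs_of zeta u -> seqs_of xi v -> exists N, forall i j, (N <= i)%N -> (N <= j)%N ->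
  `|gprod m w (u i) (v j) - t| <= 2 * delta.
Proof.
move=> ne; have [u0 zu0] := seqs_of_neq0 zeta; have [v0 xv0] := seqs_of_neq0 xi.
have [w' [M HM]] : exists w' (M : R), forall N, exists2 i, (N <= i)%N & gprod m w' (u0 i) (v0 i) < M.
  apply: contrapT => H; apply: ne; apply: (gboundary_eq zu0 xv0).
  apply: gromov_equiv_asymptotic (seqs_of_gromov zu0) (seqs_of_gromov xv0) _.
  apply/gromov_equivP => w' M; apply: contrapT => H'; apply: H; exists w', M => N.
  apply: contrapT => H''; apply: H'; exists N => // i /= Ni; rewrite leNgt; apply/negP => h.
  by apply: H''; exists i.
(* [B] exceeds the product at [i0] by more than [4 * delta]; a product above [B] further out would
   force the one at [i0] above [B - 2 * delta], which is absurd. *)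
pose B := M + m w w' + 4 * delta + 1.
have [N1 h1] := seqs_of_asymptotic zu0 zu0 w (B + delta).
have [N2 h2] := seqs_of_asymptotic xv0 xv0 w (B + delta).
have [i0 Ni0 hi0] := HM (maxn N1 N2).
move: Ni0; rewrite geq_max => /andP[N1i N2i].
have tM : gprod m w (u0 i0) (v0 i0) < M + m w w'.
  by have := gprod_base w w' (u0 i0) (v0 i0); lra.
exists (gprod m w (u0 i0) (v0 i0)) => u v zu xv.
have [N3 h3] := seqs_of_asymptotic zu zu0 w (B + delta).
have [N4 h4] := seqs_of_asymptotic xv xv0 w (B + delta).
exists (maxn (maxn N1 N2) (maxn N3 N4)) => i j.
rewrite !geq_max => /andP[/andP[i1 i2] /andP[i3 i4]] /andP[/andP[j1 j2] /andP[j3 j4]].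
have d0 := delta_ge0 w.
have ui : B <= gprod m w (u i) (u0 i0).
  have := hyp (u i) (u0 i0) (u0 i) w; have := h1 i i0 i1 N1i; have := h3 i i i3 i3.
  by rewrite /Num.min; case: ifP => _; lra.
have vj : B <= gprod m w (v0 i0) (v j).
  have := hyp (v0 i0) (v j) (v0 j) w; have := h2 i0 j N2i j2; have := h4 j j j4 j4.
  by rewrite (gprod_sym w (v j)) /Num.min; case: ifP => _; lra.
rewrite ler_norml; apply/andP; split.
  have := @gprod_min3 w (u i) (v j) (u0 i0) (v0 i0) (gprod m w (u0 i0) (v0 i0)).
  by rewrite lexx => H; have := H _ isT _; move: ui vj; rewrite /B; lra.
rewrite leNgt; apply/negP => h.
have := gprod_min3 (w := w) (x := u0 i0) (y := v0 i0) (z := u i) (z' := v j).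
rewrite (gprod_sym w (u0 i0)) (gprod_sym w (v j)).
have [hX|hX] := leP (gprod m w (u i) (v j)) B => H.
  by have := H _ (le_trans hX ui) (lexx _) (le_trans hX vj); lra.
by have := H _ ui (ltW hX) vj; rewrite /B; lra.
Qed.

Section Busemann.
Variables (xi : bd) (o : T).
Notation b := (busemann xi o).

Lemma bprod_approx x y v (e : R) : seqs_of xi v -> 0 < e ->
  \forall i \near \oo, `|bprod m b x y - (gprod m (v i) x y - m o (v i))| <= delta + e.
Proof.
move=> xv e0; near=> i.
have : `|b x - (m x (v i) - m o (v i))| <= delta + e.
  by near: i; exact: busemann_approx.
have : `|b y - (m y (v i) - m o (v i))| <= delta + e.
  by near: i; exact: busemann_approx.
by rewrite /bprod /gprod !ler_norml; lra.
Unshelve. all: end_near. Qed.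

(** One [delta] for hyperbolicity at a base point near [xi], and one for each of the two passages
    between [b] and that base point. *)
Lemma bprod_min x y z : Num.min (bprod m b x z) (bprod m b z y) - 3 * delta <= bprod m b x y.
Proof.
rewrite lerBlDr; apply/ler_addgt0Pr => e e0; have [v xv] := seqs_of_neq0 xi.
have e3 : 0 < e / 3 by rewrite divr_gt0.
near \oo => i.
have : `|bprod m b x y - (gprod m (v i) x y - m o (v i))| <= delta + e / 3.
  by near: i; exact: bprod_approx.
have : `|bprod m b x z - (gprod m (v i) x z - m o (v i))| <= delta + e / 3.
  by near: i; exact: bprod_approx.
have : `|bprod m b z y - (gprod m (v i) z y - m o (v i))| <= delta + e / 3.
  by near: i; exact: bprod_approx.
have := hyp x y z (v i); rewrite /Num.min !ler_norml.
by case: ifP => h1; case: ifP => h2; lra.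
Unshelve. all: end_near. Qed.

Lemma bprod_bd_le zeta1 zeta2 u v : seqs_of zeta1 u -> seqs_of zeta2 v ->
  (bprod_bd b zeta1 zeta2 <= limn_einf (fun i => (bprod m b (u i) (v i))%:E))%E.
Proof. by move=> z1 z2; apply: ereal_inf_lbound; exists (u, v). Qed.

Lemma bprod_bd_min zeta1 zeta2 zeta3 (a : R) : (a%:E <= bprod_bd b zeta1 zeta2)%E ->
  (a%:E <= bprod_bd b zeta2 zeta3)%E -> ((a - 3 * delta)%:E <= bprod_bd b zeta1 zeta3)%E.
Proof.
move=> h12 h23; apply: le_ereal_inf_tmp => _ [[u v] [/= z1 z3] <-].
have [w z2] := seqs_of_neq0 zeta2; apply/lee_addgt0Pr => e e0.
rewrite -leeBlDr // -EFinB; apply: le_limn_einf; near=> i.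
have h1 : a - e < bprod m b (u i) (w i).
  near: i; apply: lt_limn_einf; apply: lt_le_trans (bprod_bd_le z1 z2).
  by apply: lt_le_trans h12; rewrite lte_fin; lra.
have h2 : a - e < bprod m b (w i) (v i).
  near: i; apply: lt_limn_einf; apply: lt_le_trans (bprod_bd_le z2 z3).
  by apply: lt_le_trans h23; rewrite lte_fin; lra.
by have := bprod_min (u i) (v i) (w i); rewrite /Num.min; case: ifP => _; lra.
Unshelve. all: end_near. Qed.

Lemma gprod_base_change x y w : gprod m w x y - m o w =
  gprod m o x y - gprod m o x w - gprod m o y w.
Proof. by rewrite /gprod (m_sym w o); lra. Qed.

(** After the change of base (x|y)_w - m(o,w) = (x|y)_o - (x|w)_o - (y|w)_o each of the three terms
    is stable up to [2 * delta], in all up to [6 * delta]. The passage to [b] costs [delta + 1]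
    more, and comparing both quantities through the same centre gives [13 * delta + 1]. *)
Lemma bprod_bd_approx zeta1 zeta2 : zeta1 <> zeta2 -> zeta1 <> xi -> zeta2 <> xi ->
  exists a : R, bprod_bd b zeta1 zeta2 = a%:E /\ forall u v (w : nat -> T),
    seqs_of zeta1 u -> seqs_of zeta2 v -> seqs_of xi w ->
    \forall i \near \oo, `|gprod m (w i) (u i) (v i) - m o (w i) - a| <= 13 * delta + 1.
Proof.
move=> n12 n1 n2; have [t3 h3] := gprod_stable o n12.
have [t1 h1] := gprod_stable o n1; have [t2 h2] := gprod_stable o n2.
have key u v (w : nat -> T) : seqs_of zeta1 u -> seqs_of zeta2 v -> seqs_of xi w ->
    exists N, forall i j, (N <= i)%N -> (N <= j)%N ->
    `|gprod m (w j) (u i) (v i) - m o (w j) - (t3 - t1 - t2)| <= 6 * delta.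
  move=> zu zv xw; have [N1 {}h1] := h1 u w zu xw; have [N2 {}h2] := h2 v w zv xw.
  have [N3 {}h3] := h3 u v zu zv; exists (maxn N1 (maxn N2 N3)) => i j.
  rewrite !geq_max => /and3P[i1 i2 i3] /and3P[j1 j2 j3]; rewrite gprod_base_change.
  have := h1 i j i1 j1; have := h2 i j i2 j2; have := h3 i i i3 i3.
  by rewrite !ler_norml; lra.
have [w xw] := seqs_of_neq0 xi.
have keyb u v : seqs_of zeta1 u -> seqs_of zeta2 v ->
    \forall i \near \oo, `|bprod m b (u i) (v i) - (t3 - t1 - t2)| <= 7 * delta + 1.
  move=> zu zv; have [N HN] := key u v w zu zv xw; exists N => // i /= Ni.
  have [M _ HM] := bprod_approx (u i) (v i) xw ltr01.
  have := HM (maxn M N) (leq_maxl _ _); have := HN i (maxn M N) Ni (leq_maxr _ _).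
  by rewrite !ler_norml; lra.
have Lb : ((t3 - t1 - t2 - 7 * delta - 1)%:E <= bprod_bd b zeta1 zeta2)%E.
  apply: le_ereal_inf_tmp => _ [[u v] [/= zu zv] <-]; apply: le_limn_einf.
  by near=> i; have : `|bprod m b (u i) (v i) - (t3 - t1 - t2)| <= 7 * delta + 1;
    [near: i; exact: keyb|rewrite ler_norml; lra].
have Ub : (bprod_bd b zeta1 zeta2 <= (t3 - t1 - t2 + 7 * delta + 1)%:E)%E.
  have [u zu] := seqs_of_neq0 zeta1; have [v zv] := seqs_of_neq0 zeta2.
  apply: le_trans (bprod_bd_le zu zv) _; rewrite leNgt; apply/negP => /lt_limn_einf H.
  near \oo => i; have : t3 - t1 - t2 + 7 * delta + 1 < bprod m b (u i) (v i) by near: i.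
  have : `|bprod m b (u i) (v i) - (t3 - t1 - t2)| <= 7 * delta + 1 by near: i; exact: keyb.
  by rewrite ler_norml; lra.
have fin : bprod_bd b zeta1 zeta2 \is a fin_num.
  rewrite fin_numE; apply/andP; split; apply/eqP => e.
    by move: Lb; rewrite e.
  by move: Ub; rewrite e.
exists (fine (bprod_bd b zeta1 zeta2)); split; first by rewrite fineK.
move: Lb Ub; rewrite -[bprod_bd _ _ _]fineK // !lee_fin => Lb Ub u v w' zu zv xw'.
have [N HN] := key u v w' zu zv xw'; exists N => // i /= Ni; have := HN i i Ni Ni.
by rewrite !ler_norml; lra.
Unshelve. all: end_near. Qed.

(** The same change of base: the product of two sequences of [zeta] tends to infinity, their
    products with [xi] stay bounded. *)
Lemma bprod_bd_diag zeta : zeta <> xi -> bprod_bd b zeta zeta = +oo%E.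
Proof.
move=> n; have [t h] := gprod_stable o n; have [w xw] := seqs_of_neq0 xi.
apply/eqyP => A A0; apply: le_ereal_inf_tmp => _ [[u v] [/= zu zv] <-]; apply: le_limn_einf.
have [N1 h1] := h u w zu xw; have [N2 h2] := h v w zv xw.
have [N3 h3] := seqs_of_asymptotic zu zv o (A + 2 * t + 5 * delta + 1).
exists (maxn N1 (maxn N2 N3)) => // i /=; rewrite !geq_max => /and3P[i1 i2 i3].
have [M _ HM] := bprod_approx (u i) (v i) xw ltr01.
pose j := maxn M (maxn N1 N2).
have := HM j; rewrite /= gprod_base_change leq_maxl => /(_ isT).
have := h1 i j i1; have := h2 i j i2; have := h3 i i i3 i3.
have -> : (N1 <= j)%N by rewrite /j !leq_max leqnn orbT.
have -> : (N2 <= j)%N by rewrite /j !leq_max leqnn !orbT.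
by move=> a1 /(_ isT) + /(_ isT); rewrite !ler_norml; lra.
Qed.

Section Hamenstadt.
Variable eps : R.
Hypothesis eps0 : 0 < eps.
Notation rho := (rho b eps).

Lemma rho_diag zeta : zeta <> xi -> rho zeta zeta = 0.
Proof.
by move=> n; rewrite /Defs.rho bprod_bd_diag // gt0_muley ?lte_fin.
Qed.

Lemma rhoE zeta1 zeta2 (a : R) : bprod_bd b zeta1 zeta2 = a%:E ->
  rho zeta1 zeta2 = expR (- (eps * a)).
Proof. by move=> e; rewrite /Defs.rho e. Qed.

Lemma rho_ge0 zeta1 zeta2 : 0 <= rho zeta1 zeta2.
Proof. by apply: fine_ge0; exact: expeR_ge0. Qed.

Lemma rho_quasi_ultrametric zeta1 zeta2 zeta3 :
  zeta1 <> xi -> zeta2 <> xi -> zeta3 <> xi ->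
  rho zeta1 zeta3 <= expR (3 * eps * delta) * Num.max (rho zeta1 zeta2) (rho zeta2 zeta3).
Proof.
move=> n1 n2 n3; have d0 : 0 <= delta by exact: (delta_ge0 o).
have K1 : 1 <= expR (3 * eps * delta) by rewrite -expR0 ler_expR !mulr_ge0 ?(ltW eps0).
have [e12|n12] := pselect (zeta1 = zeta2).
  by rewrite e12 rho_diag // max_r ?rho_ge0 // ler_peMl // rho_ge0.
have [e23|n23] := pselect (zeta2 = zeta3).
  by rewrite e23 rho_diag // max_l ?rho_ge0 // ler_peMl // rho_ge0.
have [e13|n13] := pselect (zeta1 = zeta3).
  by rewrite e13 rho_diag // mulr_ge0 ?expR_ge0 // le_max rho_ge0.
have [a12 [e12 _]] := bprod_bd_approx n12 n1 n2; have [a23 [e23 _]] := bprod_bd_approx n23 n2 n3.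
have [a13 [e13 _]] := bprod_bd_approx n13 n1 n3; rewrite !(rhoE e12) !(rhoE e23) !(rhoE e13).
have : Num.min a12 a23 - 3 * delta <= a13.
  rewrite -lee_fin -e13; apply: (@bprod_bd_min _ zeta2).
    by rewrite e12 lee_fin ge_min lexx.
  by rewrite e23 lee_fin ge_min lexx orbT.
move=> H; apply: (@le_trans _ _ (expR (3 * eps * delta) * expR (- (eps * Num.min a12 a23)))).
  rewrite -expRD ler_expR; have := ler_wpM2l (ltW eps0) H.
  by move: (Num.min a12 a23) => a; lra.
rewrite ler_wpM2l ?expR_ge0 // le_max !ler_expR !lerN2 !ler_pM2l // !le_min !lexx.
by rewrite /= andbT le_total.
Qed.

Hypothesis adm : expR (22 * eps * delta) <= 2.

(** Frink's chain argument. The chain is split into an initial part, one link and a final part,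
    where both parts have at most half of the total sum S. By induction each of the three pieces has
    [rho] at most S, and two uses of the quasi-ultrametric inequality give K^2 S, where K^2 <= 2 by
    admissibility. *)
Lemma rho_chain (c : nat -> bd) l i j : (forall k, (k <= j)%N -> c k <> xi) ->
  (i <= j)%N -> (j - i <= l)%N ->
  rho (c i) (c j) <= 2 * \sum_(i <= k < j) rho (c k) (c k.+1).
Proof.
set K := expR (3 * eps * delta).
have K0 : 0 < K by exact: expR_gt0.
have d0 : 0 <= delta by exact: (delta_ge0 o).
have K1 : 1 <= K by rewrite /K -expR0 ler_expR !mulr_ge0 ?(ltW eps0).
have K2 : K * K <= 2.
  by rewrite /K -expRD; apply: le_trans adm; rewrite ler_expR; have := mulr_ge0 (ltW eps0) d0; lra.
have s0 p q : 0 <= \sum_(p <= k < q) rho (c k) (c k.+1) by apply: sumr_ge0 => k _; exact: rho_ge0.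
elim: l i j => [|l IH] i j cP ij jil.
  have -> : j = i by apply/eqP; rewrite eqn_leq ij andbT -subn_eq0 -leqn0.
  by rewrite rho_diag ?mulr_ge0 //; exact: cP.
set S := \sum_(i <= k < j) _.
have [->|nij] := eqVneq i j; first by rewrite rho_diag ?mulr_ge0 ?s0 //; exact: cP.
have {}ij : (i < j)%N by rewrite ltn_neqAle nij.
(* [p] is the largest index whose initial sum is at most half of [S]; by maximality what follows the
   next link is at most half as well. *)
have [p [ip pj h1 h2]] : exists p, [/\ (i <= p)%N, (p < j)%N,
    2 * \sum_(i <= k < p) rho (c k) (c k.+1) <= S & 2 * \sum_(p.+1 <= k < j) rho (c k) (c k.+1) <= S].
  have ex : exists p, (i <= p < j)%N && (2 * \sum_(i <= k < p) rho (c k) (c k.+1) <= S).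
    by exists i; rewrite leqnn ij big_geq // mulr0 s0.
  have ub p : (i <= p < j)%N && (2 * \sum_(i <= k < p) rho (c k) (c k.+1) <= S) -> (p <= j)%N.
    by move=> /andP[/andP[_ /ltnW]].
  have [p /andP[/andP[ip pj] h] pmax] := ex_maxnP ex ub; exists p; split => //.
  have [pj1|pj1] := eqVneq p.+1 j; first by rewrite pj1 big_geq // mulr0 s0.
  have {}pj1 : (p.+1 < j)%N by rewrite ltn_neqAle pj1.
  have := pmax p.+1; rewrite pj1 (leqW ip) /= ltnn => /implyP; rewrite implybF -ltNge.
  rewrite /S (@big_cat_nat _ _ _ p.+1 i j) ?(leqW ip) ?(ltnW pj1) //=; lra.
have cn k : (k <= j)%N -> c k <> xi by exact: cP.
have r1 : rho (c i) (c p) <= S.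
  apply: le_trans h1; apply: IH => //; first by move=> k kp; apply: cP; rewrite (leq_trans kp) // ltnW.
  by rewrite leq_subLR -ltnS -addnS (leq_trans pj) // -leq_subLR.
have r3 : rho (c p.+1) (c j) <= S.
  apply: le_trans h2; apply: IH => //.
  by rewrite leq_subLR addSn -addnS; rewrite leq_subLR in jil; rewrite (leq_trans jil) // leq_add2r.
have r2 : rho (c p) (c p.+1) <= S.
  rewrite /S (@big_cat_nat _ _ _ p i j) ?(ltnW pj) //= [X in _ + X]big_ltn //=.
  by have := s0 i p; have := s0 p.+1 j; lra.
have q1 := rho_quasi_ultrametric (cn i (ltnW ij)) (cn p (ltnW pj)) (cn j (leqnn j)).
have q2 := rho_quasi_ultrametric (cn p (ltnW pj)) (cn p.+1 pj) (cn j (leqnn j)).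
have q3 : rho (c p) (c j) <= K * S.
  by apply: le_trans q2 _; rewrite ler_wpM2l ?(ltW K0) // ge_max r2 r3.
apply: le_trans q1 _; rewrite -/K.
apply: (@le_trans _ _ (K * (K * S))).
  rewrite ler_wpM2l ?(ltW K0) // ge_max q3 andbT; apply: le_trans r1 _.
  by rewrite ler_peMl // s0.
by rewrite mulrA ler_wpM2r // s0.
Qed.

Lemma hamenstadt_bounds zeta1 zeta2 : zeta1 <> xi -> zeta2 <> xi ->
  rho zeta1 zeta2 / 2 <= hamenstadt xi b eps zeta1 zeta2 <= rho zeta1 zeta2.
Proof.
move=> n1 n2; rewrite /hamenstadt; set A := [set s | _].
have Ar : A (rho zeta1 zeta2).
  exists 1%N, (fun i => if i == 0%N then zeta1 else zeta2); split => //.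
    by move=> [|i].
  by rewrite big_nat1.
have lb : lbound A (rho zeta1 zeta2 / 2).
  move=> _ [n [c [n1' c0 cn cP ->]]].
  have := @rho_chain c n 0%N n cP (leq0n n); rewrite subn0 leqnn c0 cn => /(_ isT); lra.
apply/andP; split; first by apply: lb_le_inf => //; exists (rho zeta1 zeta2).
by apply: ge_inf => //; exists (rho zeta1 zeta2 / 2).
Qed.

End Hamenstadt.
End Busemann.
End GromovBoundary.

(** * Metrics comparable to a logarithm *)

Section RealFacts.
Context {R : realType}.
Implicit Types a b c t : R.

Lemma ler_ln_le a b : 0 < a -> a <= b -> ln a <= ln b.
Proof. by move=> a0 ab; rewrite ler_ln ?posrE // (lt_le_trans a0). Qed.

Lemma ln_le_scaled a b c : 0 < a -> 0 < b -> 0 < c -> a <= b * c -> ln a <= ln b + ln c.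
Proof. by move=> a0 b0 c0 h; rewrite -lnM ?posrE // ler_ln_le. Qed.

(** The slope 1/a can be made as small as desired, which allows a logarithm to be absorbed into a
    linear term. *)
Lemma ln_le_linear a t : 0 < a -> 0 < t -> ln t <= t / a + ln a.
Proof.
move=> a0 t0; have -> : ln t = ln (t / a) + ln a by rewrite ln_div ?posrE // subrK.
rewrite lerD2r; have := @le_ln1Dx R (t / a - 1); rewrite [1 + _]addrC subrK.
by move=> H; apply: le_trans (H _) _; [rewrite ltrBrDl subrr divr_gt0|lra].
Qed.

Lemma expR_sub1_le t : 0 <= t <= 1 / 2 -> expR t - 1 <= 2 * t.
Proof.
move=> /andP[t0 t2]; have h := expR_ge1Dx (- t); have e0 := expR_gt0 t.
have : expR t * expR (- t) = 1 by rewrite -expRD subrr expR0.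
nra.
Qed.

(** The letters stand for the six products of four points x, y, z, w at one base point: [p], [q] for
    xy and zw, [r], [s] for xz and yw, [t], [u] for zy and xw. *)
Lemma quasi_ultrametric_four_point (p q r s t u c : R) :
  Num.min r t - c <= p -> Num.min u s - c <= p ->
  Num.min r u - c <= q -> Num.min t s - c <= q ->
  Num.min (r + s) (t + u) - 2 * c <= p + q.
Proof.
by rewrite /Num.min; case: ifP => h5; case: ifP => h1; case: ifP => h2;
   case: ifP => h3; case: ifP => h4; lra.
Qed.

End RealFacts.

(* As in Gehring and Osgood, rough [k]-geodesics from [x] to [y] climb up to height
   [r x y] and come down again. *)
Section LogarithmicMetric.
Context {R : realType} {X : Type}.
Variables (k e : X -> X -> R) (d : X -> R).
Hypothesis kxx : forall x, k x x = 0.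
Hypothesis k_sym : forall x y, k x y = k y x.
Hypothesis k_tri : forall y x z, k x z <= k x y + k y z.
Hypothesis exx : forall x, e x x = 0.
Hypothesis e_sym : forall x y, e x y = e y x.
Hypothesis e_tri : forall y x z, e x z <= e x y + e y z.
Hypothesis d_gt0 : forall x, 0 < d x.
Hypothesis d_lip : forall x y, d x <= d y + e x y.
Hypothesis k_dist : forall x y, e x y <= (expR (k x y) - 1) * d x.
Hypothesis k_geodesic : forall x y (h : R), 0 < h -> exists n (c : nat -> X) (t : nat -> R),
  [/\ c 0%N = x, c n = y,
      forall i j, (i <= j <= n)%N -> k (c i) (c j) <= t j - t i <= k (c i) (c j) + h &
      forall i, (i < n)%N -> t i.+1 <= t i + h].

Definition rdist x y := e x y + d x + d y.
Notation r := rdist.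

Let k_ge0 x y : 0 <= k x y.
Proof. by have := k_tri y x x; rewrite kxx (k_sym y x); lra. Qed.
Let e_ge0 x y : 0 <= e x y.
Proof. by have := e_tri y x x; rewrite exx (e_sym y x); lra. Qed.

Lemma rdist_sym x y : r x y = r y x.
Proof. by rewrite /rdist e_sym addrAC. Qed.
Lemma rdist_gt0 x y : 0 < r x y.
Proof. by rewrite /rdist; have := e_ge0 x y; have := d_gt0 x; have := d_gt0 y; lra. Qed.
Lemma rdist_triangle y x z : r x z <= r x y + r y z.
Proof. by rewrite /rdist; have := e_tri y x z; have := d_gt0 y; lra. Qed.
Lemma d_le_rdist x y : d x <= r x y.
Proof. by rewrite /rdist; have := e_ge0 x y; have := d_gt0 y; lra. Qed.

Lemma d_growth x y : d y <= expR (k x y) * d x.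
Proof. by have := d_lip y x; have := k_dist x y; rewrite (e_sym y x); lra. Qed.

Lemma ln_d_lip x y : ln (d y) - ln (d x) <= k x y.
Proof.
rewrite lerBlDr -[k x y]expRK -lnM ?posrE ?expR_gt0 ?d_gt0 //.
by apply: ler_ln_le => //; exact: d_growth.
Qed.

(** The slack 1/2 is in the range of [expR_sub1_le]: a step of [k]-length a moves by at most 2a
    times the height. *)
Definition rough_geodesic c (t : nat -> R) n :=
  (forall i j, (i <= j <= n)%N -> k (c i) (c j) <= t j - t i <= k (c i) (c j) + 1 / 2) /\
  forall i, (i < n)%N -> t i.+1 <= t i + 1 / 2.

Lemma rough_geodesic_rev c t n : rough_geodesic c t n ->
  rough_geodesic (fun i => c (n - i)%N) (fun i => - t (n - i)%N) n.
Proof.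
move=> [H1 H2]; split=> [i j /andP[ij jn]|i ni].
  have := H1 (n - j)%N (n - i)%N; rewrite leq_sub2l //= leq_subr => /(_ isT).
  by rewrite (k_sym (c (n - i)%N)) opprK addrC.
have := H2 (n - i.+1)%N; rewrite -subSn // subSS leq_subr.
by move=> /(_ isT); lra.
Qed.

Lemma rough_geodesic_step c t n i : rough_geodesic c t n -> (i < n)%N ->
  0 <= k (c i) (c i.+1) <= 1 / 2 /\ k (c i) (c i.+1) <= t i.+1 - t i.
Proof.
by move=> [H1 H2] ni; have := H1 i i.+1; rewrite leqnSn ni => /(_ isT); have := H2 i ni;
  have := k_ge0 (c i) (c i.+1); lra.
Qed.

Lemma rough_geodesic_d c t n i : rough_geodesic c t n -> (i < n)%N ->
  d (c i.+1) <= 2 * d (c i).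
Proof.
move=> H ni; have [k2 _] := rough_geodesic_step H ni; have := expR_sub1_le k2.
have := d_growth (c i) (c i.+1); have := d_gt0 (c i); nra.
Qed.

Lemma rough_geodesic_length c t n i j (M : R) : rough_geodesic c t n -> (i <= j <= n)%N ->
  (forall l, (i <= l <= j)%N -> d (c l) <= M) -> e (c i) (c j) <= 2 * M * (t j - t i).
Proof.
move=> H /andP[+ jn]; elim: j jn => [|j IH] jn.
  by rewrite leqn0 => /eqP ->; rewrite exx subrr mulr0.
rewrite leq_eqVlt => /predU1P[->|ij] dM; first by rewrite exx subrr mulr0.
apply: le_trans (e_tri (c j) _ _) _.
have {}IH : e (c i) (c j) <= 2 * M * (t j - t i).
  by apply: IH => //; [exact: ltnW|move=> l /andP[il lj]; rewrite dM // il leqW].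
have [k2 kt] := rough_geodesic_step H jn; have := k_dist (c j) (c j.+1).
have dj : d (c j) <= M by rewrite dM // -ltnS ij leqnSn.
have := expR_sub1_le k2; have := d_gt0 (c j); nra.
Qed.

Section Comparable.
Variable C : R.
Hypothesis C1 : 1 <= C.
Hypothesis k_le : forall x y, k x y <= C * (2 * ln (r x y) - ln (d x) - ln (d y)) + C.

Lemma k_le_near x y s K : 0 < s -> 0 < K -> r x y <= K * s -> s <= d x -> s <= d y ->
  k x y <= 2 * C * ln K + C.
Proof.
move=> s0 Kpos h1 h2 h3; apply: le_trans (k_le x y) _.
have := ln_le_scaled (rdist_gt0 x y) Kpos s0 h1; have := ler_ln_le s0 h2.
have := ler_ln_le s0 h3 => a1 a2 a3.
have : C * (2 * ln (r x y) - ln (d x) - ln (d y)) <= C * (2 * ln K).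
  by rewrite ler_pM2l; [lra|exact: lt_le_trans C1].
lra.
Qed.

Definition level_cst := 8 * C * ln (64 * C) + 4 * C + 6.

Lemma level_cst_ge : 10 <= level_cst.
Proof.
have c1 := C1; have : 0 <= ln (64 * C) by apply: ln_ge0; lra.
by rewrite /level_cst; nra.
Qed.

(** At heights between M/8 and M at the ends and below M throughout, e is at most 2M times the
    [k]-length, while [k_le] bounds the [k]-length by a logarithm of e/M. A logarithm is sublinear,
    so e is at most a multiple of M. *)
Lemma level_chord c t n i j M : rough_geodesic c t n -> (i <= j <= n)%N ->
  (forall l, (i <= l <= j)%N -> d (c l) <= M) -> M <= 8 * d (c i) -> M <= 8 * d (c j) ->
  e (c i) (c j) <= level_cst * M.
Proof.
have c1 := C1; move=> H ijn dM di dj; have [ij jn] := andP ijn.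
have diM : d (c i) <= M by rewrite dM // leqnn ij.
have djM : d (c j) <= M by rewrite dM // leqnn ij.
have M0 : 0 < M by apply: lt_le_trans diM; exact: d_gt0.
have h1 := rough_geodesic_length H ijn dM.
have /andP[_ h2] := H.1 i j ijn; have h3 := k_le (c i) (c j).
set ri := r (c i) (c j) in h3; have r0 : 0 < ri by exact: rdist_gt0.
have h4 : ln (M / 8) <= ln (d (c i)) by apply: ler_ln_le; lra.
have h5 : ln (M / 8) <= ln (d (c j)) by apply: ler_ln_le; lra.
pose u := ri / (M / 8).
have u0 : 0 < u by rewrite /u !divr_gt0.
have eu : ln ri = ln u + ln (M / 8) by rewrite /u [ln (ri / _)]ln_div ?posrE ?divr_gt0 // subrK.
(* With the slope 1/(64 C) the linear term becomes [ri / 2] in the end, which the left-hand side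
   absorbs. *)
have h6 : ln u <= u / (64 * C) + ln (64 * C) by apply: ln_le_linear => //; lra.
have h7 : k (c i) (c j) <= 2 * C * ln u + C.
  have hh : 2 * ln ri - ln (d (c i)) - ln (d (c j)) <= 2 * ln u by rewrite eu; lra.
  have : C * (2 * ln ri - ln (d (c i)) - ln (d (c j))) <= C * (2 * ln u) by rewrite ler_wpM2l //; lra.
  lra.
have h8 : 2 * C * ln u <= u / 32 + 2 * C * ln (64 * C).
  have : 2 * C * ln u <= 2 * C * (u / (64 * C) + ln (64 * C)) by rewrite ler_wpM2l //; lra.
  have -> : 2 * C * (u / (64 * C) + ln (64 * C)) = u / 32 + 2 * C * ln (64 * C).
    by field; lra.
  by [].
have uM : u * M = 8 * ri by rewrite /u; field; lra.
have h9 : ri <= e (c i) (c j) + 2 * M by rewrite /ri /rdist; lra.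
have h10 : 2 * M * (t j - t i) <= 2 * M * (u / 32 + 2 * C * ln (64 * C) + C + 1 / 2).
  by rewrite ler_pM2l; lra.
have h11 : 2 * M * (u / 32 + 2 * C * ln (64 * C) + C + 1 / 2)
   = ri / 2 + 2 * M * (2 * C * ln (64 * C) + C + 1 / 2).
  have -> : ri = u * M / 8 by rewrite uM; lra.
  by field.
have h12 : 0 <= ln (64 * C) by apply: ln_ge0; lra.
by rewrite /level_cst; nra.
Qed.

Lemma first_index (P : nat -> bool) n : P n -> exists j, [/\ (j <= n)%N, P j & forall l, (l < j)%N -> ~~ P l].
Proof.
move=> Pn; have ex : exists j, P j by exists n.
have [j Pj jmin] := ex_minnP ex; exists j; split; rewrite ?jmin //.
by move=> l; apply: contraTN => /jmin; rewrite leqNgt.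
Qed.

(** Between the first times at heights s/2 and s, [level_chord] bounds the displacement by a
    multiple of s; over all halvings these bounds form a geometric series. [N] only counts the
    halvings needed to come down to the starting height. *)
Lemma ascent_chord N c t n j (s : R) : rough_geodesic c t n -> (j <= n)%N -> 0 < s ->
  s <= 2 ^+ N * d (c 0%N) -> (forall l, (l < j)%N -> d (c l) < s) -> s <= d (c j) ->
  e (c 0%N) (c j) <= 4 * level_cst * s.
Proof.
have k0 := level_cst_ge; move=> H; elim: N j s => [|N IH] [|j] s jn s0.
- by rewrite exx => *; nra.
- by rewrite expr0 mul1r => sd dl _; have := dl 0%N isT; lra.
- by rewrite exx => *; nra.
rewrite exprS => sN dl sj.
have [|j' [j'j sj' dl']] := @first_index (fun l => s / 2 <= d (c l)) j.+1; first lra.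
have h1 : e (c 0%N) (c j') <= 4 * level_cst * (s / 2).
  apply: IH => //; [exact: leq_trans jn|lra|lra|].
  by move=> l /dl'; rewrite -ltNge.
have h2 : e (c j') (c j.+1) <= level_cst * (2 * s).
  apply: (level_chord H); rewrite ?j'j //; [|lra|lra].
  move=> l /andP[_]; rewrite leq_eqVlt => /predU1P[->|lj]; last by have := dl l lj; lra.
  by have := rough_geodesic_d H jn; have := dl j (leqnn _); lra.
by have := e_tri (c j') (c 0%N) (c j.+1); nra.
Qed.

Definition ascent_cst := 4 * level_cst.
Definition summit_cst := 10 * level_cst.

(** From either end the chain first rises to half of its maximal height M, with displacement O(M) by
    [ascent_chord]; between these two moments [level_chord] applies. *)
Lemma rough_geodesic_top c t n : rough_geodesic c t n ->
  exists l, (l <= n)%N /\ r (c 0%N) (c n) <= summit_cst * d (c l).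
Proof.
move=> H; have k0 := level_cst_ge.
have [l [lln dl]] : exists l, (l <= n)%N /\ forall i, (i <= n)%N -> d (c i) <= d (c l).
  elim: n {H} => [|n [l [lln dl]]].
    by exists 0%N; split => // i; rewrite leqn0 => /eqP ->.
  have [h|h] := leP (d (c n.+1)) (d (c l)); [exists l|exists n.+1].
    split => [|i]; first exact: leqW.
    by rewrite leq_eqVlt => /predU1P[->//|]; rewrite ltnS; exact: dl.
  split=> // i; rewrite leq_eqVlt => /predU1P[->//|]; rewrite ltnS => /dl.
  by move/le_trans; apply; exact: ltW.
exists l; split => //; set M := d (c l).
have M0 : 0 < M by exact: d_gt0.
have ex (a : R) : 0 < a -> exists N, M / 2 <= 2 ^+ N * a.
  move=> a0; exists (Num.truncn (M / a)).+1.
  have h1 := truncnS_gt (M / a); rewrite ltr_pdivrMr // in h1.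
  have h2 : ((Num.truncn (M / a)).+1%:R : R) <= 2 ^+ (Num.truncn (M / a)).+1.
    by rewrite -natrX ler_nat ltnW // ltn_expl.
  have : (Num.truncn (M / a)).+1%:R * a <= 2 ^+ (Num.truncn (M / a)).+1 * a by rewrite ler_wpM2r // ltW.
  lra.
have [|i [il di dli]] := @first_index (fun l => M / 2 <= d (c l)) l; first by rewrite /= -/M; lra.
have [|j [jl dj dlj]] := @first_index (fun l => M / 2 <= d (c (n - l)%N)) (n - l)%N.
  by rewrite /= subKn // -/M; lra.
have h1 : e (c 0%N) (c i) <= 4 * level_cst * (M / 2).
  have [N hN] := ex _ (d_gt0 (c 0%N)).
  apply: (ascent_chord H) hN _ _ => //; [exact: leq_trans lln|lra|].
  by move=> l' /dli; rewrite -ltNge.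
have h2 : e (c n) (c (n - j)%N) <= 4 * level_cst * (M / 2).
  have [N hN] := ex _ (d_gt0 (c n)).
  have := @ascent_chord N _ _ _ j (M / 2) (rough_geodesic_rev H); rewrite subn0; apply => //.
  - by rewrite (leq_trans jl) // leq_subr.
  - lra.
  - by move=> l' /dlj; rewrite -ltNge.
have h3 : e (c i) (c (n - j)%N) <= level_cst * M.
  have ij : (i <= n - j)%N by rewrite (leq_trans il) // -(subKn lln) leq_sub2l.
  apply: (level_chord H); rewrite ?ij ?leq_subr //; [|lra|lra].
  by move=> l' /andP[_ h]; apply: dl; rewrite (leq_trans h) // leq_subr.
have := e_tri (c i) (c 0%N) (c n); have := e_tri (c (n - j)%N) (c i) (c n).
rewrite (e_sym (c (n - j)%N)); have := dl 0%N (leq0n n); have := dl n (leqnn n).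
by rewrite -/M /rdist /summit_cst; nra.
Qed.

Lemma ascent x y s : 0 < s -> summit_cst * s <= r x y -> exists p,
  [/\ k x p + k p y <= k x y + 1 / 2, s <= d p, d p <= 2 * s \/ p = x & e x p <= ascent_cst * s].
Proof.
move=> s0 sr; have k0 := level_cst_ge.
have [|n [c [t [c0 cn H1 H2]]]] := @k_geodesic x y (1 / 2); first by rewrite divr_gt0.
have H : rough_geodesic c t n by [].
have [l [lln hl]] := rough_geodesic_top H; rewrite c0 cn in hl.
have k2 : 0 < summit_cst by rewrite /summit_cst; lra.
have sl : s <= d (c l) by rewrite -(ler_pM2l k2); exact: le_trans hl.
have [j [jl sj dlj]] := @first_index (fun l => s <= d (c l)) l sl.
have jn := leq_trans jl lln.
have {}dlj i : (i < j)%N -> d (c i) < s by move=> /dlj; rewrite -ltNge.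
exists (c j); split => //.
- have := H1 0%N n; have := H1 0%N j; have := H1 j n; rewrite jn !leqnn !leq0n c0 cn /=.
  by move=> /(_ isT)/andP[+ _] /(_ isT)/andP[+ _] /(_ isT)/andP[_]; lra.
- case: j jl sj dlj jn => [|j] jl sj dlj jn; first by right.
  by left; have := rough_geodesic_d H jn; have := dlj j (leqnn _); lra.
- have [N hN] : exists N, s <= 2 ^+ N * d (c 0%N).
    exists (Num.truncn (s / d (c 0%N))).+1; have d0 := d_gt0 (c 0%N).
    have h1 := truncnS_gt (s / d (c 0%N)); rewrite ltr_pdivrMr // in h1.
    have h2 : ((Num.truncn (s / d (c 0%N))).+1%:R : R) <= 2 ^+ (Num.truncn (s / d (c 0%N))).+1.
      by rewrite -natrX ler_nat ltnW // ltn_expl.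
    have : (Num.truncn (s / d (c 0%N))).+1%:R * d (c 0%N)
        <= 2 ^+ (Num.truncn (s / d (c 0%N))).+1 * d (c 0%N) by rewrite ler_wpM2r // ltW.
    lra.
  by rewrite -c0; exact: (ascent_chord H) hN _ _.
Qed.

Definition detour_slope K := K * summit_cst * (1 + K) + 2 * (2 + K * summit_cst * K) + ascent_cst.
Definition detour_cst K := 2 * (2 * C * ln (detour_slope K) + C) + 1 / 2.

Lemma join_slope_ge1 K : 1 <= K -> 1 <= detour_slope K.
Proof.
by have [c1 k0] := (C1, level_cst_ge) => K1'; rewrite /detour_slope /ascent_cst /summit_cst; nra.
Qed.

Lemma join_cst_ge0 K : 1 <= K -> 0 <= detour_cst K.
Proof.
move=> /join_slope_ge1/ln_ge0 h; rewrite /detour_cst; have c1 := C1; nra.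
Qed.

(** A near-geodesic from [x] to [y] contains a point q at a height comparable to that of [p] and at
    a distance O(d p) from [x]. Then p and q are at comparable heights and distance, so [k p q] is
    bounded, and passing through [p] costs only a constant. *)
Lemma detour K x y p : 1 <= K -> r x p <= K * d p -> d p <= K * r x y ->
  k x p + k p y <= k x y + detour_cst K.
Proof.
have [c1 k0] := (C1, level_cst_ge); move=> K1'; pose A := K * summit_cst.
pose Q := A * (1 + K) + 2 * (2 + A * K) + ascent_cst.
have A0 : 0 < A by rewrite /A /summit_cst; nra.
have Q1 : 1 <= Q by exact: join_slope_ge1.
have lQ : 0 <= ln Q by exact: ln_ge0.
have -> : detour_cst K = 2 * (2 * C * ln Q + C) + 1 / 2 by [].
move=> xp py; have p0 := d_gt0 p; set s := d p / A.
have s0 : 0 < s by rewrite divr_gt0.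
have ps : d p = A * s by rewrite /s; field; rewrite lt0r_neq0.
have sr : summit_cst * s <= r x y.
  rewrite -(@ler_pM2l _ K); last lra.
  by rewrite mulrA -/A -ps.
have [q [h1 h2 h3 h4]] := ascent s0 sr.
have dx : d x <= r x p by exact: d_le_rdist.
have dq : d q <= (2 + A * K) * s.
  case: h3 => [h3|->]; first by apply: le_trans h3 _; rewrite ler_pM2r //;
    have := mulr_gt0 A0 (lt_le_trans ltr01 K1'); lra.
  apply: le_trans dx _; apply: le_trans xp _; rewrite ps mulrA (mulrC K) ler_pM2r //; lra.
have k1 : k p q <= 2 * C * ln Q + C.
  apply: (k_le_near s0) => //; [lra| |by rewrite ps ler_peMl ?(ltW s0) // /A /summit_cst; nra].
  apply: le_trans (rdist_triangle x _ _) _; rewrite (rdist_sym p x).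
  have : r x q <= ascent_cst * s + K * d p + d q by rewrite /rdist; lra.
  move: xp dq; rewrite ps /Q; set a := (2 + A * K) * s => xp dq.
  have -> : (A * (1 + K) + 2 * (2 + A * K) + ascent_cst) * s =
      A * s + K * (A * s) + 2 * a + ascent_cst * s by rewrite /a; ring.
  have : K * (A * s) <= a by rewrite /a; nra.
  by have := d_gt0 q; lra.
by have := k_tri q x p; have := k_tri q p y; rewrite (k_sym q p); lra.
Qed.

Hypothesis e_unbounded : forall x M, exists y, M <= e x y.

(** Unboundedness supplies a target far enough away for the geodesic to rise to height [s]. *)
Lemma raise x s : d x <= s -> exists p, [/\ s <= d p, d p <= 2 * s & e x p <= ascent_cst * s].
Proof.
move=> xs; have s0 : 0 < s by exact: lt_le_trans xs.
have [y hy] := e_unbounded x (summit_cst * s).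
have [|p [_ h2 h3 h4]] := @ascent x y s s0.
  by rewrite /rdist; have := d_gt0 x; have := d_gt0 y; lra.
by exists p; split => //; case: h3 => // ->; lra.
Qed.

Definition height_cst := detour_cst (ascent_cst + 4).

Lemma height_cst_ge0 : 0 <= height_cst.
Proof. by apply: join_cst_ge0; have := level_cst_ge; rewrite /ascent_cst; lra. Qed.

(** The point [p] above [x] at height about [r x y] satisfies the hypotheses of [detour] for all
    three pairs among x, y, o. Hence [p] is an approximate centre of this triangle, and the product
    is the distance from the base point to it. *)
Lemma gprod_at_height o x y : r x y <= d o -> exists p,
  [/\ r x y <= d p, d p <= 2 * r x y, r x p <= (ascent_cst + 3) * r x y &
      `|gprod k o x y - k p o| <= height_cst].
Proof.
have k0 := level_cst_ge; have k1 : 1 <= ascent_cst + 4 by rewrite /ascent_cst; lra.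
have [B0 HB] := (height_cst_ge0, fun x y p => @detour _ x y p k1) => xyo.
set B := height_cst in B0 *.
have [p [p1 p2 p3]] := raise (d_le_rdist x y).
have dx := d_le_rdist x y; have dy := d_le_rdist y x; rewrite rdist_sym in dy.
have rxy0 := rdist_gt0 x y.
have h3 : r x p <= (ascent_cst + 3) * r x y by rewrite /rdist in p2 p3 dx *; lra.
exists p; split => //.
have k13 : 0 < ascent_cst by rewrite /ascent_cst; lra.
have h4 : (ascent_cst + 3) * r x y <= (ascent_cst + 3) * d p by rewrite ler_wpM2l //; lra.
have J1 : k x p + k p y <= k x y + B by apply: HB; [nra|nra].
have J2 : k x p + k p o <= k x o + B.
  by apply: HB; [nra|have := d_le_rdist o x; rewrite rdist_sym => ?; nra].
have J3 : k y p + k p o <= k y o + B.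
  apply: HB; last by have := d_le_rdist o y; rewrite rdist_sym => ?; nra.
  by have := rdist_triangle x y p; rewrite (rdist_sym y x); nra.
have := k_tri p x o; have := k_tri p y o; have := k_tri p x y; rewrite (k_sym p y).
by rewrite (k_sym y p) in J3 *; rewrite /gprod ler_norml; lra.
Qed.

Definition diff_cst := 2 * height_cst + detour_cst (3 * (ascent_cst + 3) + 2) +
  2 * C * ln (3 * (ascent_cst + 3)) + 3 * C + 2.

Lemma ln2_le1 : ln (2 : R) <= 1.
Proof. by have := @le_ln1Dx R 1; move=> H; apply: le_trans (H _); lra. Qed.

Lemma ln2_ge0 : 0 <= ln (2 : R).
Proof. by apply: ln_ge0; lra. Qed.

Lemma diff_cst_ge1 : 1 <= diff_cst.
Proof.
have [c1 k0] := (C1, level_cst_ge).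
have := height_cst_ge0; have : 0 <= detour_cst (3 * (ascent_cst + 3) + 2).
  by apply: join_cst_ge0; rewrite /ascent_cst; lra.
have : 0 <= ln (3 * (ascent_cst + 3)) by apply: ln_ge0; rewrite /ascent_cst; lra.
by rewrite /diff_cst; nra.
Qed.

(** With centres p for x, y and q for x, z, the point q lies approximately between p and [o], so the
    difference of products is close to [k p q]. This is bounded below by the change of ln d and
    above by [k_le]. *)
Lemma gprod_difference o x y z :
  r x y <= d o -> r x z <= d o -> r x y <= 2 * r x z ->
  (ln (r x z) - ln (r x y)) - diff_cst <= gprod k o x y - gprod k o x z
    <= 2 * C * (ln (r x z) - ln (r x y)) + diff_cst.
Proof.
have [k0 c1] := (level_cst_ge, C1); set B := height_cst.
have k1 : 1 <= 3 * (ascent_cst + 3) + 2 by rewrite /ascent_cst; lra.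
set B' := detour_cst (3 * (ascent_cst + 3) + 2); have B0 := height_cst_ge0; rewrite -/B in B0.
have B'0 : 0 <= B' by exact: join_cst_ge0.
pose Q := 3 * (ascent_cst + 3).
have Q1 : 1 <= Q by rewrite /Q /ascent_cst; lra.
have lQ : 0 <= ln Q by exact: ln_ge0.
have l2 := ln2_ge0.
move=> xyo xzo xyz.
have [p [p1 p2 p3 p4]] := gprod_at_height xyo; have [q [q1 q2 q3 q4]] := gprod_at_height xzo.
have rz := rdist_gt0 x z; have ry := rdist_gt0 x y.
have h0 : 0 < ascent_cst + 3 by rewrite /ascent_cst; lra.
have rpq : r p q <= Q * r x z.
  apply: le_trans (rdist_triangle x _ _) _; rewrite (rdist_sym p x) /Q.
  have : (ascent_cst + 3) * r x y <= (ascent_cst + 3) * (2 * r x z) by rewrite ler_pM2l.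
  lra.
have J : k p q + k q o <= k p o + B'.
  apply: (detour k1).
    apply: le_trans rpq _; apply: (@le_trans _ _ (Q * d q)); first by rewrite ler_pM2l //; lra.
    by rewrite ler_pM2r ?d_gt0 // /Q; lra.
  have := d_le_rdist o p; rewrite rdist_sym => h; have : 2 * r p o <= (3 * (ascent_cst + 3) + 2) * r p o.
    by rewrite ler_pM2r ?rdist_gt0 //; lra.
  by lra.
have J' : k p o <= k p q + k q o by exact: k_tri.
have lo : ln (r x z) - ln (r x y) - ln 2 <= k p q.
  apply: le_trans (ln_d_lip p q); have := ler_ln_le rz q1.
  have : ln (d p) <= ln 2 + ln (r x y) by apply: ln_le_scaled.
  lra.
have hi : k p q <= 2 * C * (ln (r x z) - ln (r x y)) + 2 * C * ln Q + 2 * C * ln 2 + C.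
  apply: le_trans (k_le p q) _.
  have h1 := ler_ln_le rz q1; have h2 := ler_ln_le ry p1.
  have h3 : ln (r p q) <= ln Q + ln (r x z) by apply: ln_le_scaled => //; [exact: rdist_gt0|lra].
  have h4 : ln (r x y) <= ln 2 + ln (r x z) by apply: ln_le_scaled.
  have : C * (2 * ln (r p q) - ln (d p) - ln (d q)) <=
         C * (2 * (ln (r x z) - ln (r x y) + ln Q + ln 2)) by rewrite ler_wpM2l //; lra.
  by nra.
have h4 := ln2_le1.
have : 2 * C * ln (2 : R) <= 2 * C by rewrite -[leRHS]mulr1 ler_wpM2l //; lra.
have : 0 <= 2 * C * ln Q by rewrite !mulr_ge0 //; lra.
by move: p4 q4; rewrite !ler_norml /diff_cst -/B -/B' -/Q; lra.
Qed.

Lemma high_point (S : R) (x : X) : exists o, S <= d o.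
Proof.
have [|o [h _ _]] := @raise x (Num.max S (d x)); first by rewrite le_max lexx orbT.
by exists o; apply: le_trans h; rewrite le_max lexx.
Qed.

Lemma gprod_near o x y z : r x y <= d o -> r x z <= d o -> r x y <= 2 * r x z ->
  gprod k o x z - (diff_cst + 1) <= gprod k o x y.
Proof.
move=> h1 h2 h3; have := gprod_difference h1 h2 h3.
have := ln_le_scaled (rdist_gt0 x y) (ltr0n _ 2) (rdist_gt0 x z) h3.
by have := ln2_le1; lra.
Qed.

(** By the triangle inequality for [r], the larger of [r x z] and [r z y] is at least half of
    [r x y], and [gprod_near] applies to it. *)
Lemma gprod_quasi_ultrametric o x y z : r x y <= d o -> r x z <= d o -> r z y <= d o ->
  Num.min (gprod k o x z) (gprod k o z y) - (diff_cst + 1) <= gprod k o x y.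
Proof.
move=> h1 h2 h3; have tri := rdist_triangle z x y; have [h|h] := leP (r z y) (r x z).
  have h4 : r x y <= 2 * r x z by lra.
  by have := gprod_near h1 h2 h4; rewrite /Num.min; case: ifP; lra.
have h4 : r y x <= 2 * r y z by rewrite rdist_sym (rdist_sym y z); lra.
have := @gprod_near o y x z; rewrite (rdist_sym y x) (rdist_sym y z) => H.
have := H h1 h3; rewrite rdist_sym (rdist_sym z) => {}H; have {}H := H h4.
by move: H; rewrite (gprod_sym k_sym o y x) (gprod_sym k_sym o y z) /Num.min; case: ifP; lra.
Qed.

(** The quasi-ultrametric inequality holds only at base points high above the other points. It gives
    the four-point inequality there, which does not depend on the base point; two instances of the
    error are used. *)
Lemma log_hyperbolic : hyperbolic k (2 * (diff_cst + 1)).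
Proof.
move=> x y z w.
have [q ho] := high_point (r x y + r x z + r x w + r y z + r y w + r z w) x.
have [[h1 h2] h3] := (rdist_gt0 x y, rdist_gt0 x z, rdist_gt0 x w).
have [[h4 h5] h6] := (rdist_gt0 y z, rdist_gt0 y w, rdist_gt0 z w).
have um a b c : r a b + r a c + r c b <= d q ->
    Num.min (gprod k q a c) (gprod k q c b) - (diff_cst + 1) <= gprod k q a b.
  move=> h; have [[g1 g2] g3] := (rdist_gt0 a b, rdist_gt0 a c, rdist_gt0 c b).
  by apply: gprod_quasi_ultrametric; lra.
have := @quasi_ultrametric_four_point R (gprod k q x y) (gprod k q z w) (gprod k q x z)
  (gprod k q y w) (gprod k q z y) (gprod k q x w) (diff_cst + 1).
have u1 := um x y z; rewrite (rdist_sym z y) in u1.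
have u2 := um x y w; rewrite (rdist_sym w y) (gprod_sym k_sym q w) in u2.
have u3 := um z w x; rewrite (rdist_sym z x) (gprod_sym k_sym q z x) in u3.
have u4 := um z w y; rewrite (rdist_sym z y) in u4.
move=> H; have := H (u1 _) (u2 _) (u3 _) (u4 _).
have b1 := gprod_base_change k_sym q x y w; have b2 := gprod_base_change k_sym q x z w.
have b3 := gprod_base_change k_sym q z y w; rewrite (gprod_sym k_sym q z w) in b2 b3 *.
by rewrite (gprod_sym k_sym q w z) in b2 b3 *; rewrite /Num.min; case: ifP; case: ifP; lra.
Qed.

(** The model of the Gromov product at an arbitrary base point: what the change of base produces
    from the model - ln r at high base points. *)
Definition height w x y := ln (r x w) + ln (r y w) - ln (r x y) - ln (d w).

(** The change of base from a high point q writes the product as (x|y)_q - (x|w)_q plus (w|w)_q -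
    (w|y)_q, and [gprod_difference] estimates both differences. The assumption [r y w <= r x w]
    ensures its hypothesis [r x y <= 2 * r x w]. *)
Lemma log_gprod w x y :
  height w x y - (2 * diff_cst + 1) <= gprod k w x y <= 2 * C * height w x y + 2 * diff_cst.
Proof.
have c1 := C1.
wlog yx : x y / r y w <= r x w => [H|].
  have [h|/ltW h] := leP (r y w) (r x w); first exact: H.
  have := H y x h; rewrite (gprod_sym k_sym w y) /height (rdist_sym y x); lra.
have [q ho] := high_point (r x y + r x w + r y w + r w w) x.
have [h1 h2 h3 h4] : [/\ 0 < r x y, 0 < r x w, 0 < r y w & 0 < r w w] by split; exact: rdist_gt0.
have e1 := @gprod_difference q x y w; have e2 := @gprod_difference q w w y.
have tri := rdist_triangle w x y; rewrite (rdist_sym w y) in e2 tri.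
have rww : r w w = 2 * d w by rewrite /rdist exx; lra.
have dw := d_le_rdist w y; rewrite (rdist_sym w y) in dw.
have {}e1 := e1 _ _ _; have {}e2 := e2 _ _ _.
have {e1}/andP[a1 a2] : ln (r x w) - ln (r x y) - diff_cst <= gprod k q x y - gprod k q x w <=
       2 * C * (ln (r x w) - ln (r x y)) + diff_cst by apply: e1; lra.
have {e2}/andP[b1 b2] : ln (r y w) - ln (r w w) - diff_cst <= gprod k q w w - gprod k q w y <=
       2 * C * (ln (r y w) - ln (r w w)) + diff_cst by apply: e2; lra.
have eww : ln (r w w) = ln 2 + ln (d w) by rewrite rww lnM ?posrE.
have l2 := ln2_ge0; have l21 := ln2_le1.
have b := gprod_base_change k_sym q x y w.
have gw : gprod k q w w = k q w by rewrite /gprod kxx (k_sym w q); lra.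
rewrite (gprod_sym k_sym q w y) gw in b1 b2; rewrite eww in b1 b2.
have cl : 0 <= 2 * C * ln (2 : R) by rewrite !mulr_ge0 //; lra.
rewrite /height; apply/andP; split; first lra.
have -> : gprod k w x y = (gprod k q x y - gprod k q x w) + (k q w - gprod k q y w) by lra.
lra.
Qed.

End Comparable.
End LogarithmicMetric.

(** * Quasihyperbolic distance in uniform domains *)

Section UniformMetric.
Context {R : realType} {E : completeNormedModType R}.
Variable D : set E.
Hypothesis uD : unbounded_domain D.
Notation k := (@quasihyp R E D).
Notation V := (@set_val E D).
Notation d := (bdist D).

Definition uniform_ratio (A : R) := 1 + (4 * (2 * A + 1))^-1.

(** Along the curve d(x) + u is at most (2A + 1) d(g u), as d(x) <= d(g u) + u and u <= A d(g u).
    Dividing d(x) + u by [uniform_ratio A] therefore moves back by at most d(g u)/4, at [k]-cost at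
    most 1; so cost counts the powers of the ratio. *)
Lemma cigar_chain (A : R) (g : R -> E) (H : R) (x : D) n u (y : D) : 1 <= A ->
  (forall v, 0 <= v <= H -> D (g v) /\ v <= A * d (g v)) ->
  (forall v w, 0 <= v <= H -> 0 <= w <= H -> `|g v - g w| <= `|v - w|) ->
  V x = g 0 -> V y = g u -> 0 <= u <= H ->
  d (V x) + u <= d (V x) * uniform_ratio A ^+ n -> k x y <= n%:R.
Proof.
move=> A1 gD glip xg0; have d0 := bdist_gt0 uD (set_valP x).
pose N := 2 * A + 1; have N0 : 0 < N by rewrite /N; lra.
have iN : 0 < (4 * N)^-1 by rewrite invr_gt0; lra.
have iNE : 4 * N * (4 * N)^-1 = 1 by rewrite divff //; lra.
have q1 : 1 <= uniform_ratio A by rewrite /uniform_ratio -/N; lra.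
elim: n u y => [|n IH] u y yg u0H.
  rewrite expr0 mulr1 => h; have u0 : u = 0 by lra.
  have -> : y = x by apply: val_inj; rewrite [LHS]yg u0 [RHS]xg0.
  by rewrite quasihypxx.
move=> h; have [h'|h'] := leP (d (V x) + u) (d (V x) * uniform_ratio A ^+ n).
  by apply: le_trans (IH u y yg u0H h') _; rewrite ler_nat.
have [u0 uH] := andP u0H; set q := uniform_ratio A in h h' q1 *.
have qE : q = 1 + (4 * N)^-1 by [].
have q0 : 0 < q by lra.
pose u' := Num.max 0 ((d (V x) + u) / q - d (V x)).
have hq : (d (V x) + u) / q * q = d (V x) + u by rewrite divfK // lt0r_neq0.
have Q0 : 0 <= (d (V x) + u) / q by rewrite divr_ge0 //; lra.
have u'u : u' <= u by rewrite /u' ge_max u0 /=; nra.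
have u'0 : 0 <= u' by rewrite /u' le_max lexx.
have u'H : 0 <= u' <= H by rewrite u'0 (le_trans u'u).
have [Dy' _] := gD u' u'H; pose y' : D := SigSub (mem_set Dy').
have k1 : k x y' <= n%:R.
  apply: (IH u') => //; rewrite /u' -lerBrDl ge_max.
  have qn : 1 <= q ^+ n by rewrite exprn_ege1.
  rewrite subr_ge0 ler_peMr ?(ltW d0) //= lerD2r ler_pdivrMr // -mulrA -exprSr //.
have k2 : k y y' <= 1.
  apply: (quasihyp_small uD); rewrite [V y]yg [V y']/=.
  have [_ hu] := gD u u0H.
  have lip := bdist_lip uD (V x) (g u); rewrite xg0 in lip.
  have := glip 0 u; rewrite lexx (le_trans u0 uH) u0H sub0r normrN (ger0_norm u0).
  move=> /(_ isT isT) g1.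
  have dgu : d (V x) + u <= N * d (g u) by rewrite /N xg0; lra.
  apply: le_trans (glip _ _ u0H u'H) _; rewrite ger0_norm ?subr_ge0 //.
  have h2 : u - u' <= (4 * N)^-1 * (d (V x) + u).
    have : (d (V x) + u) / q - d (V x) <= u' by rewrite /u' le_max lexx orbT.
    by move: hq; rewrite qE; move: ((_ + _) / _) Q0 => z z0 hz; nra.
  have : (4 * N)^-1 * (d (V x) + u) <= (4 * N)^-1 * (N * d (g u)) by rewrite ler_pM2l.
  have -> : (4 * N)^-1 * (N * d (g u)) = d (g u) / 4 by field; lra.
  have := bdist_ge0 uD (g u); lra.
by have := quasihyp_triangle uD y' x y; rewrite (quasihyp_sym uD y' y) -natr1; lra.
Qed.

Lemma cigar_length (A : R) (g : R -> E) (H : R) (x y : D) : 1 <= A -> 0 <= H ->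
  (forall v, 0 <= v <= H -> D (g v) /\ v <= A * d (g v)) ->
  (forall v w, 0 <= v <= H -> 0 <= w <= H -> `|g v - g w| <= `|v - w|) ->
  V x = g 0 -> V y = g H ->
  k x y <= (ln (d (V x) + H) - ln (d (V x))) / ln (uniform_ratio A) + 1.
Proof.
move=> A1 H0 gD glip xg yg; have d0 := bdist_gt0 uD (set_valP x).
have q1 : 1 < uniform_ratio A.
  by rewrite /uniform_ratio ltrDl invr_gt0; lra.
have p0 : 0 < uniform_ratio A by exact: lt_trans ltr01 q1.
have lq : 0 < ln (uniform_ratio A) by rewrite ln_gt0.
set L := (_ - _) / _.
have L0 : 0 <= L.
  by rewrite divr_ge0 ?(ltW lq) // subr_ge0; apply: ler_ln_le => //; lra.
have := @cigar_chain A g H x (Num.truncn L).+1 H y A1 gD glip xg yg.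
rewrite H0 lexx => /(_ isT) HH; apply: le_trans (HH _) _.
  have h := ltW (truncnS_gt L); rewrite ler_pdivrMr // in h.
  move: h {HH}; move: (Num.truncn L).+1 => n h.
  rewrite -ler_ln ?posrE ?mulr_gt0 ?exprn_gt0 //; last exact: ltr_wpDr.
  by rewrite lnM ?posrE ?exprn_gt0 // lnXn // -mulr_natl; lra.
rewrite -natr1 lerD2r; by have := truncn_itv L0; case/andP.
Qed.

Definition uniform_cst (A : R) :=
  (ln (uniform_ratio A))^-1 * (1 + 2 * ln (1 + A)) + 2.

Lemma uniform_cst_ge1 (A : R) : 1 <= A -> 1 <= uniform_cst A.
Proof.
move=> A1; have q1 : 1 <= uniform_ratio A.
  by rewrite /uniform_ratio lerDl invr_ge0; lra.
have l1 := ln_ge0 q1; have l2 : 0 <= ln (1 + A) by apply: ln_ge0; lra.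
have : 0 <= (ln (uniform_ratio A))^-1 * (1 + 2 * ln (1 + A)).
  by rewrite mulr_ge0 ?invr_ge0 //; lra.
by rewrite /uniform_cst; lra.
Qed.

Notation e := (fun x y : D => `|V x - V y|).
Notation dd := (fun x : D => d (V x)).
Notation r := (rdist e dd).

Lemma uniform_cst_bound (A H e dx dy k1 k2 : R) : 1 <= A -> 0 < dx -> 0 < dy -> 0 <= e ->
  0 <= H -> 2 * H <= A * e ->
  k1 <= (ln (dx + H) - ln dx) / ln (uniform_ratio A) + 1 ->
  k2 <= (ln (dy + H) - ln dy) / ln (uniform_ratio A) + 1 ->
  k1 + k2 <= uniform_cst A * (2 * ln (e + dx + dy) - ln dx - ln dy) + uniform_cst A.
Proof.
move=> A1 dx0 dy0 e0 H0 HA k1l k2l.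
have p0 : 0 < (4 * (2 * A + 1))^-1 by rewrite invr_gt0; lra.
have lq : 0 < ln (uniform_ratio A) by rewrite ln_gt0 // /uniform_ratio ltrDl.
set r := e + dx + dy; have r0 : 0 < r by rewrite /r; lra.
have A10 : 0 < 1 + A by lra.
have h1 : ln (dx + H) <= ln (1 + A) + ln r by apply: ln_le_scaled => //; rewrite ?/r; nra.
have h2 : ln (dy + H) <= ln (1 + A) + ln r by apply: ln_le_scaled => //; rewrite ?/r; nra.
have h3 : ln dx <= ln r by apply: ler_ln_le; rewrite ?/r; lra.
have h4 : ln dy <= ln r by apply: ler_ln_le; rewrite ?/r; lra.
set G := 2 * ln r - ln dx - ln dy; have G0 : 0 <= G by rewrite /G; lra.
have l2 : 0 <= ln (1 + A) by apply: ln_ge0; lra.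
move: k1l k2l; rewrite ![_ / ln _]mulrC /uniform_cst.
have : 0 < (ln (uniform_ratio A))^-1 by rewrite invr_gt0.
set q := (ln _)^-1 => q0 k1l k2l.
have : q * (ln (dx + H) - ln dx) + q * (ln (dy + H) - ln dy) <= q * (G + 2 * ln (1 + A)).
  by rewrite -mulrDr ler_wpM2l ?(ltW q0) // /G; lra.
have : 0 <= q * ln (1 + A) * G by rewrite !mulr_ge0 // ltW.
have : 0 <= q * G by rewrite mulr_ge0 // ltW.
lra.
Qed.

Lemma uniform_quasihyp_le (A : R) (x y : D) : 1 <= A -> uniform_domain A D ->
  k x y <= uniform_cst A * (2 * ln (r x y) - ln (d (V x)) - ln (d (V y))) + uniform_cst A.
Proof.
move=> A1 UD; have [g [gi gr gL gc]] := UD _ _ (set_valP x) (set_valP y).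
have [gcont g0 g1 Dg] := gi.
set L := arclength g 1.
have L0 : 0 <= L by rewrite -(arclength0 g) arclength_homo.
have LA : L <= A * `|V x - V y|.
  by move: gL; rewrite curve_length_arclength // arclength0 subr0 lee_fin.
move: gL => _.
have dx := bdist_gt0 uD (set_valP x); have dy := bdist_gt0 uD (set_valP y).
pose ga := arcparam g.
have gap u : 0 <= u <= L -> D (ga u) /\ Num.min u (L - u) <= A * d (ga u).
  move=> uL; have [t t01 [Lt gt]] := arcparamP gr gcont uL; rewrite /ga gt; have [t0 t1] := andP t01.
  split; first by apply: Dg; rewrite in_itv.
  have := gc t; rewrite in_itv /= => /(_ t01).
  rewrite !curve_length_arclength // ?lexx // arclength0 subr0 Lt -/L -EFin_min lee_fin //.
move: gc => _.
have galip u v : 0 <= u <= L -> 0 <= v <= L -> `|ga u - ga v| <= `|u - v|.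
  exact: arcparam_lip.
have ga0 : ga 0 = V x.
  by have := arcparam_arclength gr gcont (t := 0); rewrite arclength0 lexx ler01 g0 => /(_ isT).
have ga1 : ga L = V y by rewrite /ga /L arcparam_arclength ?lexx ?ler01.
(* The curve is split at its midpoint: on either half the minimum in the definition of uniformity is
   the length from that half's own endpoint. *)
pose H := L / 2; have H0 : 0 <= H by rewrite /H; lra.
have HL : 0 <= H <= L by rewrite /H; lra.
have [Dz _] := gap H HL; pose z : D := SigSub (mem_set Dz).
have k1 : k x z <= (ln (d (V x) + H) - ln (d (V x))) / ln (uniform_ratio A) + 1.
  apply: (@cigar_length A ga) => //.
    move=> v v0; have vL : 0 <= v <= L by rewrite /H in v0; lra.
    have [Dv hv] := gap v vL; split => //; move: hv; rewrite min_l //; rewrite /H in v0; lra.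
  by move=> v w hv hw; apply: galip; rewrite /H in hv hw; lra.
have k2 : k y z <= (ln (d (V y) + H) - ln (d (V y))) / ln (uniform_ratio A) + 1.
  apply: (@cigar_length A (fun u => ga (L - u))) => //; last 2 first.
  - by rewrite subr0.
  - by rewrite /H; have -> : L - L / 2 = L / 2 by lra.
  - move=> v v0; have vL : 0 <= L - v <= L by rewrite /H in v0; lra.
    have [Dv hv] := gap _ vL; split => //; move: hv; rewrite subKr min_r //; rewrite /H in v0; lra.
  move=> v w hv hw; apply: le_trans (galip _ _ _ _) _; rewrite /H in hv hw; [lra|lra|].
  have -> : L - v - (L - w) = - (v - w) by ring.
  by rewrite normrN.
apply: (@le_trans _ _ (k x z + k y z)).
  by rewrite (quasihyp_sym uD y z) (quasihyp_triangle uD).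
have HA : 2 * H <= A * `|V x - V y| by rewrite /H mulrC divfK.
exact: uniform_cst_bound (normr_ge0 _) H0 HA k1 k2.
Qed.

End UniformMetric.

(** * Gauges and quasisymmetric bijections *)

Section Gauge.
Context {R : realType}.
Implicit Types (f g eta : R -> R).

(** Surjectivity excludes jumps: values just above and below [f x] are attained, at points enclosing
    [x]. *)
Lemma increasing_surj_continuous f :
  (forall t, 0 <= t -> 0 <= f t) -> (forall s t, 0 <= s -> s < t -> f s < f t) ->
  (forall v, 0 <= v -> exists2 t, 0 <= t & f t = v) ->
  dcontinuous `[0, +oo[ (fun a c => `|a - c|) (fun a c => `|a - c|) f.
Proof.
move=> f0 finc fsurj x /=; rewrite in_itv /= andbT => x0 e e0.
have lt_f s t : 0 <= s -> 0 <= t -> f s < f t -> s < t.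
  move=> s0 t0 h; rewrite ltNge le_eqVlt; apply/negP => /orP[/eqP ts|/(finc _ _ t0)]; last lra.
  by rewrite ts ltxx in h.
have fx := f0 x x0; have [|u u0 fu] := fsurj (f x + e / 2); first lra.
have xu : x < u by apply: lt_f => //; lra.
have [w [wx Hw]] : exists w, w < x /\ forall y, 0 <= y -> w < y -> f x - e < f y.
  have [h|h] := leP 0 (f x - e / 2).
    have [w w0 fw] := fsurj _ h; exists w; split; first by apply: lt_f => //; lra.
    by move=> y y0 /(finc _ _ w0); lra.
  by exists (x - 1); split; [lra|move=> y /f0; lra].
exists (Num.min (u - x) (x - w)); first by rewrite lt_min !subr_gt0 xu wx.
move=> y; rewrite in_itv /= andbT => y0; rewrite lt_min => /andP[h1 h2].
have h3 : y < u by move: h1; rewrite ltr_norml => /andP[]; lra.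
have h4 : w < y by move: h2; rewrite ltr_norml => /andP[]; lra.
have h5 := Hw y y0 h4; have h6 := finc _ _ y0 h3.
by rewrite ltr_norml; apply/andP; split; lra.
Qed.

Lemma gauge_increasing f :
  (forall t, 0 <= t -> 0 <= f t) -> (forall s t, 0 <= s -> s < t -> f s < f t) ->
  (forall v, 0 <= v -> exists2 t, 0 <= t & f t = v) -> gauge f.
Proof.
move=> f0 finc fsurj.
have mem (t : R) : `[0, +oo[%classic t = (0 <= t) by rewrite /= in_itv /= andbT.
have inj s t : 0 <= s -> 0 <= t -> f s = f t -> s = t.
  move=> s0 t0 e; have [h|h|//] := ltgtP s t.
    by have := finc _ _ s0 h; rewrite e ltxx.
  by have := finc _ _ t0 h; rewrite e ltxx.
split; first split.
- by move=> t; rewrite !mem; exact: f0.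
- by move=> s t; rewrite !inE !mem; exact: inj.
- by move=> v; rewrite mem => /fsurj[t t0 <-]; exists t; rewrite ?mem.
- exact: increasing_surj_continuous.
move=> g fg; have {}fg t : 0 <= t -> g (f t) = t by move=> t0; apply: fg; rewrite inE mem.
apply: increasing_surj_continuous.
- by move=> v /fsurj[t t0 <-]; rewrite fg.
- move=> _ w /fsurj[s s0 <-] sw; rewrite fg //.
  have [t t0 e] : exists2 t, 0 <= t & f t = w.
    by apply: fsurj; apply: le_trans (ltW sw); exact: f0.
  rewrite -e fg // ltNge le_eqVlt; apply/negP => /orP[/eqP ts|/(finc _ _ t0)].
    by rewrite -e ts ltxx in sw.
  by rewrite e => h; have := lt_trans sw h; rewrite ltxx.
- by move=> t t0; exists (f t); [exact: f0|exact: fg].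
Qed.

Definition power_gauge (K a b t : R) : R := K * (if t <= 1 then t `^ a else t `^ b).

Lemma gauge_power K a b : 0 < K -> 0 < a -> 0 < b -> gauge (power_gauge K a b).
Proof.
move=> K0 a0 b0.
have one (c : R) : 1 `^ c = 1 :> R by rewrite powR1.
have le1 (t c : R) : 0 < c -> 0 <= t -> (t `^ c <= 1) = (t <= 1).
  move=> c0 t0; apply/idP/idP => h; last first.
    by rewrite -(one c); apply: ge0_ler_powR; rewrite ?nnegrE ?ler01 // ltW.
  rewrite leNgt; apply/negP => h'; move: h; rewrite leNgt => /negP; apply.
  by rewrite -(one c); apply: gt0_ltr_powR; rewrite ?nnegrE ?ler01.
have powK (t c : R) : 0 < c -> 0 <= t -> (t `^ c^-1) `^ c = t.
  by move=> c0 t0; rewrite -powRrM mulVf ?lt0r_neq0 // powRr1.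
apply: gauge_increasing => [t t0|s t s0 st|v v0]; rewrite /power_gauge.
- by rewrite mulr_ge0 ?(ltW K0) //; case: ifP => _; rewrite powR_ge0.
- rewrite ltr_pM2l //; have t0 := ltW (le_lt_trans s0 st).
  case: (leP s 1) => s1; case: (leP t 1) => t1.
  + by apply: gt0_ltr_powR; rewrite ?nnegrE.
  + by apply: (@le_lt_trans _ _ 1); [rewrite le1|rewrite ltNge le1 // -ltNge].
  + by have := lt_trans st (le_lt_trans t1 s1); rewrite ltxx.
  + by apply: gt0_ltr_powR; rewrite ?nnegrE.
- have w0 : 0 <= v / K by rewrite divr_ge0 // ltW.
  exists (if v / K <= 1 then (v / K) `^ a^-1 else (v / K) `^ b^-1).
    by case: ifP => _; rewrite powR_ge0.
  case: (leP (v / K) 1) => h.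
    by rewrite le1 ?invr_gt0 // h powK // mulrC divfK ?lt0r_neq0.
  by rewrite le1 ?invr_gt0 // leNgt h /= powK // mulrC divfK ?lt0r_neq0.
Qed.

(** [P] and [S] stand for distances of endpoints and [a] for the difference of their products based
    at b. If P < 2S, the estimate with slope 2C yields the exponent 1/(2 C eps); otherwise the one
    with slope 1 yields 1/eps. For t <= 1 the first exponent gives the larger bound, for t > 1 the
    second. *)
Lemma power_gauge_bound (C eps B t P S a : R) : 1 <= C -> 0 < eps -> 0 < t ->
  0 < P -> 0 < S -> 0 <= B -> - (ln t / eps + eps^-1) <= a ->
  (P < 2 * S -> a <= 2 * C * (ln S - ln P) + B) ->
  (S < 2 * P -> ln P - ln S - B <= - a) ->
  P <= power_gauge (expR (B + eps^-1)) (2 * C * eps)^-1 eps^-1 t * S.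
Proof.
move=> C1 e0 t0 P0 S0 B0 ha H1 H2.
have ie : 0 < eps^-1 by rewrite invr_gt0.
pose L := if t <= 1 then (2 * C * eps)^-1 * ln t else eps^-1 * ln t.
have ic : (2 * C * eps)^-1 <= eps^-1.
  by rewrite invfM ler_piMl ?(ltW ie) // invf_le1; lra.
have [L1 L2] : eps^-1 * ln t <= L /\ (2 * C * eps)^-1 * ln t <= L.
  rewrite /L; case: (leP t 1) => t1.
    by have l0 : ln t <= 0 := ln_le0 t1; split => //; nra.
  by have l0 : 0 <= ln t by [apply: ln_ge0; exact: ltW]; split => //; nra.
suff HL : ln P - ln S <= B + eps^-1 + L.
  have -> : power_gauge (expR (B + eps^-1)) (2 * C * eps)^-1 eps^-1 t = expR (B + eps^-1 + L).
    by rewrite /power_gauge (expRD (B + eps^-1)) /L /powR gt_eqF //; case: (t <= 1).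
  rewrite -[X in X <= _](@lnK R) ?posrE // -[X in _ <= _ * X](@lnK R) ?posrE // -expRD ler_expR.
  by lra.
have [c|c] := ltP P (2 * S).
  have G := H1 c; have c2 : 0 < 2 * C by lra.
  have G1 : (ln P - ln S) * (2 * C) <= (ln t / eps + eps^-1 + B) by lra.
  rewrite -ler_pdivlMr // in G1; apply: le_trans G1 _.
  have -> : (ln t / eps + eps^-1 + B) / (2 * C) = (2 * C * eps)^-1 * ln t + (eps^-1 + B) / (2 * C).
    by field; rewrite !lt0r_neq0 //; lra.
  have : (eps^-1 + B) / (2 * C) <= eps^-1 + B by rewrite ler_pdivrMr // ler_peMr; lra.
  by lra.
have c' : S < 2 * P by lra.
have G := H2 c'.
by rewrite mulrC in L1; lra.
Qed.

Lemma expR_ratio_log (eps t a a' s s' : R) : 0 < eps -> 0 < t ->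
  expR (- (eps * a)) / 2 <= s -> s <= t * s' -> s' <= expR (- (eps * a')) ->
  a' - a <= ln t / eps + eps^-1.
Proof.
move=> e0 t0 h1 h2 h3; have l2 : ln (2 : R) <= 1 := @ln2_le1 R.
have : expR (- (eps * a)) <= (2 * t) * expR (- (eps * a')) by nra.
rewrite -ler_ln ?posrE ?mulr_gt0 ?expR_gt0 // lnM ?posrE ?mulr_gt0 ?expR_gt0 //.
rewrite lnM ?posrE // !expRK => h4.
suff h5 : eps * (a' - a) <= eps * (ln t / eps + eps^-1) by rewrite ler_pM2l in h5.
have -> : eps * (ln t / eps + eps^-1) = ln t + 1 by field; rewrite lt0r_neq0.
by lra.
Qed.

Lemma gauge_ge0 eta t : gauge eta -> 0 <= t -> 0 <= eta t.
Proof.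
move=> [[+ _ _] _ _] t0 => /(_ t); rewrite /= !in_itv /= !andbT; exact.
Qed.

(** If the zero of [eta] were at some s > 0, then by the intermediate value theorem small positive
    values would be attained on both sides of s, against injectivity. *)
Lemma gauge0 eta : gauge eta -> eta 0 = 0.
Proof.
move=> ge; have e0 t : 0 <= t -> 0 <= eta t by exact: gauge_ge0.
have mem (t : R) : `[0, +oo[%classic t = (0 <= t) by rewrite /= in_itv /= andbT.
move: ge => [[_ inj surj] cont _].
have {}inj s t : 0 <= s -> 0 <= t -> eta s = eta t -> s = t.
  by move=> s0 t0; apply: inj; rewrite inE mem.
have ivt a b v : 0 <= a -> a <= b -> Num.min (eta a) (eta b) <= v <= Num.max (eta a) (eta b) ->
    exists2 c, a <= c <= b & eta c = v.
  move=> a0 ab h; have [|c] := @IVT R eta a b v ab _ h.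
    apply/subspace_continuousP => x; rewrite /= in_itv /= => /andP[ax xb].
    apply/cvgrPdist_lt => e e_gt0; have [|d d0 Hd] := cont x _ e e_gt0.
      by rewrite mem (le_trans a0).
    exists d => //= y xy; rewrite in_itv /= => /andP[ay yb]; rewrite distrC distrC.
    by apply: Hd; rewrite ?mem ?(le_trans a0).
  by rewrite in_itv /= => h1 h2; exists c.
apply/eqP; rewrite eq_le e0 // andbT leNgt; apply/negP => p0.
have [s] := surj 0 ltac:(by rewrite mem); rewrite mem => s0 es.
pose v := Num.min (eta 0) (eta (s + 1)).
have h1 : eta (s + 1) != 0.
  apply/eqP; rewrite -es => /(inj _ _ _ s0); have : s + 1 != s by rewrite gt_eqF ?ltrDl.
  by move=> /eqP h h'; apply: h; apply: h'; rewrite addr_ge0.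
have e1 : 0 < eta (s + 1) by rewrite lt0r h1 e0 ?addr_ge0.
have v0 : 0 < v by rewrite lt_min p0 e1.
have [|c /andP[c0 cs] ec] := ivt 0 s (v / 2) (lexx _) s0.
  have vl : v <= eta 0 by rewrite ge_min lexx.
  by rewrite es ge_min le_max; apply/andP; split; apply/orP; [right|left]; lra.
have [||c' /andP[c1 _] ec'] := ivt s (s + 1) (v / 2) s0; first lra.
  have vl : v <= eta (s + 1) by rewrite ge_min lexx orbT.
  by rewrite es ge_min le_max; apply/andP; split; apply/orP; [left|right]; lra.
have cc : c = c' by apply: inj => //; [exact: le_trans c1|rewrite ec].
have cs' : c = s by apply/eqP; rewrite eq_le cs cc c1.
by move: ec; rewrite cs' es; lra.
Qed.

Lemma gauge_small eta (c : R) : gauge eta -> 0 < c ->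
  exists2 t0 : R, 0 < t0 & forall t, 0 <= t -> t < t0 -> eta t < c.
Proof.
move=> ge c0; have e0 := gauge0 ge; have [_ cont _] := ge.
have mem (t : R) : `[0, +oo[%classic t = (0 <= t) by rewrite /= in_itv /= andbT.
have [|d d0 Hd] := cont 0 _ c c0; first by rewrite mem.
exists d => // t t0 td; have := Hd t; rewrite mem e0 !sub0r !normrN !ger0_norm ?gauge_ge0 //.
exact.
Qed.

Section Homeomorphism.
Context {S S' : Type}.
Variables (Y : set S) (s : S -> S -> R) (Y' : set S') (s' : S' -> S' -> R).
Variables (f : S -> S') (eta : R -> R).
Hypothesis ge : gauge eta.
Hypothesis bij : set_bij Y Y' f.
Hypothesis sxx : forall x, Y x -> s x x = 0.
Hypothesis s_gt0 : forall x y, Y x -> Y y -> x <> y -> 0 < s x y.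
Hypothesis s'xx : forall x, s' x x = 0.
Hypothesis s'_gt0 : forall x y, x <> y -> 0 < s' x y.
Hypothesis qs : forall (t : R) x y z, 0 < t -> Y x -> Y y -> Y z ->
    s x y <= t * s x z -> s' (f x) (f y) <= eta t * s' (f x) (f z).

(** Continuity at x comes from comparing y with one fixed point z, since [eta] is small near 0. For
    the inverse, a point at distance at least e from x is compared with one fixed y0, which bounds
    the distance of its image from below. Spaces with one point are treated apart. *)
Lemma quasisymmetric_bij : quasisymmetric eta Y s Y' s' f.
Proof.
have [fY inj surj] := bij.
have {}inj x y : Y x -> Y y -> f x = f y -> x = y by move=> Yx Yy; apply: inj; rewrite inE.
split=> //; split=> //.
  move=> x Yx e e0; have [[z [Yz xz]]|H] := pselect (exists z, Y z /\ x <> z); last first.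
    exists 1 => // y Yy _; suff -> : x = y by rewrite s'xx.
    by apply: contrapT => xy; apply: H; exists y.
  have sz := s_gt0 Yx Yz xz.
  have fz : 0 < s' (f x) (f z) by apply: s'_gt0 => /(inj _ _ Yx Yz).
  have [t0 t00 Ht] := gauge_small ge (divr_gt0 e0 fz).
  exists (t0 * s x z); first by rewrite mulr_gt0.
  move=> y Yy h; have [->|xy] := pselect (x = y); first by rewrite s'xx.
  have sy := s_gt0 Yx Yy xy.
  have t1 : 0 < s x y / s x z by rewrite divr_gt0.
  have := @qs _ x y z t1 Yx Yy Yz; rewrite divfK ?lt0r_neq0 // => /(_ (lexx _)) h1.
  apply: le_lt_trans h1 _; rewrite -ltr_pdivlMr //; apply: Ht; first exact: ltW.
  by rewrite ltr_pdivrMr.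
move=> g fg y' /surj[x Yx <-] e e0; have gx x' : Y x' -> g (f x') = x' by move=> Yx'; rewrite fg // inE.
have [[y0 [Yy0 xy0]]|H] := pselect (exists z, Y z /\ x <> z); last first.
  exists 1 => // _ /surj[z Yz <-] _; rewrite !gx //; have -> : z = x.
    by apply: contrapT => zx; apply: H; exists z; split => // /esym.
  by rewrite sxx.
have s0 := s_gt0 Yx Yy0 xy0; have t0 := divr_gt0 s0 e0.
have eta0 := gauge_ge0 ge (ltW t0).
have fy0 : 0 < s' (f x) (f y0) by apply: s'_gt0 => /(inj _ _ Yx Yy0).
exists (s' (f x) (f y0) / (eta (s x y0 / e) + 1)); first by rewrite divr_gt0 // ltr_wpDl.
move=> _ /surj[z Yz <-]; rewrite !gx // ltr_pdivlMr ?ltr_wpDl // => h.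
rewrite ltNge; apply/negP => ez.
have := @qs _ x y0 z t0 Yx Yy0 Yz; rewrite mulrAC ler_pdivlMr // ler_pM2l // => /(_ ez) h2.
have : x <> z by move=> xz; rewrite -xz sxx // in ez; lra.
move=> xz; have : 0 < s' (f x) (f z) by apply: s'_gt0 => /(inj _ _ Yx Yz).
by rewrite mulrDr mulr1 mulrC in h; lra.
Qed.
End Homeomorphism.
End Gauge.

(** * The boundary of a uniform domain *)

Section Convergence.
Context {R : realType} {E : completeNormedModType R}.
Variable D : set E.
Notation k := (@quasihyp R E D).
Notation V := (@set_val E D).

Definition tends (u : nat -> D) (q : option E) : Prop :=
  if q is Some p then forall e : R, 0 < e -> \forall i \near \oo, `|V (u i) - p| < e
  else forall M : R, \forall i \near \oo, M < `|V (u i)|.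

Lemma tends_unique u q q' : tends u q -> tends u q' -> q = q'.
Proof.
case: q q' => [p|] [p'|] //= H H'.
- congr Some; apply/eqP; rewrite -subr_eq0 -normr_le0; apply/ler_addgt0Pr => e e0.
  have e2 : 0 < e / 2 by rewrite divr_gt0.
  near \oo => i; have h : `|V (u i) - p| < e / 2 by near: i; exact: H.
  have h' : `|V (u i) - p'| < e / 2 by near: i; exact: H'.
  by rewrite -(subrKA (V (u i))); apply: le_trans (ler_normD _ _) _; rewrite distrC; lra.
- exfalso; near \oo => i; have h : `|V (u i) - p| < 1 by near: i; exact: H.
  have h' : `|p| + 1 < `|V (u i)| by near: i; exact: H'.
  by have := ler_normD (V (u i) - p) p; rewrite subrK; lra.
- exfalso; near \oo => i; have h : `|V (u i) - p'| < 1 by near: i; exact: H'.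
  have h' : `|p'| + 1 < `|V (u i)| by near: i; exact: H.
  by have := ler_normD (V (u i) - p') p'; rewrite subrK; lra.
Unshelve. all: end_near. Qed.

Lemma open_infty_Some (W : set (option E)) p : open_infty D W -> W (Some p) ->
  exists2 e : R, 0 < e & forall z, closure D z -> `|z - p| < e -> W (Some z).
Proof.
move=> [sub [[_ [U oU eW]]|[_ [cl _]]]] Wp.
  have [Up _] : (U `&` closure D) p by rewrite -eW.
  have [e e0 He] := openP_dist oU Up; exists e => // z Dz zp.
  by have : (U `&` closure D) z; [split => //; apply: He; rewrite distrC|rewrite -eW].
apply: contrapT => H; have [] : (closure D `\` [set x | W (Some x)]) p; last by [].
apply: cl; apply/closureP_dist => e e0; apply: contrapT => H'; apply: H; exists e => // z Dz zp.
by apply: contrapT => Wz; apply: H'; exists z; rewrite // distrC.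
Qed.

Lemma open_infty_None (W : set (option E)) : open_infty D W -> W None ->
  exists M : R, forall z, closure D z -> M < `|z| -> W (Some z).
Proof.
move=> [sub [[+ _]|[_ [_ /bounded_setP[M HM]]]]] WN => //.
exists M => z Dz Mz; apply: contrapT => Wz; move: Mz; rewrite ltNge => /negP; apply.
by apply: HM.
Qed.

(** Naturality is tested on balls around a finite value, and on complements of balls when the value
    is infinity. *)
Lemma natural_tends (uD : unbounded_domain D) delta phi zeta u :
  hyperbolic k delta -> natural_map phi -> seqs_of zeta u -> tends u (phi zeta).
Proof.
move=> hyp [nat1 nat2] zu.
have kxx := quasihypxx uD; have ks := quasihyp_sym uD; have kt := quasihyp_triangle uD.
have key W : open_infty D W -> W (phi zeta) -> \forall i \near \oo, W (Some (V (u i))).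
  move=> oW Wphi; have /= [w [t [t0 Ht]]] := nat2 (inr zeta) W oW Wphi.
  have [N _ HN] := lt_gprod_pt kxx ks hyp w t zu.
  by exists N => // i /= Ni; apply: (Ht (inl (u i))); exact: HN.
have subD x : closure D (V x) by apply: subset_closure; exact: set_valP.
case e : (phi zeta) => [p|] /=.
  move=> r r0; pose W := [set q | if q is Some z then closure D z /\ `|z - p| < r else False].
  have : \forall i \near \oo, W (Some (V (u i))).
    apply: key; last first.
      rewrite e /W /= subrr normr0; split => //.
      have := nat1 _ _ e; rewrite /frontier; by case.
    split; first by move=> z [].
    left; split => //; exists (ball p r); first exact: ball_open.
    apply/seteqP; split=> z /=; rewrite -ball_normE /= distrC => -[] //.
  by apply: filterS => i [].
move=> M; pose W := [set q | if q is Some z then closure D z /\ M < `|z| else True].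
have : \forall i \near \oo, W (Some (V (u i))).
  apply: key; last by rewrite e.
  split; first by move=> z [].
  right; split => //.
  have -> : closure D `\` [set x | W (Some x)] = closure D `&` [set x | `|x| <= M].
    apply/seteqP; split=> z [Dz] /=.
      by move=> h; split => //=; rewrite leNgt; apply/negP => h'; apply: h.
    by move=> h; split => // -[_]; rewrite ltNge h.
  split.
    apply: closedI; first exact: closed_closure.
    by apply: closed_comp (@closed_le R M) => z _; exact: norm_continuous.
  by apply/bounded_setP; exists M => z [].
by apply: filterS => i [].
Qed.

End Convergence.

(** * The natural map of a uniform domain *)

Section UniformBoundary.
Context {R : realType} {E : completeNormedModType R}.
Variable D : set E.
Hypothesis uD : unbounded_domain D.
Notation k := (@quasihyp R E D).
Notation V := (@set_val E D).
Notation d := (bdist D).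
Notation e := (fun x y : D => `|V x - V y|).
Notation dd := (fun x : D => d (V x)).
Notation r := (rdist e dd).
Variable C : R.
Hypothesis C1 : 1 <= C.
Hypothesis k_le : forall x y : D, k x y <= C * (2 * ln (r x y) - ln (dd x) - ln (dd y)) + C.

Let kxx := quasihypxx uD.
Let ks := quasihyp_sym uD.
Let kt := quasihyp_triangle uD.
Let exx (x : D) : e x x = 0. Proof. by rewrite /= subrr normr0. Qed.
Let es (x y : D) : e x y = e y x. Proof. exact: distrC. Qed.
Let et (y x z : D) : e x z <= e x y + e y z.
Proof. by rewrite /= -(subrKA (V y)) ler_normD. Qed.
Let d0 (x : D) : 0 < dd x. Proof. exact: bdist_gt0 (set_valP x). Qed.
Let dl (x y : D) : dd x <= dd y + e x y. Proof. exact: bdist_lip. Qed.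
Let kd := quasihyp_dist uD.
Let kg := quasihyp_geodesic uD.
Let far (x : D) (M : R) : exists y : D, M <= e x y.
Proof.
have [y Dy h] := domain_far uD (M + `|V x|); exists (SigSub (mem_set Dy)).
have := ler_normD (V x - y) (- V x); rewrite addrAC subrr add0r !normrN => h'.
by change (M <= `|V x - y|); lra.
Qed.

Let delta := 2 * (diff_cst C + 1).
Lemma uniform_hyperbolic : hyperbolic k delta.
Proof. exact: (log_hyperbolic kxx ks kt exx es et d0 dl kd kg C1 k_le far). Qed.

Let lgp w x y := log_gprod kxx ks kt exx es et d0 dl kd kg C1 k_le far w x y.
Let rg0 (x y : D) : 0 < r x y. Proof. exact: (rdist_gt0 exx es et d0). Qed.
Let rtri (y x z : D) : r x z <= r x y + r y z. Proof. exact: (rdist_triangle et d0). Qed.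
Let rs (x y : D) : r x y = r y x. Proof. exact: (rdist_sym _ es). Qed.
Let dr (x y : D) : dd x <= r x y. Proof. exact: (d_le_rdist exx es et d0). Qed.
(** By the upper bound in [log_gprod], a large product makes r(x,w) r(y,w) / r(x,y) large. As r(x,w)
    <= r(x,y) + Q and r(y,w) <= Q, this is possible only if r(x,y) is small. *)
Lemma gprod_large_close w (Q c : R) : 0 < c -> exists2 t : R, 0 < t &
  forall x y, r y w <= Q -> t < gprod k w x y -> r x y <= c.
Proof.
move=> c0; have cc := C1.
pose Q1 := Num.max Q 1; have Q10 : 0 < Q1 by rewrite lt_max ltr01 orbT.
pose a := (Q1 + Q1 * Q1 / c) / dd w.
have a0 : 0 < a by rewrite divr_gt0 // addr_gt0 // divr_gt0 ?mulr_gt0.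
exists (Num.max 1 (2 * C * ln a + 2 * diff_cst C)); first by rewrite lt_max ltr01.
move=> x y yQ; rewrite gt_max => /andP[_ ht].
have /andP[_ h2] := lgp w x y.
have : 2 * C * ln a < 2 * C * height e dd w x y by lra.
rewrite ltr_pM2l; last lra.
rewrite /height => h; have h3 : ln a + ln (r x y) + ln (dd w) < ln (r x w) + ln (r y w) by lra.
have {}h3 : a * r x y * dd w < r x w * r y w.
  have [p1 p2 p3] : [/\ 0 < a * r x y, 0 < dd w & 0 < r x w * r y w].
    by split; [rewrite mulr_gt0 // rg0|exact: (d0 w)|rewrite mulr_gt0 // rg0].
  rewrite -ltr_ln ?posrE ?(mulr_gt0 p1 p2) //.
  by rewrite (lnM (y := dd w)) ?posrE // (lnM (x := a)) ?posrE // (lnM (x := r x w)) ?posrE.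
have yQ1 : r y w <= Q1 by rewrite le_max yQ.
have ea : a * r x y * dd w = (Q1 + Q1 * Q1 / c) * r x y.
  by rewrite /a; have := d0 w => dw; field; rewrite !lt0r_neq0.
rewrite ea in h3; have tri := rtri y x w; have rw := rg0 y w; have rxy := rg0 x y.
have h4 : r x w * r y w <= (r x y + Q1) * Q1.
  by apply: ler_pM; rewrite ?(ltW (rg0 _ _)) //; lra.
have h5 : Q1 * Q1 / c * r x y < Q1 * Q1 by nra.
have QQ : 0 < Q1 * Q1 by rewrite mulr_gt0.
by move: h5; rewrite mulrAC ltr_pdivrMr // ltr_pM2l // => /ltW.
Qed.

Lemma gprod_close_large w (M : R) : exists2 c : R, 0 < c &
  forall x y, r x y <= c -> M <= gprod k w x y.
Proof.
pose a := expR (M + (2 * diff_cst C + 1)).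
exists (dd w / a); first by rewrite divr_gt0 ?expR_gt0.
move=> x y h; have /andP[h1 _] := lgp w x y; apply: le_trans h1.
have h2 : ln (r x y) <= ln (dd w) - (M + (2 * diff_cst C + 1)).
  by rewrite -[X in _ - X]expRK -ln_div ?posrE ?expR_gt0 //; exact: ler_ln_le.
have h3 : ln (dd w) <= ln (r x w) by apply: ler_ln_le; rewrite // rs.
have h4 : ln (dd w) <= ln (r y w) by apply: ler_ln_le; rewrite // rs.
by rewrite /height; lra.
Qed.

Lemma gprod_far_large w (M : R) : exists Q : R,
  forall x y, Q <= r x w -> Q <= r y w -> M <= gprod k w x y.
Proof.
pose a := expR (M + (2 * diff_cst C + 1)).
have a0 : 0 < a by exact: expR_gt0.
exists (2 * a * dd w).
suff H x y : r y w <= r x w -> 2 * a * dd w <= r y w -> M <= gprod k w x y.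
  move=> x y hx hy; have [h|/ltW h] := leP (r y w) (r x w); first exact: H.
  by rewrite (gprod_sym ks); exact: H.
move=> yx hy; have /andP[h1 _] := lgp w x y; apply: le_trans h1.
have h2 : ln (r x y) <= ln 2 + ln (r x w).
  by apply: ln_le_scaled => //; have := rtri w x y; rewrite (rs w y); lra.
have h3 : ln 2 + (M + (2 * diff_cst C + 1)) + ln (dd w) <= ln (r y w).
  rewrite -[X in _ + X + _]expRK -!lnM ?posrE ?mulr_gt0 //; apply: ler_ln_le => //.
  by rewrite !mulr_gt0.
by rewrite /height; lra.
Qed.

(** Either the sequence returns to a bounded region infinitely often, and then large products make
    it Cauchy for [r], or it tends to infinity. Since [r] contains the heights, d tends to 0 in the
    first case and the limit is a boundary point. *)
Lemma gromov_seq_tends u : gromov_seq k u ->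
  exists q, tends u q /\ forall p, q = Some p -> frontier D p.
Proof.
move=> /(gromov_seqP k) gu; pose w := u 0%N.
have [[Q HQ]|H] := pselect (exists Q : R, forall N, exists2 i, (N <= i)%N & r (u i) w <= Q).
  have cau c : 0 < c -> exists N, exists2 i0, (N <= i0)%N & forall i, (N <= i)%N -> r (u i) (u i0) <= c.
    move=> c0; have [t t0 Ht] := gprod_large_close w Q c0.
    have [N HN] := gu w (t + 1); have [i0 Ni0 hi0] := HQ N; exists N, i0 => // i Ni.
    by apply: Ht => //; have := HN i i0 Ni Ni0; lra.
  have cv : cvg ((fun i => V (u i)) @ \oo).
    apply/cauchy_cvgP/cauchyP => c c0; have [|N [i0 Ni0 H]] := cau (c / 2); first by rewrite divr_gt0.
    exists (V (u i0)); exists N => // i /= Ni; rewrite -ball_normE /= distrC.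
    by have := H i Ni; rewrite /rdist; have := d0 (u i); have := d0 (u i0); lra.
  pose p := lim ((fun i => V (u i)) @ \oo).
  have up : tends u (Some p).
    move=> c c0; have /cvgrPdist_lt /(_ _ c0) := cv; apply: filterS => i.
    by rewrite distrC.
  exists (Some p); split => // _ [<-]; apply: (frontier_of_limit uD) => c c0.
  have [N [i0 Ni0 H]] := cau (c / 2) (divr_gt0 c0 (ltr0n _ 2)).
  have [M _ HM] := up c c0; exists (V (u (maxn N M))); first exact: set_valP.
  split; first by rewrite distrC; apply: HM; rewrite /= leq_maxr.
  have := H (maxn N M) (leq_maxl _ _); rewrite /rdist.
  by have := d0 (u i0); have := normr_ge0 (V (u (maxn N M)) - V (u i0)); lra.
exists None; split => //= M; apply: contrapT => H'; apply: H.
exists (2 * (M + `|V w| + dd w)) => N; apply: contrapT => H''; apply: H'.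
exists N => // i /= Ni; rewrite ltNge; apply/negP => h; apply: H''; exists i => //.
rewrite /rdist; have := dl (u i) w.
have : `|V (u i) - V w| <= `|V (u i)| + `|V w| by exact: ler_normB.
have := normr_ge0 (V w); lra.
Qed.

Lemma tends_asymptotic u v q : (forall p, q = Some p -> frontier D p) ->
  tends u q -> tends v q -> asymptotic k u v.
Proof.
case: q => [p|] /= fp hu hv w M.
  have [c c0 Hc] := gprod_close_large w M; have c4 : 0 < c / 4 by rewrite divr_gt0.
  have [N1 _ h1] := hu _ c4; have [N2 _ h2] := hv _ c4; exists (maxn N1 N2) => i j.
  rewrite !geq_max => /andP[i1 _] /andP[_ j2]; apply: Hc.
  have a1 := h1 i i1; have a2 := h2 j j2; have f0 := bdist_frontier uD (fp p erefl).
  have b1 := bdist_lip uD (V (u i)) p; have b2 := bdist_lip uD (V (v j)) p.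
  have : `|V (u i) - V (v j)| <= `|V (u i) - p| + `|V (v j) - p|.
    by rewrite (distrC (V (v j))) -{1}(subrKA p) ler_normD.
  by rewrite /rdist; lra.
have [Q HQ] := gprod_far_large w M.
have [N1 _ h1] := hu (Q + `|V w|); have [N2 _ h2] := hv (Q + `|V w|); exists (maxn N1 N2) => i j.
rewrite !geq_max => /andP[i1 _] /andP[_ j2].
have H x : Q + `|V w| < `|V x| -> Q <= r x w.
  move=> h; have := ler_normD (V x - V w) (V w); rewrite subrK.
  by rewrite /rdist; have := d0 x; have := d0 w; lra.
by apply: HQ; apply: H; [exact: h1|exact: h2].
Qed.

(** Interleaving the two sequences gives one Gromov sequence, and its limit is that of both. *)
Lemma asymptotic_tends u v q q' : asymptotic k u u -> asymptotic k v v -> asymptotic k u v ->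
  tends u q -> tends v q' -> q = q'.
Proof.
move=> uu vv uv uq vq'; pose w i := if odd i then v i./2 else u i./2.
have [|q'' [wq _]] := @gromov_seq_tends w.
  apply/(gromov_seq_asymptotic k) => o M.
  have [N1 h1] := uu o M; have [N2 h2] := vv o M; have [N3 h3] := uv o M.
  exists (maxn N1 (maxn N2 N3)).*2 => i j.
  move=> /half_leq; rewrite doubleK !geq_max => /and3P[i1 i2 i3].
  move=> /half_leq; rewrite doubleK !geq_max => /and3P[j1 j2 j3].
  rewrite /w; case: (odd i); case: (odd j); [exact: h2|rewrite (gprod_sym ks); exact: h3|exact: h3|exact: h1].
have h (f : nat -> nat) x : (forall i, (i <= f i)%N) -> (forall i, w (f i) = x i) -> tends x q''.
  move=> fi wf; case: q'' wq => [p|] /= wq c => [c0|].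
    by have [N _ HN] := wq c c0; exists N => // i /= Ni; rewrite -wf; apply: HN; exact: leq_trans (fi i).
  by have [N _ HN] := wq c; exists N => // i /= Ni; rewrite -wf; apply: HN; exact: leq_trans (fi i).
have uq'' : tends u q''.
  by apply: (h double) => i; [rewrite -addnn leq_addr|rewrite /w odd_double doubleK].
have vq'' : tends v q''.
  apply: (h (fun i => i.*2.+1)) => i; first by rewrite -addnn -addnS leq_addr.
  by rewrite /w /= odd_double /= uphalf_double.
by rewrite (tends_unique uq uq'') (tends_unique vq' vq'').
Qed.

Definition boundary_map (zeta : gboundary k) : option E :=
  xget None [set q | forall u, seqs_of zeta u -> tends u q].

Lemma boundary_mapP zeta u : seqs_of zeta u -> tends u (boundary_map zeta).
Proof.
move: u; apply: (@xgetPex _ None [set q | forall u, seqs_of zeta u -> tends u q]).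
have hyp := uniform_hyperbolic.
have [u zu] := seqs_of_neq0 zeta.
have [q [uq _]] := gromov_seq_tends (seqs_of_gromov kxx ks hyp zu); exists q => v zv.
have [q' [vq' _]] := gromov_seq_tends (seqs_of_gromov kxx ks hyp zv).
have as_ x y : seqs_of zeta x -> seqs_of zeta y -> asymptotic k x y.
  exact: (seqs_of_asymptotic kxx ks hyp).
by rewrite (asymptotic_tends (as_ u u zu zu) (as_ v v zv zv) (as_ u v zu zv) uq vq').
Qed.

Lemma boundary_map_frontier zeta p : boundary_map zeta = Some p -> frontier D p.
Proof.
have hyp := uniform_hyperbolic; have [u zu] := seqs_of_neq0 zeta.
have [q [uq fq]] := gromov_seq_tends (seqs_of_gromov kxx ks hyp zu) => e.
by apply: fq; rewrite -e; exact: tends_unique uq (boundary_mapP zu).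
Qed.

Lemma boundary_map_inj zeta1 zeta2 : boundary_map zeta1 = boundary_map zeta2 -> zeta1 = zeta2.
Proof.
have hyp := uniform_hyperbolic => e.
have [u zu] := seqs_of_neq0 zeta1; have [v zv] := seqs_of_neq0 zeta2.
apply: (gboundary_eq kxx ks hyp zu zv); apply: (@tends_asymptotic u v (boundary_map zeta1)).
- by move=> p; exact: boundary_map_frontier.
- exact: boundary_mapP.
- by rewrite e; exact: boundary_mapP.
Qed.

Lemma tends_boundary_map u q : (forall p, q = Some p -> frontier D p) -> tends u q ->
  exists2 zeta, seqs_of zeta u & boundary_map zeta = q.
Proof.
have hyp := uniform_hyperbolic => fq uq.
have gu : gromov_seq k u by apply/(gromov_seq_asymptotic k); exact: (tends_asymptotic fq uq uq).
have [zeta zu] := gboundary_of gu; exists zeta => //.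
exact: tends_unique (boundary_mapP zu) uq.
Qed.

Lemma boundary_map_surj p : frontier D p -> exists zeta, boundary_map zeta = Some p.
Proof.
move=> fp; have [|H _] := (frontier_open p _).1 fp; first by case: uD.
have ex i : {y : D | `|V y - p| < i.+1%:R^-1}.
  apply: cid; have [|y Dy h] := H i.+1%:R^-1; first by rewrite invr_gt0.
  by exists (SigSub (mem_set Dy)); rewrite distrC.
pose u i : D := projT1 (ex i); have [||zeta _ e] := @tends_boundary_map u (Some p).
- by move=> _ [<-].
- move=> c c0; exists (Num.truncn c^-1) => // i /= ni.
  apply: lt_le_trans (projT2 (ex i)) _.
  rewrite -[leRHS]invrK lef_pV2 ?posrE ?invr_gt0 //.
  apply: le_trans (ltW (truncnS_gt _)) _; by rewrite ler_nat.
- by exists zeta.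
Qed.

Lemma boundary_map_infinity : exists2 xi, boundary_map xi = None & True.
Proof.
have ex i : {y : D | i%:R < `|V y|}.
  apply: cid; have [y Dy h] := domain_far uD i%:R.
  by exists (SigSub (mem_set Dy)).
pose u i : D := projT1 (ex i); have [//||xi _ e] := @tends_boundary_map u None.
  move=> M; exists (Num.truncn M).+1 => // i /= ni.
  apply: lt_trans (projT2 (ex i)); apply: lt_le_trans (truncnS_gt _) _.
  by rewrite ler_nat.
by exists xi.
Qed.

(** Stated for sequences so that points of [D], taken as constant sequences, and boundary points are
    covered at once in the proof of naturality. *)
Lemma gprod_large_open w v q W : tends v q -> open_infty D W -> W q ->
  exists t : R, 0 < t /\ forall u q', (forall z, q' = Some z -> closure D z) ->
    tends u q' -> (\forall i \near \oo, t < gprod k w (u i) (v i)) -> W q'.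
Proof.
move=> vq oW Wq; case: q vq Wq => [p|] vq Wq.
  have [c c0 Hc] := open_infty_Some oW Wq.
  have [t t0 Ht] := gprod_large_close w (2 * (1 + `|p - V w| + dd w)) (divr_gt0 c0 (ltr0n _ 4)).
  exists t; split => // u q' cq' uq' gt.
  have {}Ht : \forall i \near \oo, `|V (u i) - p| < c / 2.
    have v1 := vq 1 ltr01; have vc := vq (c / 4) (divr_gt0 c0 (ltr0n _ 4)).
    near=> i; have a1 : `|V (v i) - p| < 1 by near: i.
    have a2 : `|V (v i) - p| < c / 4 by near: i.
    have : r (u i) (v i) <= c / 4.
      apply: Ht; last by near: i.
      rewrite /rdist; have := dl (v i) w; have := ler_normD (V (v i) - p) (p - V w).
      by rewrite subrKA /=; lra.
    rewrite /rdist; have := d0 (u i); have := d0 (v i).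
    by have := ler_normD (V (u i) - V (v i)) (V (v i) - p); rewrite subrKA; lra.
  case: q' cq' uq' => [z|] cq' uq'.
    apply: Hc; first exact: cq'.
    have uz := uq' (c / 2) (divr_gt0 c0 (ltr0n _ 2)).
    near \oo => i; have a1 : `|V (u i) - p| < c / 2 by near: i.
    have a2 : `|V (u i) - z| < c / 2 by near: i.
    by rewrite -(subrKA (V (u i))) (le_lt_trans (ler_normD _ _)) // distrC; lra.
  exfalso; have uM := uq' (`|p| + c); near \oo => i.
  have a1 : `|V (u i) - p| < c / 2 by near: i.
  have a2 : `|p| + c < `|V (u i)| by near: i.
  by have := ler_normD (V (u i) - p) p; rewrite subrK; lra.
have [M HM] := open_infty_None oW Wq.
have [t t0 Ht] := gprod_large_close w (2 * (M + 1 + `|V w| + dd w)) ltr01.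
exists t; split => // u [z|] cq' uq' gt //; apply: HM; first exact: cq'.
rewrite ltNge; apply/negP => zM; have uz := uq' 1 ltr01; have vM := vq (M + 2).
near \oo => i; have a1 : `|V (u i) - z| < 1 by near: i.
have a2 : M + 2 < `|V (v i)| by near: i.
have a3 := ler_normD (V (u i) - z) z; rewrite subrK in a3.
have : r (v i) (u i) <= 1.
  apply: Ht; last by rewrite (gprod_sym ks); near: i.
  rewrite /rdist; have := dl (u i) w; have := ler_normB (V (u i)) (V w).
  by rewrite /=; lra.
rewrite /rdist; have := d0 (u i); have := d0 (v i).
by have := ler_normD (V (v i) - V (u i)) (V (u i)); rewrite subrK; lra.
Unshelve. all: end_near. Qed.

Lemma boundary_map_natural : natural_map boundary_map.
Proof.
have hyp := uniform_hyperbolic; split; first exact: boundary_map_frontier.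
have subD (x : D) : closure D (V x) by apply: subset_closure; exact: set_valP.
have subF p : frontier D p -> closure D p by case.
move=> [x|zeta] W oW /= Wq.
  have [c c0 Hc] := open_infty_Some oW Wq; have dx := d0 x.
  exists (Num.min (1 / 2) (c / (2 * dd x))).
    by rewrite lt_min !divr_gt0 // mulr_gt0.
  move=> y; rewrite lt_min => /andP[h1 h2]; apply: (Hc (V y)) => //.
  have := kd x y; have := @expR_sub1_le R (k x y); rewrite quasihyp_ge0 //= (ltW h1) => /(_ isT).
  rewrite distrC; move: h2; rewrite ltr_pdivlMr ?mulr_gt0 //=; nra.
have [v zv] := seqs_of_neq0 zeta; have vq := boundary_mapP zv.
have [t [t0 Ht]] := gprod_large_open (v 0%N) vq oW Wq.
exists (v 0%N), t; split => // -[x|zeta'] /= h.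
  apply: (Ht (fun=> x)) => [z [<-]//|c c0|]; first by exists 0%N => // i _; rewrite subrr normr0.
  apply: lt_limn_einf; apply: lt_le_trans h _; apply: ereal_inf_lbound; by exists v.
have [u zu] := seqs_of_neq0 zeta'.
apply: (Ht u) => [z /boundary_map_frontier /subF//||]; first exact: boundary_mapP.
apply: lt_limn_einf; apply: lt_le_trans h _; apply: ereal_inf_lbound; by exists (u, v).
Qed.

Lemma tends_r u v p q : frontier D p -> frontier D q -> tends u (Some p) -> tends v (Some q) ->
  forall c : R, 0 < c -> \forall i \near \oo, `|r (u i) (v i) - `|p - q| | <= c.
Proof.
move=> fp fq up vq c c0; have c4 := divr_gt0 c0 (ltr0n R 4).
have := up _ c4; have := vq _ c4; apply: filterS2 => i h1 h2.
have b1 := bdist_lip uD (V (u i)) p; have b2 := bdist_lip uD (V (v i)) q.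
rewrite (bdist_frontier uD fp) in b1; rewrite (bdist_frontier uD fq) in b2.
have b3 := d0 (u i); have b4 := d0 (v i).
have h3 : `| `|V (u i) - V (v i)| - `|p - q| | <= `|V (u i) - p| + `|V (v i) - q|.
  apply: le_trans (ler_dist_dist _ _) _.
  have -> : V (u i) - V (v i) - (p - q) = (V (u i) - p) - (V (v i) - q).
    by rewrite !opprB (addrC q (- p)) addrACA (addrC (- V (v i))).
  exact: ler_normB.
by rewrite /rdist; move: h3; rewrite !ler_norml => /andP[? ?]; apply/andP; split; lra.
Qed.

(** Besides [diff_cst]: twice the error [13 * delta + 1] of [bprod_bd_approx], and 4C for replacing
    [r] by the norm distance of the limits, up to a factor 2 each. *)
Definition bprod_cst := diff_cst C + 26 * delta + 4 * C + 2.

Lemma bprod_cst_ge0 : 0 <= bprod_cst.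
Proof.
have h1 := diff_cst_ge1 C1; have h2 := C1; rewrite /bprod_cst /delta.
by move: (diff_cst C) h1 => x h1; lra.
Qed.

Lemma difference_transfer (K c t L L' l l' g g' m a a' h : R) : 1 <= K ->
  L <= h + l -> l <= h + L -> L' <= h + l' -> l' <= h + L' -> h <= 1 ->
  L' - L - c <= g - g' -> g - g' <= 2 * K * (L' - L) + c ->
  `|g - m - a| <= t -> `|g' - m - a'| <= t ->
  l' - l - (c + 2 * t + 4 * K) <= a - a' <= 2 * K * (l' - l) + (c + 2 * t + 4 * K).
Proof.
move=> K1 h1 h2 h3 h4 h5 h6 h7; rewrite !ler_norml => /andP[? ?] /andP[? ?].
have : 2 * K * (L' - L) <= 2 * K * (l' - l + 2) by rewrite ler_pM2l; lra.
by move=> h8; apply/andP; split; lra.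
Qed.

Lemma bprod_bd_difference xi o zeta1 zeta2 zeta3 p q s a2 a3 :
  boundary_map xi = None -> boundary_map zeta1 = Some p ->
  boundary_map zeta2 = Some q -> boundary_map zeta3 = Some s ->
  bprod_bd (busemann (m := k) xi o) zeta1 zeta2 = a2%:E ->
  bprod_bd (busemann (m := k) xi o) zeta1 zeta3 = a3%:E ->
  p <> q -> p <> s -> `|p - q| < 2 * `|p - s| ->
  ln `|p - s| - ln `|p - q| - bprod_cst <= a2 - a3
    <= 2 * C * (ln `|p - s| - ln `|p - q|) + bprod_cst.
Proof.
move=> bxi b1 b2 b3 ea2 ea3 pq ps pqs; have hyp := uniform_hyperbolic; have cc := C1.
(* The base points must rise above all other points, as [gprod_difference] asks; such a sequence
   tends to infinity, so it represents [xi] because the boundary map is injective. *)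
have hp i : {y : D | i%:R <= dd y}.
  by apply: cid; exact: (high_point kxx ks kt exx es et d0 dl kd kg C1 k_le far i%:R o).
pose w i : D := projT1 (hp i); have Hw i : i%:R <= dd (w i) by exact: projT2 (hp i).
have wN : tends w None.
  move=> M; exists (Num.truncn (M + `|V o| + dd o)).+1 => // i /= ni.
  have h1 : M + `|V o| + dd o < i%:R by apply: lt_le_trans (truncnS_gt _) _; rewrite ler_nat.
  have := Hw i; have := dl (w i) o; have := ler_normB (V (w i)) (V o) => /=; lra.
have wxi : seqs_of xi w.
  have [|//|zeta zw bz] := @tends_boundary_map w None; first by [].
  by rewrite -(boundary_map_inj (etrans bz (esym bxi))).
have [u zu] := seqs_of_neq0 zeta1; have [v zv] := seqs_of_neq0 zeta2.
have [z zz] := seqs_of_neq0 zeta3.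
have n1 : zeta1 <> zeta2 by move=> e; apply: pq; apply: Some_inj; rewrite -b1 -b2 e.
have n2 : zeta1 <> zeta3 by move=> e; apply: ps; apply: Some_inj; rewrite -b1 -b3 e.
have x1 : zeta1 <> xi by move=> e; move: b1; rewrite e bxi.
have x2 : zeta2 <> xi by move=> e; move: b2; rewrite e bxi.
have x3 : zeta3 <> xi by move=> e; move: b3; rewrite e bxi.
have [a2' [e2 /(_ u v w zu zv wxi) near2]] := bprod_bd_approx kxx ks kt hyp o n1 x1 x2.
have [a3' [e3 /(_ u z w zu zz wxi) near3]] := bprod_bd_approx kxx ks kt hyp o n2 x1 x3.
move: e2 e3; rewrite ea2 ea3 => -[e2] [e3]; rewrite -{}e2 in near2; rewrite -{}e3 in near3.
have tu := boundary_mapP zu; have tv := boundary_mapP zv; have tz := boundary_mapP zz.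
rewrite b1 in tu; rewrite b2 in tv; rewrite b3 in tz.
have f1 := boundary_map_frontier b1; have f2 := boundary_map_frontier b2.
have f3 := boundary_map_frontier b3.
have gt0 (x y : E) : x <> y -> 0 < `|x - y|.
  by move=> xy; rewrite normr_gt0 subr_eq0; apply/eqP.
have {}pq := gt0 _ _ pq; have {}ps := gt0 _ _ ps.
(* The first two terms keep [r] within a factor 2 of its limit; the third preserves the inequality
   with factor 2 between the two distances. *)
pose c := Num.min (Num.min (`|p - q| / 2) (`|p - s| / 2)) ((2 * `|p - s| - `|p - q|) / 3).
have c0 : 0 < c by rewrite !lt_min !divr_gt0 // subr_gt0.
have cq : c <= `|p - q| / 2 by rewrite !ge_min lexx.
have cs : c <= `|p - s| / 2 by rewrite !ge_min lexx orbT.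
have c3 : c <= (2 * `|p - s| - `|p - q|) / 3 by rewrite !ge_min lexx orbT.
have rq := tends_r f1 f2 tu tv c0; have rs' := tends_r f1 f3 tu tz c0.
have wbig : \forall i \near \oo, 2 * (`|p - q| + `|p - s|) <= dd (w i).
  exists (Num.truncn (2 * (`|p - q| + `|p - s|))).+1 => // i /= ni.
  apply: le_trans (Hw i); apply: le_trans (ltW (truncnS_gt _)) _; by rewrite ler_nat.
clear ea2 ea3 b1 b2 b3 n1 n2 x1 x2 x3 bxi f1 f2 f3; near \oo => i.
have A2 : `|gprod k (w i) (u i) (v i) - k o (w i) - a2| <= 13 * delta + 1 by near: i.
have A3 : `|gprod k (w i) (u i) (z i) - k o (w i) - a3| <= 13 * delta + 1 by near: i.
have Rq : `|r (u i) (v i) - `|p - q| | <= c by near: i.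
have Rs : `|r (u i) (z i) - `|p - s| | <= c by near: i.
have W : 2 * (`|p - q| + `|p - s|) <= dd (w i) by near: i.
move: Rq Rs; rewrite !ler_norml => /andP[q1 q2] /andP[s1 s2].
have [||| G1 G2] := @andP _ _ (gprod_difference kxx ks kt exx es et d0 dl kd kg C1 k_le far
  (o := w i) (x := u i) (y := v i) (z := z i) _ _ _); try lra.
have l2 := @ln2_le1 R.
have Lq1 : ln (r (u i) (v i)) <= ln 2 + ln `|p - q| by apply: ln_le_scaled => //; lra.
have Lq2 : ln `|p - q| <= ln 2 + ln (r (u i) (v i)) by apply: ln_le_scaled => //; lra.
have Ls1 : ln (r (u i) (z i)) <= ln 2 + ln `|p - s| by apply: ln_le_scaled => //; lra.
have Ls2 : ln `|p - s| <= ln 2 + ln (r (u i) (z i)) by apply: ln_le_scaled => //; lra.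
have -> : bprod_cst = diff_cst C + 2 * (13 * delta + 1) + 4 * C by rewrite /bprod_cst; ring.
exact: (difference_transfer cc Lq1 Lq2 Ls1 Ls2 l2 G1 G2 A2 A3).
Unshelve. all: end_near. Qed.

Section QuasiSymmetry.
Variables (eps : R) (xi : gboundary k) (o : D).
Hypothesis adm : admissible delta eps.
Hypothesis bxi : boundary_map xi = None.
Notation b := (busemann (m := k) xi o).
Notation f := (fun zeta => odflt 0 (boundary_map zeta)).

Definition boundary_gauge : R -> R :=
  power_gauge (expR (bprod_cst + eps^-1)) (2 * C * eps)^-1 eps^-1.

Lemma boundary_map_finite zeta : zeta <> xi -> boundary_map zeta = Some (f zeta).
Proof.
move=> zx; case e : (boundary_map zeta) => [p|]; first by rewrite e.
by case: zx; apply: boundary_map_inj; rewrite e bxi.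
Qed.

Let hyp := uniform_hyperbolic.

Lemma hamenstadt_diag zeta : zeta <> xi -> hamenstadt xi b eps zeta zeta = 0.
Proof.
case: adm => e0 ad zx; have := hamenstadt_bounds kxx ks kt hyp o e0 ad zx zx.
rewrite (rho_diag kxx ks kt hyp o e0 zx) mul0r => /andP[h1 h2].
by apply/eqP; rewrite eq_le h1 h2.
Qed.

Lemma hamenstadt_gt0 zeta1 zeta2 : zeta1 <> xi -> zeta2 <> xi -> zeta1 <> zeta2 ->
  0 < hamenstadt xi b eps zeta1 zeta2.
Proof.
case: adm => e0 ad zx1 zx2 z12; have /andP[+ _] := hamenstadt_bounds kxx ks kt hyp o e0 ad zx1 zx2.
apply: lt_le_trans; have [a [ea _]] := bprod_bd_approx kxx ks kt hyp o z12 zx1 zx2.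
by rewrite (rhoE eps ea) divr_gt0 // expR_gt0.
Qed.

Lemma boundary_map_qs (t : R) zeta1 zeta2 zeta3 : 0 < t ->
  zeta1 <> xi -> zeta2 <> xi -> zeta3 <> xi ->
  hamenstadt xi b eps zeta1 zeta2 <= t * hamenstadt xi b eps zeta1 zeta3 ->
  `|f zeta1 - f zeta2| <= boundary_gauge t * `|f zeta1 - f zeta3|.
Proof.
move=> t0 x1 x2 x3 h; case: adm => e0 ad; have cc := C1.
have [->|n2] := pselect (zeta1 = zeta2).
  rewrite subrr normr0 mulr_ge0 // /boundary_gauge /power_gauge mulr_ge0 ?expR_ge0 //.
  by case: ifP => _; rewrite powR_ge0.
have [e3|n3] := pselect (zeta1 = zeta3).
  move: h; rewrite -e3 hamenstadt_diag // mulr0 leNgt => /negP; case.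
  exact: hamenstadt_gt0.
have b1 := boundary_map_finite x1; have b2 := boundary_map_finite x2; have b3 := boundary_map_finite x3.
move: b1 b2 b3; set p := f zeta1; set q := f zeta2; set s := f zeta3 => b1 b2 b3.
have pq : p <> q by move=> e; apply: n2; apply: boundary_map_inj; rewrite b1 b2 e.
have ps : p <> s by move=> e; apply: n3; apply: boundary_map_inj; rewrite b1 b3 e.
have [a2 [ea2 _]] := bprod_bd_approx kxx ks kt hyp o n2 x1 x2.
have [a3 [ea3 _]] := bprod_bd_approx kxx ks kt hyp o n3 x1 x3.
have /andP[h2 _] := hamenstadt_bounds kxx ks kt hyp o e0 ad x1 x2.
have /andP[_ h3] := hamenstadt_bounds kxx ks kt hyp o e0 ad x1 x3.
rewrite (rhoE eps ea2) in h2; rewrite (rhoE eps ea3) in h3.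
have h4 : a3 - a2 <= ln t / eps + eps^-1.
  exact: (expR_ratio_log e0 t0 h2 h h3).
have gt0 (x y : E) : x <> y -> 0 < `|x - y|.
  by move=> xy; rewrite normr_gt0 subr_eq0; apply/eqP.
apply: (power_gauge_bound C1 e0 t0 (gt0 _ _ pq) (gt0 _ _ ps) bprod_cst_ge0 (a := a2 - a3)).
- by rewrite -(opprB a3) lerN2.
- by move=> c; case/andP: (bprod_bd_difference bxi b1 b2 b3 ea2 ea3 pq ps c).
- move=> c; rewrite opprB.
  by case/andP: (bprod_bd_difference bxi b1 b3 b2 ea3 ea2 ps pq c).
Qed.

Lemma uniform_boundary_qs : boundary_qs boundary_map xi b eps boundary_gauge.
Proof.
case: adm => e0 ad; have cc := C1.
exists f; split; first exact: boundary_map_finite.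
apply: quasisymmetric_bij.
- by apply: gauge_power; rewrite ?expR_gt0 ?invr_gt0 ?mulr_gt0 //; lra.
- split.
  + by move=> zeta /= zx; apply: (@boundary_map_frontier zeta); exact: boundary_map_finite.
  + move=> z1 z2; rewrite !inE => x1 x2 e; apply: boundary_map_inj.
    by rewrite (boundary_map_finite x1) (boundary_map_finite x2) e.
  + move=> p fp; have [zeta bz] := boundary_map_surj fp; exists zeta; last by rewrite bz.
    by move=> e; move: bz; rewrite e bxi.
- by move=> zeta; exact: hamenstadt_diag.
- by move=> z1 z2; exact: hamenstadt_gt0.
- by move=> x; rewrite subrr normr0.
- by move=> x y xy; rewrite normr_gt0 subr_eq0; apply/eqP.
- by move=> t z1 z2 z3; exact: boundary_map_qs.
Qed.

End QuasiSymmetry.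

End UniformBoundary.

(** * Separation of points in an annulus *)

Section Directions.
Context {R : realType} {E : completeNormedModType R}.
Implicit Types (a b u v : E).

Lemma dim_ge2_independent a : dim_ge2 E -> exists u, forall t : R, u + t *: a != 0.
Proof.
move=> [u [v uv]]; apply: contrapT => H.
have [t1 e1] : exists t : R, u + t *: a = 0.
  apply: contrapT => H1; apply: H; exists u => t; apply/eqP => e; by apply: H1; exists t.
have [t2 e2] : exists t : R, v + t *: a = 0.
  apply: contrapT => H1; apply: H; exists v => t; apply/eqP => e; by apply: H1; exists t.
have eu : u = - (t1 *: a) by apply/eqP; rewrite -addr_eq0 e1.
have ev : v = - (t2 *: a) by apply/eqP; rewrite -addr_eq0 e2.
have [|t20 t10] := uv t2 (- t1).
  by rewrite eu ev !scalerN scaleNr opprK !scalerA (mulrC t1) addNr.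
have t1z : t1 = 0 by apply/eqP; rewrite -oppr_eq0 t10.
have [|/eqP] := uv 1 0; last by rewrite oner_eq0.
by rewrite eu t1z scale0r oppr0 !scaler0 scale0r addr0.
Qed.

(** The substitute for orthogonality: [v] is the direction of a shortest vector on a line parallel
    to [a], so |v + t a| >= 1 for all t. For |t| >= |a|/2 this gives |a + t v| >= |t|, and smaller t
    are covered by the triangle inequality. *)
Lemma transversal_direction a : dim_ge2 E ->
  exists v, `|v| = 1 /\ forall t : R, `|a| / 2 <= `|a + t *: v|.
Proof.
move=> dE; have [u Hu] := dim_ge2_independent a dE.
have [a0|a0] := eqVneq a 0.
  exists (`|u|^-1 *: u); have u0 : u != 0 by have := Hu 0; rewrite scale0r addr0.
  split; last by move=> t; rewrite a0 normr0 mul0r normr_ge0.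
  by rewrite normrZ ger0_norm ?invr_ge0 // mulVf // normr_eq0.
have na : 0 < `|a| by rewrite normr_gt0.
(* Beyond [T] the norm exceeds its value at 0, so a minimum over [-T, T] is global. *)
pose F (t : R) := `|u + t *: a|; pose T := 2 * `|u| / `|a|.
have T0 : 0 <= T by rewrite divr_ge0 // mulr_ge0.
have [||t0 _ Ht0] := @EVT_min R F (- T) T; first lra.
  apply: continuous_subspaceT => t; apply: (@continuous_comp _ _ _
    (fun t : R => u + t *: a) (fun z : E => `|z|)).
    by apply: cvgD; [exact: cvg_cst|apply: cvgZr_tmp; exact: cvg_id].
  exact: norm_continuous.
have Hmin t : F t0 <= F t.
  have [h|h] := leP `|t| T.
    by apply: Ht0; rewrite in_itv /= -ler_norml.
  apply: (@le_trans _ _ (F 0)); first by apply: Ht0; rewrite in_itv /=; lra.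
  rewrite /F scale0r addr0; have := ler_normB (u + t *: a) u.
  rewrite addrAC subrr add0r normrZ => h1.
  have : T * `|a| < `|t| * `|a| by rewrite ltr_pM2r.
  by rewrite /T divfK ?lt0r_neq0 //; lra.
have m0 : 0 < F t0 by rewrite normr_gt0.
pose v := (F t0)^-1 *: (u + t0 *: a).
have hv t : 1 <= `|v + t *: a|.
  have -> : v + t *: a = (F t0)^-1 *: (u + (t0 + F t0 * t) *: a).
    rewrite /v scalerDr scalerDl scalerDr scalerDr !scalerA mulrA mulVf ?lt0r_neq0 // mul1r.
    by rewrite !addrA.
  rewrite normrZ ger0_norm ?invr_ge0 ?(ltW m0) // mulrC ler_pdivlMr // mul1r; exact: Hmin.
exists v; split.
  by rewrite /v normrZ ger0_norm ?invr_ge0 ?(ltW m0) // mulVf // lt0r_neq0.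
move=> t; have [h|h] := leP `|t| (`|a| / 2).
  have := ler_normB (a + t *: v) (t *: v); rewrite addrK normrZ.
  have -> : `|v| = 1 by rewrite /v normrZ ger0_norm ?invr_ge0 ?(ltW m0) // mulVf // lt0r_neq0.
  by rewrite mulr1; lra.
apply: le_trans (ltW h) _.
have t0' : t != 0 by apply/eqP => t0'; rewrite t0' normr0 in h; lra.
have -> : a + t *: v = t *: (v + t^-1 *: a) by rewrite scalerDr (scalerA t t^-1) mulfV // scale1r addrC.
by rewrite normrZ ler_peMr.
Qed.

(** Convexity: if the norm dropped somewhere in both directions, [b] would be a convex combination
    of two shorter vectors. *)
Lemma receding_sign b v : exists s : R, `|s| = 1 /\ forall t : R, 0 <= t -> `|b| <= `|b + t *: (s *: v)|.
Proof.
apply: contrapT => H.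
have [t1 t10 h1] : exists2 t : R, 0 <= t & `|b + t *: v| < `|b|.
  apply: contrapT => H1; apply: H; exists 1; rewrite normr1; split => // t t0.
  by rewrite scale1r leNgt; apply/negP => h; apply: H1; exists t.
have [t2 t20 h2] : exists2 t : R, 0 <= t & `|b - t *: v| < `|b|.
  apply: contrapT => H1; apply: H; exists (- 1); rewrite normrN1; split => // t t0.
  by rewrite scaleN1r scalerN leNgt; apply/negP => h; apply: H1; exists t.
have p1 : 0 < t1 by rewrite lt0r t10 andbT; apply/eqP => e; rewrite e scale0r addr0 ltxx in h1.
have p2 : 0 < t2 by rewrite lt0r t20 andbT; apply/eqP => e; rewrite e scale0r subr0 ltxx in h2.
have e : (t1 + t2) *: b = t2 *: (b + t1 *: v) + t1 *: (b - t2 *: v).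
  by rewrite !scalerDr scalerN !scalerA (mulrC t1) addrACA subrr addr0 -scalerDl addrC.
have := ler_normD (t2 *: (b + t1 *: v)) (t1 *: (b - t2 *: v)).
by rewrite -e !normrZ !ger0_norm ?addr_ge0 //; nra.
Qed.

End Directions.

(** * Walking around a ball *)

Section Separation.
Context {R : realType} {E : completeNormedModType R}.
Variable D : set E.
Hypothesis uD : unbounded_domain D.
Notation k := (@quasihyp R E D).
Notation V := (@set_val E D).
Notation d := (bdist D).

(** Steps of length at most th/2 cost at most 1 in [k] as long as d stays above [th]; the first
    point where it does not is the second alternative. [P] records that the walk avoids a ball. *)
Lemma walk_segment (P : E -> Prop) (th : R) (N : nat) (y : D) (u : E) : 0 < th -> th <= d (V y) ->
  `|u| <= th / 2 * N%:R -> (forall t : R, 0 <= t <= 1 -> P (V y + t *: u)) ->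
  (exists b : D, [/\ V b = V y + u, th <= d (V b) & k y b <= N%:R]) \/
  (exists z : D, [/\ P (V z), d (V z) <= th & k y z <= N%:R]).
Proof.
move=> th0; elim: N y u => [|N IH] y u dy.
  rewrite mulr0 normr_le0 => /eqP -> _; left; exists y; rewrite addr0; split => //.
  by rewrite quasihypxx.
move=> hb HP; pose t : R := N.+1%:R^-1; have t0 : 0 < t by rewrite invr_gt0.
have t1 : t <= 1 by rewrite invf_le1 // ler1n.
have tN : t * N.+1%:R = 1 by rewrite mulVf.
pose y1 := V y + t *: u.
have yy1 : `|V y - y1| <= th / 2.
  rewrite /y1 opprD addrA subrr add0r normrN normrZ (ger0_norm (ltW t0)).
  apply: (@le_trans _ _ (t * (th / 2 * N.+1%:R))); first by rewrite ler_pM2l.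
  by rewrite mulrCA tN mulr1.
have Dy1 : D y1.
  by apply: (domain_ball uD (set_valP y)); apply: le_lt_trans yy1 _; lra.
pose z1 : D := SigSub (mem_set Dy1).
have kz : k y z1 <= 1 by apply: quasihyp_small => //=; apply: le_trans yy1 _; lra.
have [h|h] := leP (d y1) th.
  right; exists z1; split => //; first by apply: HP; rewrite ltW.
  by apply: le_trans kz _; rewrite ler1n.
have e1 a : V z1 + a *: ((1 - t) *: u) = V y + (t + a * (1 - t)) *: u.
  by rewrite /= /y1 scalerA -addrA -scalerDl.
have [||[b [b1 b2 b3]]|[z [z1P z2 z3]]] := IH z1 ((1 - t) *: u) (ltW h).
- rewrite normrZ ger0_norm ?subr_ge0 //.
  apply: (@le_trans _ _ ((1 - t) * (th / 2 * N.+1%:R))); first by rewrite ler_wpM2l ?subr_ge0.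
  by rewrite mulrBl mul1r mulrCA tN mulr1 -natr1; lra.
- by move=> a /andP[a0 a1]; rewrite e1; apply: HP; nra.
- left; exists b; split => //.
    by rewrite b1 -[(1 - t) *: u]scale1r e1 mul1r (addrC t) subrK scale1r.
  by have := quasihyp_triangle uD z1 y b; rewrite -natr1; lra.
- right; exists z; split => //; have := quasihyp_triangle uD z1 y z.
  by rewrite -natr1; lra.
Qed.

Lemma norm_segment (a b : E) (M t : R) : `|a| <= M -> `|b| <= M -> 0 <= t <= 1 ->
  `|a + t *: (b - a)| <= M.
Proof.
move=> aM bM /andP[t0 t1].
have -> : a + t *: (b - a) = (1 - t) *: a + t *: b.
  by rewrite scalerBr scalerBl scale1r addrA addrAC.
apply: le_trans (ler_normD _ _) _; rewrite !normrZ !ger0_norm ?subr_ge0 //.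
have h1 : (1 - t) * `|a| <= (1 - t) * M by rewrite ler_wpM2l ?subr_ge0.
have h2 : t * `|b| <= t * M by rewrite ler_wpM2l.
lra.
Qed.

Definition sep_cst (c c1 : R) : R := 3 * (Num.truncn (4 * c / c1)).+1%:R.

(** The walk goes from y to y + w, then to y' + w, then to y'. The direction of w is transversal to
    y - q, so the first leg stays s/2 away from q; |w| = 2cs keeps the second leg away; the sign of
    w is chosen so that the third is never closer to q than y'. The three legs explain the factor 3
    in [sep_cst]. *)
Lemma annulus_separation (c c1 s : R) (q : E) (y y' : D) : dim_ge2 E -> 1 <= c -> 0 < c1 -> 0 < s ->
  s <= `|V y - q| <= c * s -> s <= `|V y' - q| <= c * s ->
  k y y' <= sep_cst c c1 \/
  exists z : D, [/\ s / 3 <= `|V z - q|, d (V z) <= c1 * s & k y z <= sep_cst c c1].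
Proof.
move=> dE cge c10 s0 /andP[y1 y2] /andP[y'1 y'2].
pose N := (Num.truncn (4 * c / c1)).+1.
have hN : 2 * c * s <= c1 * s / 2 * N%:R.
  have : 4 * c / c1 <= N%:R by apply: ltW; exact: truncnS_gt.
  by rewrite ler_pdivrMr // => h; move: N%:R h => n h; nra.
have kN : k y y <= sep_cst c c1 by rewrite quasihypxx // /sep_cst mulr_ge0.
rewrite /sep_cst -/N; pose P (z : E) := s / 3 <= `|z - q|.
have [dy|dy] := leP (d (V y)) (c1 * s).
  by right; exists y; split => //; lra.
have th0 : 0 < c1 * s by rewrite mulr_gt0.
have [v [v1 Hv]] := transversal_direction (V y - q) dE.
have [sg [sg1 Hs]] := receding_sign (V y' - q) v.
pose L : R := 2 * c * s; have L0 : 0 <= L by rewrite /L !mulr_ge0 ?(ltW s0) //; lra.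
pose w := L *: (sg *: v); have nw : `|w| = L.
  transitivity (`|L| * (`|sg| * `|v|)); first by rewrite -!normrZ.
  by rewrite [X in _ * (X * _)]sg1 v1 !mulr1 ger0_norm.
have Hw (t : R) : t *: w = (t * L * sg) *: v by rewrite /w !scalerA mulrA.
have [|||[z [zP dz kz]]] := @walk_segment P (c1 * s) N y w th0 (ltW dy).
- by rewrite nw.
- move=> t /andP[t0 t1]; rewrite /P addrAC Hw.
  by have := Hv (t * L * sg); lra.
- move=> [a1 [ea1 da1 ka1]].
  have [|||[z [zP dz kz]]] := @walk_segment P (c1 * s) N a1 (V y' - V y) th0 da1.
  + have -> : V y' - V y = (V y' - q) - (V y - q) by rewrite opprB addrA subrK.
    by have := ler_normB (V y' - q) (V y - q); lra.
  + move=> t t01; rewrite /P ea1.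
    have -> : V y + w + t *: (V y' - V y) - q = (V y - q + t *: ((V y' - q) - (V y - q))) + w.
      by rewrite (addrAC (V y) w) (addrAC _ w) (addrAC (V y)) opprB addrA subrK.
    have h1 := norm_segment y2 y'2 t01.
    have h2 := ler_normB (V y - q + t *: ((V y' - q) - (V y - q)) + w)
      (V y - q + t *: ((V y' - q) - (V y - q))).
    have cs : s <= c * s by rewrite ler_peMl // ltW.
    by rewrite addrAC subrr add0r nw /L in h2; lra.
  + move=> [a2 [ea2 da2 ka2]]; have ea2' : V a2 = V y' + w by rewrite ea2 ea1 addrC subrKA.
    have [|||[z [zP dz kz]]] := @walk_segment P (c1 * s) N a2 (- w) th0 da2.
    * by rewrite normrN nw.
    * move=> t /andP[t0 t1]; rewrite /P ea2'.
      have -> : V y' + w + t *: (- w) - q = V y' - q + ((1 - t) * L) *: (sg *: v).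
        by rewrite scalerN -addrA -addrA (addrA w) -{1}(scale1r w) -scalerBl (addrC _ (- q)) addrA -scalerA.
      have h : 0 <= (1 - t) * L by rewrite mulr_ge0 // subr_ge0.
      by have := Hs _ h; lra.
    * move=> [a3 [ea3 da3 ka3]]; left.
      have ea : a3 = y' by apply: val_inj; change (V a3 = V y'); rewrite ea3 ea2' addrK.
      have t1 := quasihyp_triangle uD a1 y y'; have t2 := quasihyp_triangle uD a2 a1 y'.
      by rewrite ea in ka3; lra.
    * right; exists z; split => //; have t1 := quasihyp_triangle uD a1 y z.
      by have t2 := quasihyp_triangle uD a2 a1 z; lra.
  + right; exists z; split => //; have t1 := quasihyp_triangle uD a1 y z.
    by have n0 : 0 <= N%:R :> R by []; lra.
- by right; exists z; split => //; have n0 : 0 <= N%:R :> R by []; lra.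
Qed.

End Separation.

(** * Rays descending to the boundary *)

Section Ray.
Context {R : realType} {E : completeNormedModType R}.
Variable D : set E.
Hypothesis uD : unbounded_domain D.
Notation k := (@quasihyp R E D).
Notation V := (@set_val E D).
Notation d := (bdist D).

Lemma ray_step_bound (s a : R) : 0 < s -> s <= 1 / 10 -> 0 <= a -> a <= s * (1 + s ^+ 2) ->
  a / (1 - a) <= s - s ^+ 2 + s ^+ 3 + 3 * s ^+ 2.
Proof.
move=> s0 s1 a0 h; have s2 : s ^+ 2 <= s / 10 by rewrite expr2; nra.
have s3 : s ^+ 3 <= s ^+ 2 / 10 by rewrite exprS mulrC ler_wpM2l ?sqr_ge0 //; lra.
have p2 : 0 <= s ^+ 2 by rewrite sqr_ge0.
have p3 : 0 <= s ^+ 3 by rewrite exprn_ge0 // ltW.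
have a1 : a <= s + s ^+ 3 by rewrite (le_trans h) // mulrDr mulr1 -exprS.
have a2 : a <= 1 / 5 by lra.
rewrite ler_pdivrMr; last lra.
apply: (@le_trans _ _ ((s + 2 * s ^+ 2) * (1 - (s + s ^+ 3)))); last first.
  by apply: ler_pM; rewrite ?subr_ge0; lra.
have e : (s + 2 * s ^+ 2) * (1 - (s + s ^+ 3)) =
    s + s ^+ 2 - 2 * s * s ^+ 2 - s * s ^+ 3 - 2 * s ^+ 2 * s ^+ 3 by ring.
have e3 : s ^+ 3 = s * s ^+ 2 by rewrite exprS.
rewrite e; nra.
Qed.

(** A step of relative size s towards a boundary point at distance at most (1 + s^2) d(x). To first
    order both its [k]-cost and the drop of ln d equal s, so the excess is of order s^2. *)
Lemma ray_step (s : R) (x : D) : 0 < s -> s <= 1 / 10 -> exists y : D,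
  [/\ k x y <= ln (d (V x)) - ln (d (V y)) + 3 * s ^+ 2, k x y <= 1,
      `|V x - V y| <= 2 * (d (V x) - d (V y)) &
      d (V y) <= (1 - s + s ^+ 2) * d (V x)].
Proof.
move=> s0 s1; have dx := bdist_gt0 uD (set_valP x).
have s2p : 0 < s ^+ 2 by rewrite exprn_gt0.
have s2 : s ^+ 2 <= s / 10 by rewrite expr2; nra.
have [p fp hp] := bdist_approx uD (V x) (mulr_gt0 s2p dx).
have {}hp : `|V x - p| <= (1 + s ^+ 2) * d (V x) by lra.
pose y := V x + s *: (p - V x).
have xy : `|V x - y| <= s * (1 + s ^+ 2) * d (V x).
  rewrite /y opprD addrA subrr add0r normrN normrZ (ger0_norm (ltW s0)) distrC -mulrA.
  by rewrite ler_wpM2l // ltW.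
have yp : `|y - p| <= (1 - s) * ((1 + s ^+ 2) * d (V x)).
  have -> : y - p = (1 - s) *: (V x - p).
    by rewrite scalerBl scale1r -[s *: (V x - p)]opprK -scalerN opprB opprK /y addrAC.
  by rewrite normrZ ger0_norm; [rewrite ler_wpM2l //|]; lra.
have s12 : s * (1 + s ^+ 2) <= 1 / 5 by nra.
have xy5 : `|V x - y| <= d (V x) / 5 by apply: le_trans xy _; nra.
have Dy : D y by apply: (domain_ball uD (set_valP x)); lra.
pose z : D := SigSub (mem_set Dy); exists z.
have dz : 0 < d y := bdist_gt0 uD Dy.
have dy : d y <= (1 - s) * (1 + s ^+ 2) * d (V x) by rewrite -mulrA; apply: le_trans yp; exact: bdist_le.
have e3 : (1 - s) * (1 + s ^+ 2) = 1 - (s - s ^+ 2 + s ^+ 3) by ring.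
have hln : s - s ^+ 2 + s ^+ 3 <= ln (d (V x)) - ln (d y).
  have h1 : d y / d (V x) <= 1 - (s - s ^+ 2 + s ^+ 3) by rewrite ler_pdivrMr // -e3.
  have h2 : ln (d y / d (V x)) <= d y / d (V x) - 1.
    have := @le_ln1Dx R (d y / d (V x) - 1); rewrite (addrC 1) subrK; apply.
    by rewrite ltrBrDl addrN divr_gt0.
  by rewrite ln_div ?posrE // in h2; lra.
split => /=.
- have h1 : `|V x - y| < d (V x) by lra.
  have := @quasihyp_segment _ _ _ uD x z h1 => h2.
  have -> : ln (d (V x)) - ln (d y) + 3 * s ^+ 2 = (ln (d (V x)) - ln (d y)) + 3 * s ^+ 2 by [].
  apply: le_trans h2 _; apply: le_trans (_ : s - s ^+ 2 + s ^+ 3 + 3 * s ^+ 2 <= _); last by rewrite lerD2r.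
  have := @ray_step_bound s (`|V x - y| / d (V x)) s0 s1; rewrite divr_ge0 ?(ltW dx) // ler_pdivrMr //.
  move=> /(_ isT xy); apply: le_trans; rewrite le_eqVlt; apply/orP; left; apply/eqP.
  change (V z) with y; field; apply/andP; split; lra.
- by apply: quasihyp_small => //=; apply: le_trans xy5 _; lra.
- apply: le_trans xy _; nra.
- apply: le_trans dy _; rewrite ler_wpM2r ?(ltW dx) //; nra.
Qed.

Definition ray_seq (x : D) (c : nat -> D) (p : E) : Prop :=
  [/\ c 0%N = x,
      forall i j, (i <= j)%N -> k (c i) (c j) <= ln (d (V (c i))) - ln (d (V (c j))) + 1 /\
                               `|V (c i) - V (c j)| <= 2 * d (V (c i)),
      forall i, k (c i) (c i.+1) <= 1,
      forall e : R, 0 < e -> exists N, forall i, (N <= i)%N -> d (V (c i)) <= e &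
      frontier D p /\ forall i, `|V (c i) - p| <= 2 * d (V (c i))].

Lemma ray_exists x : exists c p, ray_seq x c p.
Proof.
pose s i : R := (i + 10)%N%:R^-1.
have n0 (i m : nat) : (0 < m)%N -> 0 < (i + m)%N%:R :> R by move=> m0; rewrite ltr0n addn_gt0 m0 orbT.
have s0 i : 0 < s i by rewrite invr_gt0 n0.
have s1 i : s i <= 1 / 10 by rewrite /s div1r lef_pV2 ?posrE ?n0 // ler_nat leq_addl.
pose nx i y := cid (ray_step y (s0 i) (s1 i)).
pose c := fix c i := if i is j.+1 then projT1 (nx j (c j)) else x.
have cP i : [/\ k (c i) (c i.+1) <= ln (d (V (c i))) - ln (d (V (c i.+1))) + 3 * s i ^+ 2,
   k (c i) (c i.+1) <= 1,
      `|V (c i) - V (c i.+1)| <= 2 * (d (V (c i)) - d (V (c i.+1))) &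
      d (V (c i.+1)) <= (1 - s i + s i ^+ 2) * d (V (c i))] by exact: projT2 (nx i (c i)).
have dc i : 0 < d (V (c i)) by apply: bdist_gt0 => //; exact: set_valP.
(* A telescoping majorant of the remaining excess: 3/(i + 10)^2 <= 3/(i + 9) - 3/(i + 10). Its value
   at 0 is 1/3. *)
pose tau i : R := 3 / (i + 9)%N%:R.
have tau_le i : 3 * s i ^+ 2 <= tau i - tau i.+1.
  rewrite /tau /s addSnnS -mulrBr ler_pM2l //.
  have a0 := n0 i 9 isT; have e : (i + 10)%N%:R = (i + 9)%N%:R + 1 :> R by rewrite addnS natr1.
  rewrite e; move: ((i + 9)%N%:R : R) a0 => a a0.
  have -> : a^-1 - (a + 1)^-1 = (a * (a + 1))^-1 by field; rewrite !lt0r_neq0 //; lra.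
  by rewrite exprVn lef_pV2 ?posrE ?exprn_gt0 ?mulr_gt0 //; nra.
have tau0 i : 0 <= tau i <= 1 / 3.
  rewrite /tau; have a0 := n0 i 9 isT; rewrite divr_ge0 ?(ltW a0) //= ler_pdivrMr //.
  have : 9 <= (i + 9)%N%:R :> R by rewrite ler_nat leq_addl.
  by lra.
have kij i m : k (c i) (c (i + m)%N) <= ln (d (V (c i))) + tau i - (ln (d (V (c (i + m)%N))) + tau (i + m)%N).
  elim: m => [|m IH]; first by rewrite addn0 quasihypxx // subrr.
  have [h _ _ _] := cP (i + m)%N; have := tau_le (i + m)%N.
  by have := quasihyp_triangle uD (c (i + m)%N) (c i) (c (i + m).+1); rewrite addnS; lra.
have eij i m : `|V (c i) - V (c (i + m)%N)| <= 2 * (d (V (c i)) - d (V (c (i + m)%N))).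
  elim: m => [|m IH]; first by rewrite addn0 !subrr normr0 mulr0.
  have [_ _ h _] := cP (i + m)%N; rewrite addnS -(subrKA (V (c (i + m)%N))).
  by apply: le_trans (ler_normD _ _) _; lra.
(* The explicit sequence 1/(i + 11) decreases no faster than the factors 1 - s + s^2 require, which
   replaces the study of an infinite product. *)
have dle i : d (V (c i)) <= 11 / (i + 11)%N%:R * d (V x).
  elim: i => [|i IH]; first by rewrite add0n divff ?mul1r.
  have [_ _ _ h] := cP i; apply: le_trans h _.
  have a0 := n0 i 10 isT; rewrite /s.
  have a2 : 2 <= (i + 10)%N%:R :> R by rewrite ler_nat addnC.
  have e1 : (i + 11)%N%:R = (i + 10)%N%:R + 1 :> R by rewrite addnS natr1.
  have e2 : (i.+1 + 11)%N%:R = (i + 10)%N%:R + 2 :> R by rewrite addSnnS -(natrD _ (i + 10) 2) -addnA.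
  rewrite e1 in IH; rewrite e2; move: ((i + 10)%N%:R : R) a0 a2 IH => a a0 a2 IH.
  have f0 : 0 <= 1 - a^-1 + a^-1 ^+ 2.
    have -> : 1 - a^-1 + a^-1 ^+ 2 = (1 / 2 - a^-1) ^+ 2 + 3 / 4 by field; rewrite lt0r_neq0.
    by rewrite addr_ge0 ?sqr_ge0.
  apply: le_trans (ler_wpM2l f0 IH) _; rewrite mulrA ler_wpM2r ?(ltW (bdist_gt0 uD (set_valP x))) //.
  have -> : (1 - a^-1 + a^-1 ^+ 2) * (11 / (a + 1)) = 11 * ((a ^+ 2 - a + 1) / (a ^+ 2 * (a + 1))).
    by field; rewrite !lt0r_neq0 //; lra.
  rewrite ler_pM2l // ler_pdivrMr ?mulr_gt0 ?exprn_gt0 //; last lra.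
  rewrite mulrC ler_pdivlMr; last lra.
  rewrite -subr_ge0; have -> : a ^+ 2 * (a + 1) - (a ^+ 2 - a + 1) * (a + 2) = a - 2 by ring.
  by rewrite subr_ge0.
have to0 (e : R) : 0 < e -> exists N, forall i, (N <= i)%N -> d (V (c i)) <= e.
  move=> e0; exists (Num.truncn (11 * d (V x) / e)).+1 => i Ni; apply: le_trans (dle i) _.
  rewrite mulrAC ler_pdivrMr ?n0 // [e * _]mulrC -ler_pdivrMr //.
  apply: ltW; apply: lt_le_trans (truncnS_gt _) _.
  by rewrite ler_nat (leq_trans Ni) // leq_addr.
have cv : cvg ((fun i => V (c i)) @ \oo).
  apply/cauchy_cvgP/cauchyP => e e0; have [|N HN] := to0 (e / 4); first by rewrite divr_gt0.
  exists (V (c N)); exists N => // i /= Ni; rewrite -ball_normE /=.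
  have := eij N (i - N)%N; rewrite subnKC // => h; apply: le_lt_trans h _.
  by have := HN N (leqnn _); have := dc i; lra.
pose p := lim ((fun i => V (c i)) @ \oo); have cp : (V (c i) @[i --> \oo] --> p) by [].
have ip i : `|V (c i) - p| <= 2 * d (V (c i)).
  apply/ler_addgt0Pr => e e0; have /cvgrPdist_lt /(_ _ e0) [N _ HN] := cp.
  have := HN (i + N)%N (leq_addl _ _); have := eij i N; have := dc (i + N)%N.
  move=> h1 h2 h3; rewrite -(subrKA (V (c (i + N)%N))); apply: le_trans (ler_normD _ _) _.
  by rewrite (distrC _ p); lra.
exists c, p; split => //.
- move=> i j ij; have := kij i (j - i)%N; have := eij i (j - i)%N; rewrite subnKC // => h1 h2.
  have /andP[t1 t2] := tau0 i; have /andP[t3 t4] := tau0 j; have := dc j.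
  by split; lra.
- by move=> i; have [] := cP i.
- split => //; apply: (frontier_of_limit uD) => e e0.
  have [|N HN] := to0 (e / 4); first by rewrite divr_gt0.
  have h := HN N (leqnn _); exists (V (c N)); first exact: set_valP.
  by rewrite distrC; have := ip N; split; lra.
Qed.

End Ray.

(** * Triangles in hyperbolic spaces *)

Section HyperbolicTriangles.
Context {R : realType} {T : Type}.
Variable m : T -> T -> R.
Hypothesis mxx : forall x, m x x = 0.
Hypothesis m_sym : forall x y, m x y = m y x.
Hypothesis m_tri : forall y x z, m x z <= m x y + m y z.
Variable delta : R.
Hypothesis hyp : hyperbolic m delta.
Implicit Types (x y z w : T) (u v : nat -> T).
Notation gprod := (gprod m).

Lemma gprod_split z w x y c : gprod w x y <= c ->
  gprod w x z <= c + delta \/ gprod w z y <= c + delta.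
Proof.
move=> h; have := hyp x y z w; rewrite lerBlDr ge_min => /orP[h1|h1]; [left|right]; lra.
Qed.

Lemma gprod_dual w x y : gprod w x y = m w x - gprod x w y.
Proof. by rewrite /Defs.gprod (m_sym x w) (m_sym y w) (m_sym y x); lra. Qed.

Lemma gprod_on_geodesic h z y w : m z y + m y w <= m z w + h -> m z y - h / 2 <= gprod z w y.
Proof. by rewrite /Defs.gprod (m_sym w z) (m_sym w y) (m_sym y z); lra. Qed.

Lemma gprod_close w x y c : m x y <= c -> m w x - c <= gprod w x y.
Proof.
rewrite /Defs.gprod (m_sym x w) (m_sym y w); have := m_tri y w x; rewrite (m_sym y x); lra.
Qed.

Lemma gprod_close_le w x y z c : m x y <= c -> gprod w y z <= gprod w x z + c.
Proof.
rewrite /Defs.gprod => h; have := m_tri x y w; have := m_tri y x z; rewrite (m_sym y x); lra.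
Qed.

(** The point of the near-geodesic at distance (z|c_n)_{c_0} from its origin is where the triangle
    is thinnest; the four-point inequality bounds its distance to [z]. *)
Lemma chain_near z (c : nat -> T) n :
  (forall i, (i < n)%N -> m (c i) (c i.+1) <= 1) ->
  (forall i, (i <= n)%N -> m (c 0%N) (c i) + m (c i) (c n) <= m (c 0%N) (c n) + 2) ->
  exists2 i, (i <= n)%N & m z (c i) <= gprod z (c 0%N) (c n) + 2 * delta + 2.
Proof.
move=> st geo; pose a := gprod (c 0%N) z (c n).
have ex : exists i, (i <= n)%N && (a <= m (c 0%N) (c i)).
  exists n; rewrite leqnn /= /a (gprod_sym m_sym) m_sym; exact: gprod_le.
pose i := ex_minn ex; have [/andP[ni ai] imin] : ((i <= n)%N && (a <= m (c 0%N) (c i))) /\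
    forall j, (j <= n)%N && (a <= m (c 0%N) (c j)) -> (i <= j)%N.
  by rewrite /i; case: ex_minnP.
have a0 : 0 <= a by exact: gprod_ge0.
have ai1 : m (c 0%N) (c i) <= a + 1.
  move: ni ai imin; move: i => [|j] ni ai imin; first by rewrite mxx; lra.
  have : m (c 0%N) (c j) < a.
    rewrite ltNge; apply/negP => h; have := imin j; rewrite h andbT (ltnW ni) => /(_ isT).
    by rewrite ltnn.
  by have := st j ni; have := m_tri (c j) (c 0%N) (c j.+1); lra.
exists i => //; have gi := geo i ni; move: ai ai1; rewrite /a /Defs.gprod => ai ai1.
have s1 := m_sym (c 0%N) z; have s2 := m_sym (c n) z; have s3 := m_sym (c i) (c n).
have s4 := m_sym (c 0%N) (c n); have s5 := m_sym (c i) (c 0%N).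
by case: (four_point m_sym hyp z (c i) (c 0%N) (c n)) => h; lra.
Qed.

(* [j] is the point of the geodesic from [x] to [y] where the one to [w] branches off. *)
Lemma branch_point x y w j t : m x j + m j y <= m x y + 2 -> t <= m x j <= t + 1 ->
  `|gprod x y w - t| <= 2 * delta ->
  gprod j y w <= 2 + 5 * delta /\ gprod j x w <= 2 + 3 * delta.
Proof.
move=> geo /andP[j1 j2]; rewrite ler_norml => /andP[g1 g2].
have d0 := delta_ge0 mxx hyp x.
have h1 : t - 1 <= gprod x j y by rewrite (gprod_sym m_sym); have := gprod_on_geodesic geo; lra.
have h2 : t - 1 - 3 * delta <= gprod x j w.
  by have := hyp j w y x; rewrite lerBlDr ge_min => /orP[]; lra.
move: g1 g2 h1 h2; rewrite /Defs.gprod.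
have s1 := m_sym x j; have s2 := m_sym x y; have s3 := m_sym x w; have s4 := m_sym j y.
have s5 := m_sym j w; have s6 := m_sym y w.
by split; lra.
Qed.

Lemma geodesics_diverge z w p y y' (K c l : R) : gprod z w p <= K ->
  m z y + m y w <= m z w + 1 -> m z y' + m y' p <= m z p + 1 ->
  m y y' <= c -> l <= m z y -> l <= m z y' -> l <= K + c + 2 * delta + 1 / 2.
Proof.
move=> hK g1 g2 yy' l1 l2; rewrite leNgt; apply/negP => hl.
have := @gprod_min3 _ _ _ mxx _ hyp z w p y y' (l - c - 1 / 2).
have c0 : 0 <= c by apply: le_trans yy'; exact: m_ge0.
have a1 := gprod_on_geodesic g1; have a2 := gprod_on_geodesic g2; rewrite (gprod_sym m_sym) in a2.
have a3 := gprod_close z yy'.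
have a4 := gprod_le m_sym m_tri z y' y; have a5 := gprod_sym m_sym z y y'.
by move=> H; have := H ltac:(lra) ltac:(lra) ltac:(lra); lra.
Qed.

Lemma shadow_point z w w0 y z' (c l : R) : l <= m z y -> m z y + m y w0 <= m z w0 + 1 ->
  m y z' <= c -> l <= gprod z w w0 -> l - c - 1 / 2 - delta <= gprod z w z'.
Proof.
move=> l1 g1 yz h; have c0 : 0 <= c by apply: le_trans yz; exact: m_ge0.
have a1 := gprod_on_geodesic g1; have a3 := gprod_close_le z w0 yz.
have a4 := gprod_sym m_sym z y w0; have := hyp w z' w0 z; rewrite lerBlDr ge_min.
have : m z y - 1 / 2 - c <= gprod z w0 z'.
  have := m_tri y z z'; have := m_tri z' z y; have := m_tri y z' w0.
  by move: a1; rewrite /Defs.gprod (m_sym w0 z) (m_sym w0 y) (m_sym z' z)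
    (m_sym w0 z') (m_sym z' y) (m_sym y z); lra.
by move=> h1 /orP[]; lra.
Qed.

(** Seen from [w], the way to [a] passes near [z], and [b] branches off it only beyond [z]; so the
    way to [b] passes near [z] too. *)
Lemma gprod_bend z w a b K : 0 <= K -> gprod z a w <= K -> m w z < gprod w a b ->
  gprod z w b <= K + delta.
Proof.
move=> K0 h1 h2; have e1 := gprod_dual w z b; have e2 := gprod_dual w z a.
have e3 := gprod_sym m_sym z a w.
by have := hyp z b a w; rewrite lerBlDr ge_min => /orP[]; lra.
Qed.

Lemma gprod_through z w a b K : gprod z a w <= K -> gprod z b w <= K ->
  m w z - 2 * K <= gprod w a b.
Proof.
rewrite /Defs.gprod (m_sym a z) (m_sym b z) (m_sym w z) (m_sym a w) (m_sym b w).
by have := m_tri z a b; rewrite (m_sym a z); lra.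
Qed.

End HyperbolicTriangles.

(** * Near-geodesics and rays for [k] *)

Section Rays.
Context {R : realType} {E : completeNormedModType R}.
Variable D : set E.
Hypothesis uD : unbounded_domain D.
Notation k := (@quasihyp R E D).
Notation V := (@set_val E D).
Notation d := (bdist D).
Implicit Types (x y z u : D) (q p : E).

Let kxx := quasihypxx uD.
Let ks := quasihyp_sym uD.
Let kt := quasihyp_triangle uD.

Lemma quasihyp_ln_bdist x y : ln (d (V y)) - ln (d (V x)) <= k x y.
Proof.
have dx := bdist_gt0 uD (set_valP x); have dy := bdist_gt0 uD (set_valP y).
rewrite lerBlDr -[k x y]expRK -lnM ?posrE ?expR_gt0 //; apply: ler_ln_le => //.
have := bdist_lip uD (V y) (V x); have := quasihyp_dist uD x y; rewrite distrC.
by rewrite mulrBl mul1r; lra.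
Qed.

Lemma dist_le_expR x y (c : R) : k x y <= c -> `|V x - V y| <= expR c * d (V x).
Proof.
move=> h; apply: le_trans (quasihyp_dist uD x y) _.
have dx := bdist_gt0 uD (set_valP x); have : expR (k x y) <= expR c by rewrite ler_expR.
by rewrite ler_pM2r //; lra.
Qed.

Lemma bdist_le4 x y : k x y <= 1 -> d (V y) <= 4 * d (V x).
Proof.
move=> h; have e2 : expR (1 / 2 : R) <= 2.
  by have := @expR_sub1_le R (1 / 2); rewrite lexx divr_ge0 // => /(_ isT); lra.
have e4 : expR (1 : R) <= 4.
  have -> : (1 : R) = 1 / 2 + 1 / 2 by lra.
  by rewrite expRD; have := expR_gt0 (1 / 2 : R); nra.
have dx := bdist_gt0 uD (set_valP x); have := quasihyp_ln_bdist x y => h1.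
have : d (V y) <= expR 1 * d (V x).
  rewrite -ler_ln ?posrE ?mulr_gt0 ?expR_gt0 ?(bdist_gt0 uD (set_valP _)) //.
  by rewrite lnM ?posrE ?expR_gt0 // expRK; lra.
by nra.
Qed.

Lemma quasihyp_ge_dist x y (c : R) : (expR c - 1) * d (V x) <= `|V x - V y| -> c <= k x y.
Proof.
have dx := bdist_gt0 uD (set_valP x).
move=> /le_trans /(_ (quasihyp_dist uD x y)); rewrite ler_pM2r // lerBlDr subrK ler_expR.
exact.
Qed.

Lemma half_geodesic x y : exists n (c : nat -> D), [/\ c 0%N = x, c n = y,
  forall i, (i <= n)%N -> k x (c i) + k (c i) y <= k x y + 1 &
  forall i, (i < n)%N -> k (c i) (c i.+1) <= 1 / 2].
Proof.
have [|n [c [t [c0 cn ct tS]]]] := @quasihyp_geodesic _ _ _ uD x y (1 / 4); first by rewrite divr_gt0.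
exists n, c; split => // i ni.
  have := ct 0%N n; have := ct 0%N i; have := ct i n; rewrite !leq0n !ni !leqnn c0 cn /=.
  by move=> /(_ isT)/andP[a1 a2] /(_ isT)/andP[a3 a4] /(_ isT)/andP[a5 a6]; lra.
have := ct i i.+1; rewrite leqnSn ni => /(_ isT)/andP[a1 a2].
have := tS i ni; lra.
Qed.

(** The first point outside the ball: a step of [k]-length 1/2 moves by at most twice the height,
    and the height is at most the distance to the boundary point [q]. *)
Lemma geodesic_crossing x y q (s : R) : frontier D q -> `|V x - q| < s -> s <= `|V y - q| ->
  exists u, s <= `|V u - q| <= 3 * s /\ k x u + k u y <= k x y + 1.
Proof.
move=> fq xs ys; have [n [c [c0 cn geo st]]] := half_geodesic x y.
have ex : exists i, (i <= n)%N && (s <= `|V (c i) - q|) by exists n; rewrite leqnn cn.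
case: (ex_minnP ex) => i /andP[ni si] imin; exists (c i); split; last exact: geo.
rewrite si /=; move: ni si imin; case: i => [|j] nj si imin.
  by move: si; rewrite c0 leNgt xs.
have js : `|V (c j) - q| < s.
  by rewrite ltNge; apply/negP => h; have := imin j; rewrite h andbT (ltnW nj) ltnn => /(_ isT).
have h1 := st j nj; have := quasihyp_dist uD (c j) (c j.+1).
have dj := bdist_le uD (V (c j)) fq; have d0 := bdist_gt0 uD (set_valP (c j)).
have h2 : expR (k (c j) (c j.+1)) - 1 <= 2.
  by have := @expR_sub1_le R (k (c j) (c j.+1)); rewrite quasihyp_ge0 //= h1 => /(_ isT); lra.
have h3 : (expR (k (c j) (c j.+1)) - 1) * d (V (c j)) <= 2 * d (V (c j)) by rewrite ler_pM2r.
have : `|V (c j.+1) - q| <= `|V (c j) - V (c j.+1)| + `|V (c j) - q|.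
  by rewrite (distrC (V (c j))) -{1}(subrKA (V (c j))) ler_normD.
by lra.
Qed.

Lemma geodesic_at x y (L : R) : 0 <= L -> L <= k x y ->
  exists u, L <= k x u <= L + 1 /\ k x u + k u y <= k x y + 1.
Proof.
move=> L0 Lk; have [n [c [c0 cn geo st]]] := half_geodesic x y.
have ex : exists i, (i <= n)%N && (L <= k x (c i)) by exists n; rewrite leqnn cn.
case: (ex_minnP ex) => i /andP[ni si] imin; exists (c i); split; last exact: geo.
rewrite si /=; move: ni si imin; case: i => [|j] nj si imin.
  by rewrite c0 kxx; lra.
have js : k x (c j) < L.
  by rewrite ltNge; apply/negP => h; have := imin j; rewrite h andbT (ltnW nj) ltnn => /(_ isT).
by have h1 := st j nj; have := kt (c j) x (c j.+1); lra.
Qed.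

Section OneRay.
Variables (x : D) (c : nat -> D) (p : E).
Hypothesis cP : ray_seq x c p.

Lemma ray_geodesic i n : (i <= n)%N -> k x (c i) + k (c i) (c n) <= k x (c n) + 2.
Proof.
move: cP => [c0 H _ _ _] ni; have [h1 _] := H i n ni; have [h2 _] := H 0%N i (leq0n _).
rewrite c0 in h2; have := quasihyp_ln_bdist (c n) x; rewrite (ks (c n)); lra.
Qed.

Lemma ray_dist i : `|V x - V (c i)| <= 2 * d (V x).
Proof. by move: cP => [c0 H _ _ _]; have [] := H 0%N i (leq0n _); rewrite c0. Qed.

Lemma ray_end i : `|V (c i) - p| <= 2 * d (V (c i)).
Proof. by move: cP => [_ _ _ _ []]. Qed.

Lemma ray_end0 : `|V x - p| <= 2 * d (V x).
Proof. by have := ray_end 0; case: cP => ->. Qed.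

Lemma ray_far (L : R) : exists N, forall i, (N <= i)%N -> L <= k x (c i).
Proof.
move: cP => [_ _ _ H _]; have dx := bdist_gt0 uD (set_valP x).
have [|N HN] := H (expR (- L) * d (V x)); first by rewrite mulr_gt0 ?expR_gt0.
exists N => i /HN h; have di := bdist_gt0 uD (set_valP (c i)).
have := ler_ln_le di h; rewrite lnM ?posrE ?expR_gt0 // expRK.
have := quasihyp_ln_bdist (c i) x; rewrite ks; lra.
Qed.

Lemma ray_at n (L : R) : 0 <= L -> L <= k x (c n) ->
  exists2 i, (i <= n)%N & L <= k x (c i) <= L + 1.
Proof.
move: cP => [c0 _ st _ _] L0 Lk.
have ex : exists i, (i <= n)%N && (L <= k x (c i)) by exists n; rewrite leqnn.
case: (ex_minnP ex) => i /andP[ni si] imin; exists i => //.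
rewrite si /=; move: ni si imin; case: i => [|j] nj si imin.
  by rewrite c0 kxx; lra.
have js : k x (c j) < L.
  by rewrite ltNge; apply/negP => h; have := imin j; rewrite h andbT (ltnW nj) ltnn => /(_ isT).
by have h1 := st j; have := kt (c j) x (c j.+1); lra.
Qed.

Lemma ray_near delta (hyp : hyperbolic k delta) z n :
  exists2 i, (i <= n)%N & k z (c i) <= gprod k z x (c n) + 2 * delta + 2.
Proof.
move: cP => [c0 _ st _ _]; rewrite -c0; apply: (chain_near kxx ks kt hyp) => i ni //.
by rewrite c0; exact: ray_geodesic.
Qed.

Lemma ray_descent i : ln (d (V (c i))) <= ln (d (V x)) + 1 - k x (c i).
Proof. by move: cP => [c0 H _ _ _]; have [] := H 0%N i (leq0n _); rewrite c0; lra. Qed.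

End OneRay.
End Rays.

(** * From quasisymmetry to the geometry of geodesics *)

Section Converse.
Context {R : realType} {E : completeNormedModType R}.
Variable D : set E.
Hypothesis uD : unbounded_domain D.
Hypothesis dE : dim_ge2 E.
Notation k := (@quasihyp R E D).
Notation V := (@set_val E D).
Notation d := (bdist D).
Variable delta : R.
Hypothesis hyp : hyperbolic k delta.
Variables (ray : D -> nat -> D) (pt : D -> E) (w : nat -> D).
Hypothesis rayP : forall x, ray_seq x (ray x) (pt x).
Hypothesis w_gromov : forall x (L : R), exists N, forall i j,
  (N <= i)%N -> (N <= j)%N -> L <= gprod k x (w i) (w j).
Hypothesis w_far : forall M : R, exists N, forall n, (N <= n)%N -> M <= `|V (w n)|.
Hypothesis ray_stable : forall x, exists t : R, exists N, forall n, (N <= n)%N ->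
  `|gprod k x (ray x n) (w n) - t| <= 2 * delta.
(** The two forms in which quasisymmetry is used: [Q1] bounds a ratio of distances of endpoints from
    a difference of products at [w n], and [Q2] bounds a difference of products from a ratio of
    distances. *)
Variables Q1 Q2 : R -> R.
Hypothesis Q1_ge0 : forall c, 0 <= Q1 c.
Hypothesis Q2_ge0 : forall c, 0 <= Q2 c.
Hypothesis Q1P : forall x y z (c : R), (exists N, forall n, (N <= n)%N ->
    gprod k (w n) (ray x n) (ray z n) - c <= gprod k (w n) (ray x n) (ray y n)) ->
  `|pt x - pt y| <= Q1 c * `|pt x - pt z|.
Hypothesis Q2P : forall x y z (c : R), pt x <> pt z -> `|pt x - pt y| <= c * `|pt x - pt z| ->
  exists N, forall n, (N <= n)%N ->
    gprod k (w n) (ray x n) (ray z n) - Q2 c <= gprod k (w n) (ray x n) (ray y n).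
Implicit Types (x y z u : D).

Let kxx := quasihypxx uD.
Let ks := quasihyp_sym uD.
Let kt := quasihyp_triangle uD.
Let dpos x : 0 < d (V x). Proof. exact: bdist_gt0 (set_valP x). Qed.
Let ptF x : frontier D (pt x). Proof. by case: (rayP x) => _ _ _ _ []. Qed.
Let delta0 : 0 <= delta. Proof.
by have [y Dy] := domain_neq0 uD; exact: (delta_ge0 kxx hyp (SigSub (mem_set Dy))).
Qed.
Let gs o x y : gprod k o x y = gprod k o y x. Proof. exact: gprod_sym. Qed.

Definition sep0 : R := sep_cst 3 (1 / 36).

Lemma sep_cst_ge0 c c1 : 0 <= sep_cst c c1 :> R.
Proof. by rewrite /sep_cst mulr_ge0. Qed.

Lemma separation (c s : R) q y y' : 1 <= c -> 0 < s ->
  s <= `|V y - q| <= c * s -> s <= `|V y' - q| <= c * s ->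
  k y y' <= sep_cst c (1 / 36) \/ exists z : D, [/\ s / 3 <= `|V z - q|,
    d (V z) <= s / 36, k y z <= sep_cst c (1 / 36) & s / 4 <= `|q - pt z|].
Proof.
move=> c1 s0 h h'; have i36 : 0 < 1 / 36 :> R by rewrite divr_gt0.
have [|[z [z1 z2 z3]]] := annulus_separation uD dE c1 i36 s0 h h'; first by left.
right; exists z; have e := ray_end0 (rayP z); have t := ler_normD (V z - pt z) (pt z - q).
by rewrite subrKA (distrC (pt z)) in t; split => //; lra.
Qed.

(** In the proof of [cone], two geodesics from z with product at most K are more than [sep0] apart
    beyond [cone_depth], and a ray with small product at z comes within [cone_near] of z. The
    annulus has radius [cone_scale] times d(z), large enough for both estimates to be decisive. *)
Definition cone_depth (K : R) := K + sep0 + 1 + 3 * delta.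
Definition cone_near (K : R) := K + 4 * delta + 2.
Definition cone_scale (K : R) := 2 + expR (cone_depth K) + 4 * (expR (cone_near K) + 3).
Definition cone_cst (K : R) :=
  (2 + Q1 (2 * K) * (3 * expR sep0 + 4)) * cone_scale K.

Lemma far_norm q (M : R) : exists N, forall n, (N <= n)%N -> M <= `|V (w n) - q|.
Proof.
have [N HN] := w_far (M + `|q|); exists N => n /HN h.
by have := ler_normD (V (w n) - q) q; rewrite subrK; lra.
Qed.

Lemma far_quasihyp x (L : R) : exists N, forall n, (N <= n)%N -> L <= k x (w n).
Proof.
have [N HN] := far_norm (V x) (expR L * d (V x)); exists N => n /HN h.
apply: (quasihyp_ge_dist uD); rewrite distrC; apply: le_trans h.
by have := dpos x; rewrite mulrBl mul1r; lra.
Qed.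

(* If [pt b] were far from [pt a], the separation lemma in an annulus around [pt a] would
   yield a boundary point [pt z'] at which the quasisymmetry condition fails. *)
Lemma cone K z a b : 0 <= K -> `|V z - pt a| <= 3 * d (V z) ->
  (exists N, forall n, (N <= n)%N -> gprod k z (ray a n) (w n) <= K) ->
  (exists N, forall n, (N <= n)%N -> gprod k z (ray b n) (w n) <= K) ->
  `|pt b - pt a| <= cone_cst K * d (V z).
Proof.
move=> K0 za [Na Ha] [Nb Hb]; set q := pt a; pose M := cone_scale K; pose s := M * d (V z).
have dz := dpos z; have e1 := expR_gt0 (cone_depth K); have e2 := expR_gt0 (cone_near K).
have e3 := expR_gt0 sep0; have q0 := Q1_ge0 (2 * K); have sep00 : 0 <= sep0 by exact: sep_cst_ge0.
have M0 : 14 <= M by rewrite /M /cone_scale; lra.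
have s0 : 0 < s by rewrite mulr_gt0 //; lra.
have zs : 3 * d (V z) < s by rewrite /s ltr_pM2r //; lra.
have Qe : 0 <= Q1 (2 * K) * (3 * expR sep0 + 4) by rewrite mulr_ge0 //; lra.
have [small|big] := ltP `|pt b - q| (2 * s).
  apply: le_trans (ltW small) _; rewrite /s mulrA ler_pM2r // /cone_cst -/M.
  by rewrite ler_pM2r; lra.
have [N1 H1] := w_gromov z (cone_depth K).
have [N2 H2] := far_norm q s.
have [N3 H3] : exists N, forall n, (N <= n)%N -> s <= `|V (ray b n) - q|.
  have [_ _ _ H _] := rayP b; have [|N HN] := H (s / 2); first by rewrite divr_gt0.
  exists N => n /HN h; have := ray_end (rayP b) n.
  rewrite distrC; have := ler_normD (pt b - V (ray b n)) (V (ray b n) - q).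
  by rewrite subrKA; lra.
pose n0 := maxn (maxn Na Nb) (maxn N1 (maxn N2 N3)).
have [na nb n1 n2 n3] : [/\ (Na <= n0)%N, (Nb <= n0)%N, (N1 <= n0)%N, (N2 <= n0)%N & (N3 <= n0)%N].
  by rewrite /n0; split; rewrite !leq_max leqnn ?orbT.
have fq : frontier D q by exact: ptF.
have [y [/andP[y1 y2] yg]] := geodesic_crossing uD fq (le_lt_trans za zs) (H2 n0 n2).
have [y' [/andP[y'1 y'2] y'g]] := geodesic_crossing uD fq (le_lt_trans za zs) (H3 n0 n3).
have deep u : s <= `|V u - q| -> cone_depth K <= k z u.
  move=> su; apply: (quasihyp_ge_dist uD).
  have := ler_normD (V u - V z) (V z - q); rewrite subrKA (distrC (V u) (V z)) => h.
  have h2 : s = cone_scale K * d (V z) by [].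
  by rewrite /cone_scale in h2; nra.
have ly := deep y y1; have ly' := deep y' y'1.
(* If [y] and [y'] were close for [k], two geodesics from [z] with small product would stay together
   too long. So there is [z'], close to [y], whose ray ends away from [q]. *)
have [|||kyy|[z' [z'1 z'2 z'3 z'4]]] := @separation 3 s q y y' _ s0; rewrite ?y1 ?y'1 ?ler1n //.
  have h := geodesics_diverge kxx ks kt hyp (_ : gprod k z (w n0) (ray b n0) <= K) yg y'g kyy ly ly'.
  have hb : gprod k z (w n0) (ray b n0) <= K by rewrite gs; exact: Hb.
  by have := h hb; have d00 := delta0; rewrite /cone_depth -/sep0; lra.
rewrite -/sep0 in z'3.
have qz' : `|q - pt z'| <= (3 * expR sep0 + 4) * s.
  have h1 := ray_end0 (rayP z').
  have h3 := ler_normD (q - V z') (V z' - pt z'); rewrite subrKA in h3.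
  have h4 := dist_le_expR uD z'3; have h5 := bdist_le uD (V y) fq.
  have h6 := ler_normD (V z' - V y) (V y - q); rewrite subrKA (distrC (V z') (V y)) in h6.
  have h7 : expR sep0 * d (V y) <= expR sep0 * (3 * s) by rewrite ler_pM2l //; lra.
  by rewrite (distrC q (V z')) in h3; lra.
(* Seen from [w n], the rays of [a] and [b] separate no earlier than near [z]. If the ray of [z']
   left that of [a] only beyond [z], it would pass near [z]; but all of it lies near [z'], far from
   [z]. *)
have key : exists N, forall n, (N <= n)%N ->
    gprod k (w n) (ray a n) (ray z' n) - 2 * K <= gprod k (w n) (ray a n) (ray b n).
  exists n0 => n; rewrite /n0 !geq_max => /andP[/andP[an bn] /andP[n1' _]].
  have ga := Ha n an; have gb := Hb n bn.
  have low := gprod_through ks kt ga gb.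
  suff : gprod k (w n) (ray a n) (ray z' n) <= k (w n) z by lra.
  rewrite leNgt; apply/negP => /(gprod_bend ks hyp K0 ga) h.
  have h1 := shadow_point kxx ks kt hyp ly yg z'3 (H1 n n0 n1' n1).
  have [|{}h] := gprod_split hyp z' h; first by rewrite /cone_depth in h1; lra.
  have [i _ hi] := ray_near uD (rayP z') hyp z n.
  have hi' : k z (ray z' i) <= cone_near K by rewrite /cone_near; lra.
  have t1 := dist_le_expR uD hi'; have t2 := ray_dist (rayP z') i.
  have t3 := ler_normD (V z' - V (ray z' i)) (V (ray z' i) - q); rewrite subrKA in t3.
  have t4 := ler_normD (V (ray z' i) - V z) (V z - q); rewrite subrKA (distrC _ (V z)) in t4.
  have t5 : s = cone_scale K * d (V z) by [].
  by rewrite /cone_scale in t5; nra.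
have := Q1P key => h; rewrite distrC; apply: le_trans h _.
apply: le_trans (ler_wpM2l q0 qz') _; rewrite mulrA /s mulrA ler_pM2r // /cone_cst -/M.
by rewrite ler_pM2r; lra.
Qed.

Definition star_near := 6 + 6 * delta + sep0.
Definition star_sep := 4 * (expR star_near + 2 + cone_cst (2 + 5 * delta)) + 1.
Definition star_cst := 4 + 5 * delta + sep0 + ln star_sep.

Lemma cone_cst_ge0 K : 0 <= cone_cst K.
Proof.
have e1 := expR_gt0 (cone_depth K); have e2 := expR_gt0 (cone_near K).
have e3 := expR_gt0 sep0; have q0 := Q1_ge0 (2 * K).
have h1 : 0 <= Q1 (2 * K) * (3 * expR sep0 + 4) by rewrite mulr_ge0 //; lra.
have h2 : 0 <= cone_scale K by rewrite /cone_scale; lra.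
by rewrite /cone_cst mulr_ge0 // addr_ge0.
Qed.

(** If the product is large, the geodesic to [w n] first follows the ray of x down to a point J with
    d(J) much smaller than d(x), then leaves the ball of radius d(x) around pt x at some y. If x and
    y were [k]-close, the two ways from J to them would agree, against the choice of J. Otherwise
    there is a point [k]-close to x whose ray ends at a distance comparable to d(x) from pt x; yet
    [cone] at J bounds this distance by a multiple of d(J). *)
Lemma starlike x : exists N, forall n, (N <= n)%N -> gprod k x (ray x n) (w n) <= star_cst.
Proof.
have d00 := delta0; have [t [N HN]] := ray_stable x; have sep00 : 0 <= sep0 by exact: sep_cst_ge0.
have c0 := cone_cst_ge0 (2 + 5 * delta); have e0 := expR_gt0 star_near.
have Z1 : 1 <= star_sep by rewrite /star_sep; lra.
have lZ : 0 <= ln star_sep by exact: ln_ge0.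
pose T1 := 4 + 3 * delta + sep0 + ln star_sep.
have [tT|tT] := leP t T1.
  exists N => n /HN; rewrite ler_norml => /andP[h1 h2]; rewrite /star_cst.
  by rewrite /T1 in tT; lra.
exfalso; have dx := dpos x.
have [N1 HN1] := ray_far uD (rayP x) t.
have [|j jN1 /andP[j1 j2]] := @ray_at _ _ _ uD _ _ _ (rayP x) N1 t _ (HN1 _ (leqnn _)).
  by rewrite /T1 in tT; lra.
set J := ray x j in j1 j2.
have dJ : star_sep * d (V J) <= d (V x).
  have h := ray_descent (rayP x) j; rewrite -/J in h.
  rewrite -ler_ln ?posrE ?mulr_gt0 ?dpos //; last by lra.
  by rewrite lnM ?posrE ?dpos //; rewrite /T1 in tT; lra.
have branch n : (maxn N j <= n)%N ->
    gprod k J (ray x n) (w n) <= 2 + 5 * delta /\ gprod k J x (w n) <= 2 + 3 * delta.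
  rewrite geq_max => /andP[Nn jn].
  apply: (branch_point kxx ks hyp (t := t)); rewrite ?j1 ?j2 //; last exact: HN.
  exact: (ray_geodesic uD (rayP x)).
set q := pt x; have fq : frontier D q by exact: ptF.
have xq1 := bdist_le uD (V x) fq; have xq2 := ray_end0 (rayP x); rewrite -/q in xq2.
have Jq := ray_end (rayP x) j; rewrite -/J -/q in Jq.
have dJ0 := dpos J.
have dJ' : 4 * (expR star_near + 2 + cone_cst (2 + 5 * delta)) * d (V J) < d (V x).
  by apply: lt_le_trans dJ; rewrite ltr_pM2r // /star_sep; lra.
have Jq1 : `|V J - q| < d (V x) by nra.
have [N2 H2] := far_norm q (d (V x)).
pose n0 := maxn (maxn N j) N2.
have [y [/andP[y1 y2] yg]] := geodesic_crossing uD fq Jq1 (H2 n0 (leq_maxr _ _)).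
have [b1 b2] := branch n0 (leq_maxl _ _).
have [|||kxy|[z' [z'1 z'2 z'3 z'4]]] := @separation 3 (d (V x)) q x y _ dx.
- by rewrite ler1n.
- by rewrite xq1 /=; lra.
- by rewrite y1.
- rewrite -/sep0 in kxy; have g := gprod_on_geodesic ks yg.
  move: b2 g kxy; rewrite /gprod /T1 in tT *.
  have := kt y x (w n0); have := kt x y (w n0); have := ks x J; have := ks x y; have := ks (w n0) J.
  have := ks (w n0) x; have := ks (w n0) y; have := ks y J; have := kt y x J.
  by lra.
rewrite -/sep0 in z'3.
(* A small product would bring the ray of [z'] close to [J], hence to [q]; but that ray stays within
   2 d(z') of [z']. *)
have far_ n : gprod k J x (ray z' n) <= 2 + 4 * delta -> False.
  move=> h; have h1 := gprod_close_le ks kt J (ray z' n) z'3.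
  have [i _ hi] := ray_near uD (rayP z') hyp J n.
  have h2 : gprod k J z' (ray z' n) <= 2 + 4 * delta + sep0.
    have z'x : k z' x <= sep0 by rewrite ks.
    by have := gprod_close_le ks kt J (ray z' n) z'x; lra.
  have hi' : k J (ray z' i) <= star_near by rewrite /star_near; lra.
  have t1 := dist_le_expR uD hi'; have t2 := ray_dist (rayP z') i.
  have t3 := ler_normD (V z' - V (ray z' i)) (V (ray z' i) - q); rewrite subrKA in t3.
  have t4 := ler_normD (V (ray z' i) - V J) (V J - q); rewrite subrKA (distrC _ (V J)) in t4.
  by nra.
have cJ : `|pt z' - q| <= cone_cst (2 + 5 * delta) * d (V J).
  apply: (@cone _ J x z'); first lra.
  - by rewrite -/q; lra.
  - by exists (maxn N j) => n /branch[].
  - exists (maxn N j) => n /branch[_ h].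
    have [h1|h1] := gprod_split hyp (ray z' n) h; [by case: (far_ n _); lra|lra].
by rewrite distrC in z'4; nra.
Qed.

Definition close_gap (M : R) := sep_cst (2 * M) (1 / 36) + star_cst + 2 * delta + Q2 (16 * M).
Definition close_drop (M : R) := 2 * close_gap M + 4 * star_cst + 5 + 4 * delta.
Definition close_cst (M : R) :=
  sep_cst (2 * M) (1 / 36) + 2 * close_drop M + ln M + 1.

Lemma star_cst_ge0 : 0 <= star_cst.
Proof.
have d00 := delta0; have c0 := cone_cst_ge0 (2 + 5 * delta); have e0 := expR_gt0 star_near.
have sep00 : 0 <= sep0 by exact: sep_cst_ge0.
have : 0 <= ln star_sep by apply: ln_ge0; rewrite /star_sep; lra.
by rewrite /star_cst; lra.
Qed.

(** The way from [w n] over [y] down its ray is nearly geodesic by [starlike]; [ray y i] is the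
    point on it at about the distance of [x] from [w n]. *)
Lemma ray_detour x y n i L : 0 <= L -> k (w n) y + L = k (w n) x ->
  L <= k y (ray y i) <= L + 1 -> (i <= n)%N ->
  gprod k y (ray y n) (w n) <= star_cst ->
  k (w n) (ray y i) <= k (w n) x + 1 /\
  k (w n) x - 2 * star_cst - 2 <= gprod k (w n) (ray y n) (ray y i).
Proof.
move=> L0 eL /andP[l1 l2] ni S; have g := ray_geodesic uD (rayP y) ni; have S0 := star_cst_ge0.
have t1 := kt y (w n) (ray y i); have t2 := kt (ray y i) (ray y n) (w n).
move: S; rewrite /gprod; have s1 := ks (ray y n) y; have s2 := ks (w n) y; have s3 := ks (ray y n) (w n).
have s4 := ks (ray y i) (w n); have s5 := ks (ray y i) (ray y n).
by move=> S; split; lra.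
Qed.

Lemma star_dual x n : gprod k x (ray x n) (w n) <= star_cst ->
  k (w n) x - star_cst <= gprod k (w n) x (ray x n).
Proof. by rewrite (gprod_dual ks (w n)) (gs x (w n)); lra. Qed.

(* By quasisymmetry the lower bound for the product of [ray x] and [ray z] passes to [ray x]
   and [ray y]; hence [x] is close to the point [ray y i] at the same distance from [w n],
   and comparing [d] at these two points bounds [k y (ray y i)]. *)
Lemma close_by_shadow x y z n i (M : R) : 1 <= M -> d (V y) <= M * d (V x) ->
  k x z <= sep_cst (2 * M) (1 / 36) ->
  gprod k x (ray x n) (w n) <= star_cst -> gprod k y (ray y n) (w n) <= star_cst ->
  gprod k z (ray z n) (w n) <= star_cst ->
  gprod k (w n) (ray x n) (ray z n) - Q2 (16 * M) <= gprod k (w n) (ray x n) (ray y n) ->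
  k (w n) y <= k (w n) x -> (i <= n)%N ->
  k (w n) x - k (w n) y <= k y (ray y i) <= k (w n) x - k (w n) y + 1 ->
  k x y <= close_cst M.
Proof.
move=> M1 dyx z3 Hx Hy Hz H1 wyx ni Li; have dx := dpos x; have dy := dpos y.
have d00 := delta0; have S0 := star_cst_ge0; have q2 := Q2_ge0 (16 * M).
have sp := sep_cst_ge0 (2 * M) (1 / 36).
have L0 : 0 <= k (w n) x - k (w n) y by rewrite subr_ge0.
have eL : k (w n) y + (k (w n) x - k (w n) y) = k (w n) x by rewrite addrC subrK.
have [w1 w2] := ray_detour L0 eL Li ni Hy.
have g1 : k (w n) x - close_gap M <= gprod k (w n) (ray x n) (ray y n).
  apply: le_trans H1.
  suff g2 : k (w n) x - sep_cst (2 * M) (1 / 36) - star_cst - 2 * delta <= gprod k (w n) (ray x n) (ray z n).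
    by rewrite /close_gap; lra.
  apply: (gprod_min3 kxx hyp (z := x) (z' := z)).
  - by rewrite gs; have := star_dual Hx; lra.
  - by have := gprod_close ks kt (w n) z3; lra.
  - by have := star_dual Hz; have := kt z (w n) x; rewrite (ks z x); lra.
have g3 : k (w n) x - close_gap M - 2 * star_cst - 2 - 2 * delta <= gprod k (w n) x (ray y i).
  apply: (gprod_min3 kxx hyp (z := ray x n) (z' := ray y n)).
  - by have := star_dual Hx; rewrite /close_gap; lra.
  - lra.
  - by rewrite /close_gap; lra.
have kxi : k x (ray y i) <= close_drop M.
  by move: g3; rewrite /gprod /close_drop (ks x (w n)) (ks (ray y i) (w n)); lra.
have kyi : k y (ray y i) <= close_drop M + ln M + 1.
  have h1 := ray_descent (rayP y) i; have h2 := quasihyp_ln_bdist uD (ray y i) x.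
  have h3 : ln (d (V y)) <= ln M + ln (d (V x)) by apply: ln_le_scaled => //; exact: lt_le_trans M1.
  by rewrite (ks (ray y i)) in h2; lra.
have := kt (ray y i) x y; rewrite (ks (ray y i) y) /close_cst; lra.
Qed.

(** Which of x, y is nearer to [w n] depends on n, so the order enters as an implication; [close]
    fixes one n and orders the points accordingly. *)
Lemma close_above x y (M : R) :
  `|V x - V y| + d (V x) + d (V y) <= M * d (V x) ->
  `|V x - V y| + d (V x) + d (V y) <= M * d (V y) ->
  exists N, forall n, (N <= n)%N -> k (w n) y <= k (w n) x -> k x y <= close_cst M.
Proof.
move=> rx ry; have dx := dpos x; have dy := dpos y; have d00 := delta0; have S0 := star_cst_ge0.
have nxy := normr_ge0 (V x - V y).
have M1 : 1 <= M by nra.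
have lM : 0 <= ln M by exact: ln_ge0.
have q2 := Q2_ge0 (16 * M); have sp := sep_cst_ge0 (2 * M) (1 / 36).
pose s := Num.min (d (V x)) (d (V y)); have s0 : 0 < s by rewrite lt_min dx dy.
have sx : s <= d (V x) by rewrite ge_min lexx.
have sy : s <= d (V y) by rewrite ge_min lexx orbT.
have rs : `|V x - V y| + d (V x) + d (V y) <= M * s.
  by rewrite /s /Num.min; case: ifP.
set q := pt x; have fq : frontier D q by exact: ptF.
have xq1 := bdist_le uD (V x) fq; have xq2 := ray_end0 (rayP x); rewrite -/q in xq2.
have yq1 := bdist_le uD (V y) fq.
have yq2 := ler_normD (V y - V x) (V x - q); rewrite subrKA (distrC (V y) (V x)) in yq2.
have [|||kxy|[z [z1 z2 z3 z4]]] := @separation (2 * M) s q x y _ s0; first lra.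
- by apply/andP; split; lra.
- by apply/andP; split; lra.
- by exists 0%N => n _ _; rewrite /close_cst /close_drop /close_gap; lra.
(* The left side is at most |x - y| + 2 d(x) + 2 d(y), hence at most 2 M s, and s is at most four
   times the distance on the right. *)
have qy : `|q - pt y| <= 16 * M * `|q - pt z|.
  have h := ler_normD (q - V y) (V y - pt y); rewrite subrKA (distrC q (V y)) in h.
  have h1 := ray_end0 (rayP y); have h2 : M * s <= 4 * M * `|q - pt z| by nra.
  by lra.
have qz : pt x <> pt z by move=> e; move: z4; rewrite /q e subrr normr0; lra.
have [N1 H1] := Q2P qz qy; have [Nx Hx] := starlike x; have [Ny Hy] := starlike y.
have [Nz Hz] := starlike z; have [i0 Hi0] := ray_far uD (rayP y) (k x y).
exists (maxn (maxn N1 i0) (maxn Nx (maxn Ny Nz))) => n; rewrite !geq_max.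
move=> /andP[/andP[n1 ni0] /and3P[nx ny nz]] wyx.
have L0 : 0 <= k (w n) x - k (w n) y by rewrite subr_ge0.
have Lk : k (w n) x - k (w n) y <= k y (ray y i0).
  by have := Hi0 i0 (leqnn _); have := kt y (w n) x; rewrite (ks y x); lra.
have [i ii0 Li] := ray_at uD (rayP y) L0 Lk; have ni := leq_trans ii0 ni0.
apply: (close_by_shadow M1 _ z3 (Hx n nx) (Hy n ny) (Hz n nz) (H1 n n1) wyx ni Li).
by lra.
Qed.

Lemma close x y (M : R) :
  `|V x - V y| + d (V x) + d (V y) <= M * d (V x) ->
  `|V x - V y| + d (V x) + d (V y) <= M * d (V y) -> k x y <= close_cst M.
Proof.
move=> hx hy; have [N1 H1] := close_above hx hy; have [N2 H2] : exists N, forall n, (N <= n)%N ->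
    k (w n) x <= k (w n) y -> k y x <= close_cst M.
  by apply: close_above; rewrite distrC addrAC.
have [h|/ltW h] := leP (k (w (maxn N1 N2)) y) (k (w (maxn N1 N2)) x).
  by apply: H1 h; rewrite leq_maxl.
by rewrite ks; apply: H2 h; rewrite leq_maxr.
Qed.

Definition up_cone := 4 * (cone_cst (star_cst + delta + 1) + 6).
Definition up_cst := close_cst up_cone + 2 * star_cst + 4 * delta + 6.

(** Let y be the point at distance about [up_cst] on the way to [w n]. If its height were below 4
    d(x), then [cone] at y would place y within O(d(y)) of pt x, and [close] would make it [k]-close
    to a point of the ray of x of similar height. But by [starlike] the ray and the way to y leave x
    in different directions. *)
Lemma ascend x : exists y, k x y <= up_cst + 1 /\ 4 * d (V x) <= d (V y).
Proof.
have d00 := delta0; have S0 := star_cst_ge0; have c0 := cone_cst_ge0 (star_cst + delta + 1).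
have cl0 : 0 <= close_cst up_cone.
  by apply: le_trans (close (x := x) (y := x) _ _); rewrite ?kxx // subrr normr0 add0r;
    have := dpos x; rewrite /up_cone; nra.
have up0 : 0 <= up_cst by rewrite /up_cst; lra.
have [N0 H0] := starlike x.
have [N1 H1] := w_gromov x (up_cst + 3 + delta).
have [N2 H2] := far_quasihyp x up_cst.
pose n0 := maxn N1 N2.
have [y [/andP[y1 y2] yg]] := geodesic_at uD up0 (H2 n0 (leq_maxr _ _)).
exists y; split; first lra.
rewrite leNgt; apply/negP => dyx.
have yw n : (N1 <= n)%N -> gprod k y x (w n) <= 1 / 2 + delta.
  move=> Nn; have h : gprod k y x (w n0) <= 1 / 2.
    by rewrite /gprod (ks (w n0) y); lra.
  have [//|h1] := gprod_split hyp (w n) h; exfalso.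
  have := gprod_base ks kt x y (w n) (w n0).
  by have := H1 n n0 Nn (leq_maxl _ _); lra.
have xw n : (maxn N0 N1 <= n)%N -> gprod k y (ray x n) (w n) <= star_cst + delta + 1.
  rewrite geq_max => /andP[n0' n1]; have := H0 n n0'; have := yw n n1; rewrite /gprod.
  have := kt x y (ray x n); rewrite (ks (ray x n) x) (ks (ray x n) y) (ks (w n) x) (ks (w n) y) (ks y x).
  by lra.
have [Ny Hy] := starlike y.
have cn : `|pt x - pt y| <= cone_cst (star_cst + delta + 1) * d (V y).
  apply: cone; first lra.
  - by have := ray_end0 (rayP y); have := dpos y; lra.
  - by exists Ny => n /Hy; lra.
  - by exists (maxn N0 N1).
have yx : `|V y - pt x| <= (cone_cst (star_cst + delta + 1) + 2) * d (V y).
  have h := ler_normD (V y - pt y) (pt y - pt x); rewrite subrKA (distrC (pt y) (pt x)) in h.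
  by have := ray_end0 (rayP y); lra.
(* The first point of the ray not higher than [y]; it is not much lower either, since steps change d
   by a factor at most 4, and at index 0 this is the assumption on [y]. *)
have ex : exists i, d (V (ray x i)) <= d (V y).
  by have [_ _ _ H _] := rayP x; have [N HN] := H _ (dpos y); exists N; exact: HN.
case: (ex_minnP ex) => i di imin.
have di2 : d (V y) <= 4 * d (V (ray x i)).
  move: di imin; case: i => [|j] di imin.
    by have [-> _ _ _ _] := rayP x; lra.
  have dj : d (V y) < d (V (ray x j)).
    by rewrite ltNge; apply/negP => h; have := imin j h; rewrite ltnn.
  have [_ _ st _ _] := rayP x; have := st j; rewrite ks => /(bdist_le4 uD).
  by lra.
have dist : `|V (ray x i) - V y| <= (cone_cst (star_cst + delta + 1) + 4) * d (V y).
  have h := ler_normD (V (ray x i) - pt x) (pt x - V y); rewrite subrKA (distrC (pt x)) in h.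
  by have := ray_end (rayP x) i; lra.
have di0 := dpos (ray x i); have dy0 := dpos y.
have kiy : k (ray x i) y <= close_cst up_cone.
  apply: close; rewrite /up_cone; first nra.
  have : (cone_cst (star_cst + delta + 1) + 6) * d (V y)
      <= 4 * (cone_cst (star_cst + delta + 1) + 6) * d (V y).
    by rewrite ler_pM2r //; lra.
  by lra.
pose n := maxn (maxn N0 N1) i; have [n01 ni] : (maxn N0 N1 <= n)%N /\ (i <= n)%N by rewrite leq_maxl leq_maxr.
move: (n01); rewrite geq_max => /andP[nN0 nN1].
pose a := star_cst + 2 * delta + 1.
(* If either of the first two products is below [a], then [k x y] is too small; if neither is, the
   chain of three large products contradicts [starlike]. *)
have [h1|h1] := ltP (gprod k x (ray x n) (ray x i)) a.
  have := gprod_on_geodesic ks (ray_geodesic uD (rayP x) ni).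
  by have := kt (ray x i) x y; rewrite /a /up_cst in h1 y1 *; lra.
have [h2|h2] := ltP (gprod k x (ray x i) y) a.
  have := kt (ray x i) x y; move: h2; rewrite /gprod (ks (ray x i) x) (ks y x) /a /up_cst in y1 *.
  have := quasihyp_ge0 uD x (ray x i); lra.
have h3 : a <= gprod k x y (w n).
  by have := yw n nN1; have := gprod_dual ks x y (w n); rewrite /a /up_cst in y1 *; lra.
have := gprod_min3 kxx hyp h1 h2 h3; have := H0 n nN0; rewrite /a; lra.
Qed.

End Converse.

(** * Construction of uniform curves *)

Section UpperSums.
Context {R : realType} {E : completeNormedModType R}.
Implicit Types (f : E -> R) (g : R -> E) (a b c : R).

Lemma upper_sum_ge0 f g a b S : upper_sum f g a b S -> 0 <= S.
Proof.
elim=> {a b S} [a b M l ab M0 _ gl|a c b S T _ S0 _ T0]; last exact: addr_ge0.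
rewrite mulr_ge0 // -lee_fin; apply: le_trans gl; exact: curve_length_ge0.
Qed.

Lemma upper_sum_sub f g a b S : upper_sum f g a b S -> forall c, a <= c <= b ->
  exists2 S', S' <= S & upper_sum f g a c S'.
Proof.
elim=> {a b S} [a b M l ab M0 fM gl|a c b S T h1 IH1 h2 IH2] u /andP[au ub].
  exists (M * l) => //; constructor => //.
    by move=> t /andP[t1 t2]; apply: fM; rewrite t1 (le_trans t2).
  by apply: le_trans gl; exact: curve_length_sub.
have [uc|/ltW cu] := leP u c.
  have [|S' S'S h] := IH1 u; first by rewrite au.
  by exists S' => //; have := upper_sum_ge0 h2; lra.
have [|T' T'T h] := IH2 u; first by rewrite cu.
by exists (S + T'); [lra|exact: UpperSumD h1 h].
Qed.

Lemma upper_sum_length f g a b S m : 0 < m -> upper_sum f g a b S ->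
  (forall t, a <= t <= b -> m <= f (g t)) -> (curve_length g a b <= (S / m)%:E)%E.
Proof.
move=> m0; elim=> {a b S} [a b M l ab M0 fM gl|a c b S T h1 IH1 h2 IH2] H.
  have l0 : 0 <= l by rewrite -lee_fin; apply: le_trans gl; exact: curve_length_ge0.
  apply: le_trans gl _; rewrite lee_fin ler_pdivlMr // mulrC.
  by rewrite ler_wpM2r //; apply: le_trans (H a _) (fM a _); rewrite lexx ab.
have ac := upper_sum_le h1; have cb := upper_sum_le h2.
rewrite (@curve_lengthD _ _ g a b c) ?ac // mulrDl EFinD; apply: leeD.
  by apply: IH1 => t /andP[t1 t2]; apply: H; rewrite t1 (le_trans t2).
by apply: IH2 => t /andP[t1 t2]; apply: H; rewrite t2 andbT (le_trans ac).
Qed.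

Lemma curve_length_concat g1 g2 t : g1 1 = g2 0 -> 1 / 2 <= t ->
  curve_length (concat g1 g2) 0 t = (curve_length g1 0 1 + curve_length g2 0 (2 * t - 1))%E.
Proof.
move=> e t2; rewrite (@curve_lengthD _ _ _ 0 t (1 / 2)); last by rewrite divr_ge0.
have h : 2 * (1 / 2) = 1 :> R by lra.
by rewrite curve_length_concatl ?divr_ge0 // curve_length_concatr // h subrr.
Qed.

End UpperSums.

Section UniformCurves.
Context {R : realType} {E : completeNormedModType R}.
Variable D : set E.
Hypothesis uD : unbounded_domain D.
Notation k := (@quasihyp R E D).
Notation V := (@set_val E D).
Notation d := (bdist D).

Let dpos (x : D) : 0 < d (V x). Proof. exact: bdist_gt0 (set_valP x). Qed.

(** Every initial piece of the curve certifies that its endpoint is within [S] of x, so d changes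
    along the curve by a factor at most expR S; a bound below for 1/d turns the certificate into a
    length bound. *)
Lemma quasihyp_curve (x y : D) S : k x y < S -> exists g, [/\ curve_in D (V x) (V y) g,
  (curve_length g 0 1 <= (S * expR S * d (V x))%:E)%E &
  forall t, 0 <= t <= 1 -> d (V x) <= expR S * d (g t)].
Proof.
move=> /(quasihyp_lt_qh_le uD)[g [gi gS]].
have kt t : 0 <= t <= 1 -> exists2 z : D, V z = g t & k x z <= S.
  move=> t01; have [_ g0 _ Dg] := gi.
  have Dt : D (g t) by apply: Dg; rewrite in_itv.
  pose z : D := SigSub (mem_set Dt); exists z => //.
  have [S' S'S h] := upper_sum_sub gS t01; apply: le_trans S'S.
  have /andP[t0 t1] := t01; have [tp|] := ltP 0 t; last first.
    move=> t0'; have e : t = 0 by apply/eqP; rewrite eq_le t0' t0.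
    have -> : z = x by apply: val_inj; change (g t = V x); rewrite e g0.
    by rewrite quasihypxx //; exact: upper_sum_ge0 h.
  apply: quasihyp_le => //; exists (fun s => g (t * s)); split.
    split; rewrite ?mulr0 ?mulr1 //.
      have [/continuous_itvP gc _ _ _] := gi; apply/continuous_itvP => s /andP[s0 s1] e e0.
      have [|c c0 Hc] := gc (t * s) _ e e0; first by rewrite mulr_ge0 //= mulr_ile1.
      exists c => // u /andP[u0 u1] us; apply: Hc; first by rewrite mulr_ge0 //= mulr_ile1.
      by rewrite -mulrBr normrM ger0_norm //; apply: le_lt_trans us; rewrite ler_piMl.
    move=> s; rewrite in_itv /= => /andP[s0 s1]; apply: Dg.
    by rewrite in_itv /= mulr_ge0 //= mulr_ile1.
  by apply: (@upper_sum_affine _ _ _ g _ t 0 0 t _ tp h) => [||s _]; rewrite ?mulr0 ?mulr1 ?addr0.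
have S0 := upper_sum_ge0 gS; have dx := dpos x; have e0 := expR_gt0 S.
exists g; split => //.
  have -> : S * expR S * d (V x) = S / (expR S * d (V x))^-1 by rewrite invrK mulrA.
  apply: upper_sum_length gS _; first by rewrite invr_gt0 mulr_gt0.
  move=> t /kt[z ez kz]; rewrite -ez lef_pV2 ?posrE ?mulr_gt0 //.
  have := quasihyp_dist uD x z; have := bdist_lip uD (V z) (V x); rewrite distrC mulrBl mul1r.
  have : expR (k x z) * d (V x) <= expR S * d (V x) by rewrite ler_pM2r // ler_expR.
  by lra.
move=> t /kt[z ez kz]; rewrite -ez; have dz := dpos z.
have := quasihyp_dist uD z x; have := bdist_lip uD (V x) (V z); rewrite distrC mulrBl mul1r.
have : expR (k z x) * d (V z) <= expR S * d (V z) by rewrite ler_pM2r // ler_expR quasihyp_sym.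
by lra.
Qed.

Variables (B : R) (cl : R -> R).
Hypothesis ascend : forall x, exists y, k x y <= B /\ 4 * d (V x) <= d (V y).
Hypothesis close : forall x y (M : R),
  `|V x - V y| + d (V x) + d (V y) <= M * d (V x) ->
  `|V x - V y| + d (V x) + d (V y) <= M * d (V y) -> k x y <= cl M.

Definition link_cst (S : R) : R := (S + 1) * expR (S + 1).
Definition climb_cst := 2 * link_cst B * expR (B + 1).

Definition climbs (x y : D) := exists g, [/\ curve_in D (V x) (V y) g,
  (curve_length g 0 1 <= (link_cst B * d (V y))%:E)%E &
  forall t, 0 <= t <= 1 -> (curve_length g 0 t <= (climb_cst * d (g t))%:E)%E].

Let B0 : 0 <= B.
Proof.
have [y Dy] := domain_neq0 uD; have [z [h _]] := ascend (SigSub (mem_set Dy)).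
exact: le_trans (quasihyp_ge0 uD _ _) h.
Qed.

Lemma climbs_refl x : climbs x x.
Proof.
have dx := dpos x; have b0 := B0; have L0 : 0 <= link_cst B.
  by rewrite /link_cst mulr_ge0 ?expR_ge0 //; lra.
have [|g [gi gl xg]] := @segment_curve _ _ _ uD (V x) (V x) (set_valP x); first by rewrite subrr normr0.
have len (t : R) : 0 <= t -> (curve_length g 0 t <= 0%:E)%E.
  by move=> t0; apply: le_trans (gl 0 t t0) _; rewrite subrr normr0 mul0r.
exists g; split => //.
  by apply: le_trans (len 1 ler01) _; rewrite lee_fin mulr_ge0 // ltW.
move=> t /andP[t0 t1]; apply: le_trans (len t t0) _; rewrite lee_fin mulr_ge0 //.
  by rewrite /climb_cst mulr_ge0 ?expR_ge0 // mulr_ge0.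
exact: bdist_ge0.
Qed.

(* The old curve has length at most [link_cst B * d y], the link too, and [d] is at least
   [expR (- (B + 1)) * d y] on the link. *)
Lemma climbs_step x y z : climbs x y -> k y z <= B -> 4 * d (V y) <= d (V z) -> climbs x z.
Proof.
move=> [g1 [i1 l1 c1]] kyz dyz; have dy := dpos y; have b0 := B0.
have [|g2 [i2 l2 c2]] := @quasihyp_curve y z (B + 1); first lra.
have e : g1 1 = g2 0 by case: i1 => _ _ -> _; case: i2.
have L0 : 0 <= link_cst B by rewrite /link_cst mulr_ge0 ?expR_ge0 //; lra.
exists (concat g1 g2); split; first exact: curve_in_concat i1 i2.
  rewrite curve_length_concat // ?ler_pdivrMr ?mul1r ?ler1n //.
  have -> : 2 * 1 - 1 = 1 :> R by lra.
  apply: le_trans (leeD l1 l2) _; rewrite -EFinD lee_fin -/(link_cst B); nra.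
move=> t /andP[t0 t1]; have [h|/ltW h] := leP t (1 / 2).
  rewrite curve_length_concatl // concatl //; apply: c1; lra.
have t21 : 0 <= 2 * t - 1 <= 1 by lra.
rewrite curve_length_concat // concatr //.
have l2' : (curve_length g2 0 (2 * t - 1) <= (link_cst B * d (V y))%:E)%E.
  by apply: le_trans l2; apply: curve_length_sub => //; case/andP: t21.
apply: le_trans (leeD l1 l2') _; rewrite -EFinD lee_fin /climb_cst.
have := c2 _ t21; nra.
Qed.

(** Repeated use of [ascend] until height [S] is passed: a step raises the height by a factor at
    most expR B, and linear growth in the number of steps suffices to terminate. *)
Lemma climbs_to x S : d (V x) <= S ->
  exists y, [/\ climbs x y, S <= d (V y) & d (V y) <= expR B * S].
Proof.
move=> xS; apply: contrapT => H; have dx := dpos x; have b0 := B0.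
have e1 : 1 <= expR B by rewrite -expR0 ler_expR.
have key n : exists y, [/\ climbs x y, d (V y) < S & n.+1%:R * d (V x) <= d (V y)].
  elim: n => [|n [y [cy yS ny]]].
    exists x; split; [exact: climbs_refl| |by rewrite mul1r].
    rewrite ltNge; apply/negP => Sx; apply: H; exists x; split => //; first exact: climbs_refl.
    by nra.
  have [z [kyz yz]] := ascend y; have cz := climbs_step cy kyz yz.
  have dy := dpos y; exists z; split => //.
    rewrite ltNge; apply/negP => Sz; apply: H; exists z; split => //.
    have h1 := quasihyp_dist uD y z; have h2 := bdist_lip uD (V z) (V y); rewrite distrC in h2.
    have h3 : expR (k y z) * d (V y) <= expR B * d (V y) by rewrite ler_pM2r // ler_expR.
    have h4 : expR B * d (V y) <= expR B * S by rewrite ler_pM2l ?expR_gt0 // ltW.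
    by rewrite mulrBl mul1r in h1; lra.
  have n0 : 0 <= n%:R :> R by []; move: ny; rewrite -!natr1; move: (n%:R : R) n0 => m m0; nra.
have [y [_ yS ny]] := key (Num.truncn (S / d (V x))).
have := truncnS_gt (S / d (V x)); rewrite ltr_pdivrMr // => h; lra.
Qed.

Definition top_ratio := 1 + 2 * (link_cst B + 1) * expR B.
Definition top_cst := link_cst (cl top_ratio).
Definition bridge_cst := climb_cst + (link_cst B + top_cst) * expR (cl top_ratio + 1).
Definition uniform_bound := 1 + 6 * (2 * link_cst B + top_cst) * expR B + bridge_cst.

Lemma uniform_of_climbs : 1 <= uniform_bound /\ uniform_domain uniform_bound D.
Proof.
have b0 := B0; have L0 : 0 <= link_cst B by rewrite /link_cst mulr_ge0 ?expR_ge0 //; lra.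
have eB : 1 <= expR B by rewrite -expR0 ler_expR.
have M1 : 1 <= top_ratio by rewrite /top_ratio; nra.
have M3 : 2 <= top_ratio by rewrite /top_ratio; nra.
have cl0 : 0 <= cl top_ratio.
  have [y Dy] := domain_neq0 uD; pose z : D := SigSub (mem_set Dy); have dz := dpos z.
  by rewrite -(quasihypxx uD z); apply: close; rewrite subrr normr0 add0r; nra.
have T0 : 0 <= top_cst by rewrite /top_cst /link_cst mulr_ge0 ?expR_ge0 //; lra.
have C0 : 0 <= climb_cst by rewrite /climb_cst mulr_ge0 ?expR_ge0 // mulr_ge0.
have Br0 : 0 <= bridge_cst by rewrite /bridge_cst addr_ge0 // mulr_ge0 ?expR_ge0 ?addr_ge0.
have U0 : 0 <= 6 * (2 * link_cst B + top_cst) * expR B by rewrite !mulr_ge0 ?expR_ge0 // addr_ge0 // mulr_ge0.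
split; first by rewrite /uniform_bound; lra.
move=> x' y' Dx Dy; have [x ex] : exists x : D, V x = x' by exists (SigSub (mem_set Dx)).
have [y ey] : exists y : D, V y = y' by exists (SigSub (mem_set Dy)).
rewrite -{}ex -{}ey.
have dx := dpos x; have dy := dpos y; have n0 := normr_ge0 (V x - V y).
have rect g (a : R) : (curve_length g 0 1 <= a%:E)%E -> rectifiable g.
  by move=> h; apply: le_lt_trans h _; exact: ltey.
(* Points close together relative to their height are joined by a segment. Otherwise d(x) and d(y)
   are bounded by multiples of |x - y|, which makes S comparable to |x - y|. *)
have [near_|far_] := leP `|V x - V y| (d (V x) / 2).
  have [|g [gi gl xg]] := @segment_curve _ _ _ uD (V x) (V y) (set_valP x); first lra.
  exists g.
  have h1 : (curve_length g 0 1 <= (uniform_bound * `|V x - V y|)%:E)%E.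
    apply: le_trans (gl 0 1 ler01) _; rewrite subr0 mulr1 lee_fin ler_peMl // /uniform_bound; lra.
  split => //; first exact: rect h1.
  move=> t; rewrite in_itv /= => /andP[t0 t1]; rewrite ge_min; apply/orP; left.
  apply: le_trans (gl 0 t t0) _; rewrite subr0 lee_fin.
  have h2 : `|V x - V y| * t <= `|V x - V y| by rewrite ler_piMr.
  have h3 : `|V x - V y| <= d (g t).
    have := bdist_lip uD (V x) (g t); have := xg t; rewrite t0 t1 => /(_ isT); lra.
  apply: le_trans (le_trans h2 h3) _; rewrite ler_peMl ?bdist_ge0 // /uniform_bound; lra.
pose S := `|V x - V y| + d (V x) + d (V y).
have [|u [[g1 [i1 l1 c1]] uS Su]] := @climbs_to x S; first by rewrite /S; lra.
have [|v [[g2 [i2 l2 c2]] vS Sv]] := @climbs_to y S; first by rewrite /S; lra.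
have du := dpos u; have dv := dpos v.
have chord (a b : D) g (c : R) : curve_in D (V a) (V b) g -> (curve_length g 0 1 <= c%:E)%E ->
    `|V a - V b| <= c.
  move=> [_ g0 g1' _] h; rewrite distrC -g0 -g1' -lee_fin; apply: le_trans h.
  exact: curve_length_ge_dist.
have xu := chord _ _ _ _ i1 l1; have yv := chord _ _ _ _ i2 l2.
have Lu : link_cst B * d (V u) <= link_cst B * (expR B * S) by rewrite ler_wpM2l.
have Lv : link_cst B * d (V v) <= link_cst B * (expR B * S) by rewrite ler_wpM2l.
have ruv : `|V u - V v| + d (V u) + d (V v) <= top_ratio * S.
  have t1 := ler_normD (V u - V x) (V x - V v); rewrite subrKA (distrC (V u) (V x)) in t1.
  have t2 := ler_normD (V x - V y) (V y - V v); rewrite subrKA in t2.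
  by rewrite /top_ratio; rewrite /S in Lu Lv Su Sv *; lra.
have kuv : k u v < cl top_ratio + 1.
  have S0 : 0 <= top_ratio by lra.
  apply: le_lt_trans (close (M := top_ratio) _ _) _; last by rewrite ltrDl.
    by apply: le_trans ruv _; rewrite ler_wpM2l.
  by apply: le_trans ruv _; rewrite ler_wpM2l.
have [g3 [i3 l3 c3]] := quasihyp_curve kuv.
rewrite -/(link_cst (cl top_ratio)) -/top_cst in l3.
have e13 : g1 1 = g3 0 by case: i1 => _ _ -> _; case: i3.
(* The link between the tops is counted with the ascent from x: on these two pieces the length from
   x is controlled, on the reversed ascent from y the length from y. *)
pose h := concat g1 g3; have ih : curve_in D (V x) (V v) h by exact: curve_in_concat i1 i3.
have lh : (curve_length h 0 1 <= ((link_cst B + top_cst) * d (V u))%:E)%E.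
  rewrite curve_length_concat // ?ler_pdivrMr ?mul1r ?ler1n //.
  have -> : 2 * 1 - 1 = 1 :> R by lra.
  by rewrite mulrDl EFinD; exact: leeD.
have eM : 0 < expR (cl top_ratio + 1) by exact: expR_gt0.
have ch t : 0 <= t <= 1 -> (curve_length h 0 t <= (bridge_cst * d (h t))%:E)%E.
  move=> /andP[t0 t1]; rewrite /h; have [t2|/ltW t2] := leP t (1 / 2).
    rewrite curve_length_concatl // concatl //; apply: le_trans (c1 (2 * t) _) _; first lra.
    by rewrite lee_fin ler_wpM2r ?bdist_ge0 // /bridge_cst lerDl mulr_ge0 ?expR_ge0 ?addr_ge0.
  have t21 : 0 <= 2 * t - 1 <= 1 by lra.
  rewrite curve_length_concat // concatr //.
  have l3' : (curve_length g3 0 (2 * t - 1) <= (top_cst * d (V u))%:E)%E.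
    by apply: le_trans l3; apply: curve_length_sub => //; case/andP: t21.
  apply: le_trans (leeD l1 l3') _; rewrite -EFinD -mulrDl lee_fin /bridge_cst mulrDl.
  have h1 : 0 <= climb_cst * d (g3 (2 * t - 1)) by rewrite mulr_ge0 ?bdist_ge0.
  have h2 : (link_cst B + top_cst) * d (V u)
      <= (link_cst B + top_cst) * (expR (cl top_ratio + 1) * d (g3 (2 * t - 1))).
    by rewrite ler_wpM2l ?addr_ge0 //; exact: c3.
  by rewrite mulrA in h2; lra.
pose g2r t := g2 (1 - t); have i2r : curve_in D (V v) (V y) g2r by exact: curve_in_rev.
have eh : h 1 = g2r 0 by case: ih => _ _ -> _; case: i2r.
pose g := concat h g2r; exists g.
have gl : (curve_length g 0 1 <= (uniform_bound * `|V x - V y|)%:E)%E.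
  rewrite curve_length_concat // ?ler_pdivrMr ?mul1r ?ler1n //.
  have -> : 2 * 1 - 1 = 1 :> R by lra.
  have l2r : (curve_length g2r 0 1 <= (link_cst B * d (V v))%:E)%E.
    by rewrite /g2r curve_length_rev subrr subr0.
  apply: le_trans (leeD lh l2r) _; rewrite -EFinD lee_fin.
  have S6 : S <= 6 * `|V x - V y|.
    by have := bdist_lip uD (V y) (V x); rewrite distrC /S; lra.
  have Tu : (link_cst B + top_cst) * d (V u) <= (link_cst B + top_cst) * (expR B * S).
    by rewrite ler_wpM2l ?addr_ge0.
  have TS : (2 * link_cst B + top_cst) * expR B * S
      <= (2 * link_cst B + top_cst) * expR B * (6 * `|V x - V y|).
    by rewrite ler_wpM2l // !mulr_ge0 ?expR_ge0 // addr_ge0 // mulr_ge0.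
  have Br1 : 0 <= bridge_cst * `|V x - V y| by rewrite mulr_ge0.
  by rewrite /uniform_bound; lra.
split => //; [exact: curve_in_concat ih i2r|exact: rect gl|].
have bu : bridge_cst <= uniform_bound by rewrite /uniform_bound; lra.
move=> t; rewrite in_itv /= => /andP[t0 t1]; rewrite ge_min; apply/orP.
have fin z : ((bridge_cst * d z)%:E <= (uniform_bound * d z)%:E)%E.
  by rewrite lee_fin ler_wpM2r ?bdist_ge0.
have [t2|/ltW t2] := leP t (1 / 2).
  left; apply: le_trans (fin _); rewrite /g curve_length_concatl // concatl //; apply: ch; lra.
right; apply: le_trans (fin _); rewrite /g curve_length_concatr // concatr //.
rewrite /g2r curve_length_rev.
have -> : 1 - (2 * 1 - 1) = 0 :> R by lra.
apply: le_trans (c2 _ _) _; first lra.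
by rewrite lee_fin ler_wpM2r ?bdist_ge0 // /bridge_cst lerDl mulr_ge0 ?expR_ge0 ?addr_ge0.
Qed.

End UniformCurves.

(** * The converse *)

Section Constants.
Context {R : realType}.
Variables (delta eps : R) (eta : R -> R).

Lemma ler_half_scale (t a b : R) : 0 < t -> a / 2 <= b -> t * a <= 2 * t * b.
Proof. by nra. Qed.

(** The factor 2 comes from [hamenstadt_bounds], the term 26 delta + 2 from two applications of
    [bprod_bd_approx]. *)
Definition qs_upper (c : R) : R := eta (2 * expR (eps * (c + 26 * delta + 2))).

Definition qs_threshold (c : R) : R :=
  xget 1 [set t0 : R | 0 < t0 /\ forall t, 0 <= t -> t < t0 -> eta t < (`|c| + 1)^-1].

(** Large enough that a difference of products beyond it makes the ratio of Hamenstaedt distances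
    smaller than [qs_threshold c]. *)
Definition qs_lower (c : R) : R := 26 * delta + 2 + ln (1 + 2 / qs_threshold c) / eps.

Hypothesis delta0 : 0 <= delta.
Hypothesis eps0 : 0 < eps.
Hypothesis ge : gauge eta.

Lemma qs_thresholdP c : 0 < qs_threshold c /\
  forall t, 0 <= t -> t < qs_threshold c -> eta t < (`|c| + 1)^-1.
Proof.
apply: (@xgetPex _ 1 [set t0 : R | 0 < t0 /\ forall t, 0 <= t -> t < t0 -> eta t < (`|c| + 1)^-1]).
have [|t0 t00 h] := gauge_small ge (_ : 0 < (`|c| + 1)^-1); last by exists t0.
by rewrite invr_gt0 ltr_wpDl.
Qed.

Lemma qs_upper_ge0 c : 0 <= qs_upper c.
Proof. by rewrite /qs_upper; apply: (gauge_ge0 ge); rewrite mulr_ge0 ?expR_ge0. Qed.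

Lemma qs_lower_ge0 c : 0 <= qs_lower c.
Proof.
have [t0 _] := qs_thresholdP c; rewrite /qs_lower !addr_ge0 ?mulr_ge0 //.
  by apply: ln_ge0; rewrite lerDl divr_ge0 // ltW.
by rewrite invr_ge0 ltW.
Qed.

Lemma qs_lower_threshold c s s' : qs_lower c - 26 * delta - 2 <= s - s' ->
  2 * expR (- (eps * (s - s'))) < qs_threshold c.
Proof.
have [t0 _] := qs_thresholdP c; rewrite /qs_lower => h.
have tt : 0 < 1 + 2 / qs_threshold c by rewrite ltr_pwDl // divr_ge0 // ltW.
have h1 : expR (- (eps * (s - s'))) <= (1 + 2 / qs_threshold c)^-1.
  rewrite expRN lef_pV2 ?posrE ?expR_gt0 // -[X in X <= _](@lnK R) ?posrE // ler_expR.
  rewrite -[X in X <= _](@mulfVK R eps) ?lt0r_neq0 // mulrC ler_pM2l //; lra.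
apply: (@le_lt_trans _ _ (2 * (1 + 2 / qs_threshold c)^-1)); first by rewrite ler_pM2l.
have -> : 1 + 2 / qs_threshold c = (qs_threshold c + 2) / qs_threshold c.
  by field; rewrite lt0r_neq0.
rewrite invf_div mulrA ltr_pdivrMr ?addr_gt0 //; nra.
Qed.

End Constants.

Section BoundaryToUniform.
Context {R : realType} {E : completeNormedModType R}.
Variable D : set E.
Hypothesis uD : unbounded_domain D.
Hypothesis dE : dim_ge2 E.
Notation k := (@quasihyp R E D).
Notation V := (@set_val E D).
Notation d := (bdist D).
Variables (delta eps : R) (eta : R -> R).
Hypothesis adm : admissible delta eps.
Hypothesis ge : gauge eta.
Hypothesis hyp : hyperbolic k delta.
Variables (phi : gboundary k -> option E) (xi : gboundary k) (o : D).
Hypothesis nat_phi : natural_map phi.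
Hypothesis phi_xi : phi xi = None.
Hypothesis qs_phi : boundary_qs phi xi (busemann (m := k) xi o) eps eta.

Let kxx := quasihypxx uD.
Let ks := quasihyp_sym uD.
Let kt := quasihyp_triangle uD.
Let delta0 : 0 <= delta. Proof. exact: (delta_ge0 kxx hyp o). Qed.

Lemma ray_gromov x c p : ray_seq x c p -> gromov_seq k c.
Proof.
move=> cP; apply/(gromov_seqP k) => z M.
have [N HN] := ray_far uD cP (M + k x z + 1); exists N => i j Ni Nj.
suff H a b : (a <= b)%N -> (N <= a)%N -> M <= gprod k z (c a) (c b).
  by have [/H|/ltnW/H] := leqP i j; [exact|rewrite (gprod_sym ks); exact].
move=> ab Na; have h := gprod_on_geodesic ks (ray_geodesic uD cP ab).
have := HN a Na; have := gprod_base ks kt x z (c a) (c b).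
by rewrite (gprod_sym ks x (c a)); lra.
Qed.

Lemma ray_tends x c p : ray_seq x c p -> @tends R E D c (Some p).
Proof.
move=> cP e e0; have [_ _ _ H _] := cP; have [|N HN] := H (e / 3); first by rewrite divr_gt0.
by exists N => // i /HN h; have := ray_end cP i; lra.
Qed.

Lemma ray_boundary x c p : ray_seq x c p ->
  exists zeta, [/\ seqs_of zeta c, zeta <> xi & phi zeta = Some p].
Proof.
move=> cP; have [zeta zc] := gboundary_of (ray_gromov cP); exists zeta.
have e : phi zeta = Some p := tends_unique (natural_tends uD hyp nat_phi zc) (ray_tends cP).
by split => // ex; move: e; rewrite ex phi_xi.
Qed.

Lemma gprod_escape zeta u v w (M : R) : zeta <> xi -> seqs_of zeta u -> seqs_of zeta v -> seqs_of xi w ->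
  \forall n \near \oo, M <= gprod k (w n) (u n) (v n) - k o (w n).
Proof.
move=> zx zu zv xw; have [t Ht] := gprod_stable kxx ks kt hyp o zx.
have [N1 H1] := Ht u w zu xw; have [N2 H2] := Ht v w zv xw.
have [N3 H3] := seqs_of_asymptotic kxx ks hyp zu zv o (M + 2 * t + 4 * delta).
exists (maxn N1 (maxn N2 N3)) => // n /=; rewrite !geq_max => /and3P[n1 n2 n3].
rewrite (gprod_base_change ks).
have := H1 n n n1 n1; have := H2 n n n2 n2; have := H3 n n n3 n3.
by rewrite !ler_norml => ? /andP[? ?] /andP[? ?]; lra.
Qed.

Lemma boundary_expand x y z u v v' w f c :
  (forall zeta, zeta <> xi -> phi zeta = Some (f zeta)) ->
  quasisymmetric eta [set zeta | zeta <> xi] (hamenstadt xi (busemann (m := k) xi o) eps)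
      (frontier D) (fun x y => `|x - y|) f ->
  x <> xi -> y <> xi -> z <> xi -> seqs_of x u -> seqs_of y v -> seqs_of z v' -> seqs_of xi w ->
  (exists N, forall n, (N <= n)%N ->
    gprod k (w n) (u n) (v' n) - c <= gprod k (w n) (u n) (v n)) ->
  `|f x - f y| <= qs_upper delta eps eta c * `|f x - f z|.
Proof.
move=> fP [_ qs] xx yx zx xu yv zv xw [N HN]; have [eps0 ad] := adm; have d0 := delta0.
have [->|nxy] := pselect (x = y).
  by rewrite subrr normr0 mulr_ge0 // qs_upper_ge0.
have [a [ea /(_ u v w xu yv xw) near2]] := bprod_bd_approx kxx ks kt hyp o nxy xx yx.
have [exz|nxz] := pselect (x = z).
  (* For x = z the product of [u] and [v'] is unbounded while that of [u] and [v] stays near [a],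
     against the hypothesis. *)
  exfalso; rewrite -exz in zv; have escape := gprod_escape (a + 13 * delta + 2 + c) xx xu zv xw.
  near \oo => n; have h1 : (N <= n)%N by near: n; exists N.
  have h2 : `|gprod k (w n) (u n) (v n) - k o (w n) - a| <= 13 * delta + 1 by near: n.
  have h3 : a + 13 * delta + 2 + c <= gprod k (w n) (u n) (v' n) - k o (w n) by near: n.
  by have := HN n h1; move: h2; rewrite ler_norml => /andP[_ h2]; lra.
have [a' [ea' /(_ u v' w xu zv xw) near3]] := bprod_bd_approx kxx ks kt hyp o nxz xx zx.
have haa : a' - a <= c + 26 * delta + 2.
  move: near2 near3; clear ea ea' => near2 near3.
  near \oo => n; have h1 : (N <= n)%N by near: n; exists N.
  have : `|gprod k (w n) (u n) (v n) - k o (w n) - a| <= 13 * delta + 1 by near: n.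
  have : `|gprod k (w n) (u n) (v' n) - k o (w n) - a'| <= 13 * delta + 1 by near: n.
  have := HN n h1; rewrite !ler_norml => ? /andP[? ?] /andP[? ?]; lra.
apply: qs => //; first by rewrite mulr_gt0 // expR_gt0.
have /andP[_ h2] := hamenstadt_bounds kxx ks kt hyp o eps0 ad xx yx.
have /andP[h3 _] := hamenstadt_bounds kxx ks kt hyp o eps0 ad xx zx.
rewrite (rhoE eps ea) in h2; rewrite (rhoE eps ea') in h3.
apply: le_trans h2 _.
have h4 : expR (- (eps * a)) <= expR (eps * (c + 26 * delta + 2)) * expR (- (eps * a')).
  rewrite -expRD ler_expR -subr_ge0.
  have -> : eps * (c + 26 * delta + 2) + - (eps * a') - - (eps * a) =
      eps * (c + 26 * delta + 2 - (a' - a)) by ring.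
  by rewrite mulr_ge0 ?(ltW eps0) // subr_ge0.
by apply: le_trans h4 _; apply: ler_half_scale h3; exact: expR_gt0.
Unshelve. all: end_near. Qed.

(** Quasisymmetry is applied with y and z exchanged. If the product towards z exceeded that towards
    y by too much, z would be much closer to x than y for the Hamenstaedt metric; then |f x - f z|
    would be less than |f x - f y| / (|c| + 1), against the assumed ratio. *)
Lemma boundary_shrink x y z u v v' w f c :
  (forall zeta, zeta <> xi -> phi zeta = Some (f zeta)) ->
  quasisymmetric eta [set zeta | zeta <> xi] (hamenstadt xi (busemann (m := k) xi o) eps)
      (frontier D) (fun x y => `|x - y|) f ->
  x <> xi -> y <> xi -> z <> xi -> seqs_of x u -> seqs_of y v -> seqs_of z v' -> seqs_of xi w ->
  f x <> f z -> `|f x - f y| <= c * `|f x - f z| ->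
  exists N, forall n, (N <= n)%N ->
    gprod k (w n) (u n) (v' n) - qs_lower delta eps eta c <= gprod k (w n) (u n) (v n).
Proof.
move=> fP [_ qs] xx yx zx xu yv zv xw nf hc; have [eps0 ad] := adm; have d0 := delta0.
have nxz : x <> z by move=> e; apply: nf; rewrite e.
have Q0 := qs_lower_ge0 d0 eps0 ge c.
have [a' [ea' /(_ u v' w xu zv xw) near3]] := bprod_bd_approx kxx ks kt hyp o nxz xx zx.
suff : \forall n \near \oo,
    gprod k (w n) (u n) (v' n) - qs_lower delta eps eta c <= gprod k (w n) (u n) (v n).
  by case=> N _ HN; exists N => n; exact: HN.
have [exy|nxy] := pselect (x = y).
  rewrite -exy in yv; have escape := gprod_escape (a' + 13 * delta + 2) xx xu yv xw.
  move: near3 escape; clear ea'; apply: filterS2 => n.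
  by rewrite ler_norml => /andP[_ ?] ?; lra.
have [a [ea /(_ u v w xu yv xw) near2]] := bprod_bd_approx kxx ks kt hyp o nxy xx yx.
have [h|h] := leP (a' - a) (qs_lower delta eps eta c - 26 * delta - 2).
  move: near2 near3; clear ea ea'; apply: filterS2 => n.
  by rewrite !ler_norml => /andP[? ?] /andP[? ?]; lra.
exfalso; have /andP[_ h2] := hamenstadt_bounds kxx ks kt hyp o eps0 ad xx zx.
have /andP[h3 _] := hamenstadt_bounds kxx ks kt hyp o eps0 ad xx yx.
rewrite (rhoE eps ea') in h2; rewrite (rhoE eps ea) in h3.
have thr := qs_lower_threshold eps0 ge (ltW h); have [t0 Ht] := qs_thresholdP ge c.
set t := 2 * expR (- (eps * (a' - a))) in thr.
have tp : 0 < t by rewrite /t mulr_gt0 // expR_gt0.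
have := qs t x z y tp xx zx yx.
have -> : hamenstadt xi (busemann (m := k) xi o) eps x z
    <= t * hamenstadt xi (busemann (m := k) xi o) eps x y.
  apply: le_trans h2 _.
  have -> : expR (- (eps * a')) = expR (- (eps * (a' - a))) * expR (- (eps * a)).
    by rewrite -expRD; congr expR; ring.
  by rewrite /t; apply: ler_half_scale h3; exact: expR_gt0.
move=> /(_ isT) h4; have h5 := Ht t (ltW tp) thr.
have p0 : 0 < `|f x - f z| by rewrite normr_gt0 subr_eq0; apply/eqP.
have c1 : 0 < `|c| + 1 by rewrite ltr_wpDl.
have h6 : eta t * `|f x - f y| <= (`|c| + 1)^-1 * `|f x - f y| by rewrite ler_wpM2r // ltW.
have h7 := le_trans h4 h6; rewrite mulrC ler_pdivlMr // in h7.
have h8 : c * `|f x - f z| <= `|c| * `|f x - f z| by rewrite ler_wpM2r // ler_norm.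
have : `|f x - f z| * `|c| < `|f x - f z| * (`|c| + 1) by rewrite ltr_pM2l // ltrDl.
by rewrite ltNge (le_trans h7) // (le_trans hc) // (le_trans h8) // mulrC.
Qed.

Definition domain_cst (delta eps : R) (eta : R -> R) : R :=
  let Q1 := qs_upper delta eps eta in let Q2 := qs_lower delta eps eta in
  uniform_bound (up_cst delta Q1 Q2 + 1) (close_cst delta Q1 Q2).

Lemma uniform_of_boundary_qs : 1 <= domain_cst delta eps eta /\
  uniform_domain (domain_cst delta eps eta) D.
Proof.
have [f [fP qs]] := qs_phi; have [eps0 ad] := adm; have d0 := delta0.
have [rp rpP] := choice (fun x => let: ex_intro c (ex_intro p h) := ray_exists uD x in
  ex_intro (fun cp : (nat -> D) * E => ray_seq x cp.1 cp.2) (c, p) h).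
have [cls clsP] := choice (fun x => ray_boundary (rpP x)).
have [w xw] := seqs_of_neq0 xi.
have fcls x : f (cls x) = (rp x).2.
  by have [_ cx e] := clsP x; apply: Some_inj; rewrite -e fP.
have w_gromov x (L : R) : exists N, forall i j, (N <= i)%N -> (N <= j)%N -> L <= gprod k x (w i) (w j).
  by have /(gromov_seqP k) := seqs_of_gromov kxx ks hyp xw; apply.
have w_far (M : R) : exists N, forall n, (N <= n)%N -> M <= `|V (w n)|.
  have := natural_tends uD hyp nat_phi xw; rewrite phi_xi => /(_ M)[N _ HN].
  by exists N => n Nn; apply: ltW; exact: HN.
have ray_stable x : exists (t : R) N, forall n, (N <= n)%N ->
    `|gprod k x ((rp x).1 n) (w n) - t| <= 2 * delta.
  have [zx nx _] := clsP x; have [t Ht] := gprod_stable kxx ks kt hyp x nx.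
  have [N HN] := Ht _ _ zx xw; by exists t, N => n Nn; exact: HN.
have Q1_ge0 c : 0 <= qs_upper delta eps eta c by exact: qs_upper_ge0.
have Q2_ge0 c : 0 <= qs_lower delta eps eta c by exact: qs_lower_ge0.
have Q1P x y z (c : R) : (exists N, forall n, (N <= n)%N ->
    gprod k (w n) ((rp x).1 n) ((rp z).1 n) - c <= gprod k (w n) ((rp x).1 n) ((rp y).1 n)) ->
    `|(rp x).2 - (rp y).2| <= qs_upper delta eps eta c * `|(rp x).2 - (rp z).2|.
  have [zx nx _] := clsP x; have [zy ny _] := clsP y; have [zz nz _] := clsP z.
  by rewrite -!fcls; exact: boundary_expand.
have Q2P x y z (c : R) : (rp x).2 <> (rp z).2 -> `|(rp x).2 - (rp y).2| <= c * `|(rp x).2 - (rp z).2| ->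
    exists N, forall n, (N <= n)%N ->
    gprod k (w n) ((rp x).1 n) ((rp z).1 n) - qs_lower delta eps eta c
      <= gprod k (w n) ((rp x).1 n) ((rp y).1 n).
  have [zx nx _] := clsP x; have [zy ny _] := clsP y; have [zz nz _] := clsP z.
  by rewrite -!fcls; exact: boundary_shrink.
apply: (uniform_of_climbs uD).
- exact: (ascend uD dE hyp rpP w_gromov w_far ray_stable Q1_ge0 Q2_ge0 Q1P Q2P).
- exact: (close uD dE hyp rpP w_gromov w_far ray_stable Q1_ge0 Q2_ge0 Q1P Q2P).
Qed.

End BoundaryToUniform.

(** * The two directions with their constants *)

Section MainTheorem.
Context {R : realType}.
Implicit Types (A delta eps : R) (eta : R -> R).

Definition hyperbolicity_cst A : R := 2 * (diff_cst (uniform_cst A) + 1).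

Lemma hyperbolicity_cst_ge0 A : 1 <= A -> 0 <= hyperbolicity_cst A.
Proof.
by move=> A1; have := diff_cst_ge1 (uniform_cst_ge1 A1); rewrite /hyperbolicity_cst; lra.
Qed.

Lemma gauge_boundary A eps : 1 <= A -> 0 < eps -> gauge (boundary_gauge (uniform_cst A) eps).
Proof.
move=> A1 e0; have := uniform_cst_ge1 A1 => C1.
by apply: gauge_power; rewrite ?expR_gt0 ?invr_gt0 ?mulr_gt0 //; lra.
Qed.

Lemma admissible_ex delta : 0 <= delta -> exists eps, admissible delta eps.
Proof.
move=> d0; exists (ln 2 / (22 * (delta + 1))).
have l2 : 0 < ln (2 : R) by rewrite ln_gt0 // ltr1n.
have p : 0 < 22 * (delta + 1) by lra.
split; first by rewrite divr_gt0.
rewrite -[X in _ <= X](@lnK R) ?posrE // ler_expR.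
have -> : 22 * (ln 2 / (22 * (delta + 1))) * delta = ln (2 : R) * (delta / (delta + 1)).
  by field; rewrite lt0r_neq0 //; lra.
by rewrite ler_piMr ?(ltW l2) // ler_pdivrMr; lra.
Qed.

Lemma uniform_natural_map A (E : completeNormedModType R) (D : set E) :
  1 <= A -> unbounded_domain D -> uniform_domain A D ->
  hyperbolic (@quasihyp R E D) (hyperbolicity_cst A) /\
  exists (phi : gboundary (@quasihyp R E D) -> option E)
         (xi : gboundary (@quasihyp R E D)),
    [/\ natural_map phi, phi xi = None &
        forall eps b, admissible (hyperbolicity_cst A) eps -> busemann_functions xi b ->
          boundary_qs phi xi b eps (boundary_gauge (uniform_cst A) eps)].
Proof.
move=> A1 uD uA; have C1 := uniform_cst_ge1 A1.
have kle := fun x y : D => uniform_quasihyp_le uD x y A1 uA.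
split; first exact: (uniform_hyperbolic uD C1 kle).
have [xi bxi _] := boundary_map_infinity uD C1 kle.
exists (boundary_map (D := D)), xi; split => //.
  exact: (boundary_map_natural uD C1 kle).
by move=> eps b adm [z _ <-]; exact: (uniform_boundary_qs uD C1 kle).
Qed.

End MainTheorem.

Theorem theorem1p6 (R : realType) :
  [/\
    forall (E : completeNormedModType R) (D : set E),
      dim_ge2 E -> unbounded_domain D ->
      (exists2 A : R, 1 <= A & uniform_domain A D) <->
      (exists (delta eps : R) (eta : R -> R),
         [/\ 0 <= delta, admissible delta eps, gauge eta,
             hyperbolic (@quasihyp R E D) delta &
             exists (phi : gboundary (@quasihyp R E D) -> option E)
                    (xi : gboundary (@quasihyp R E D)),
               [/\ natural_map phi, phi xi = None &
                   exists2 b, busemann_functions xi b &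
                     boundary_qs phi xi b eps eta]]),

    forall A : R, 1 <= A ->
      exists (delta : R) (eta : R -> R -> R),
        [/\ 0 <= delta,
            forall eps, admissible delta eps -> gauge (eta eps) &
            forall (E : completeNormedModType R) (D : set E),
              dim_ge2 E -> unbounded_domain D -> uniform_domain A D ->
              hyperbolic (@quasihyp R E D) delta /\
              exists (phi : gboundary (@quasihyp R E D) -> option E)
                     (xi : gboundary (@quasihyp R E D)),
                [/\ natural_map phi, phi xi = None &
                    forall eps b, admissible delta eps ->
                      busemann_functions xi b ->
                      boundary_qs phi xi b eps (eta eps)]] &

    forall (delta eps : R) (eta : R -> R),
      0 <= delta -> admissible delta eps -> gauge eta ->
      exists2 A : R, 1 <= A &
        forall (E : completeNormedModType R) (D : set E),
          dim_ge2 E -> unbounded_domain D ->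
          hyperbolic (@quasihyp R E D) delta ->
          (exists (phi : gboundary (@quasihyp R E D) -> option E)
                  (xi : gboundary (@quasihyp R E D)),
             [/\ natural_map phi, phi xi = None &
                 exists2 b, busemann_functions xi b &
                   boundary_qs phi xi b eps eta]) ->
          uniform_domain A D].
Proof.
split.
- move=> E D dE uD; split.
    move=> [A A1 uA]; have d0 := hyperbolicity_cst_ge0 A1.
    have [eps adm] := admissible_ex d0.
    have [hyp [phi [xi [nat_phi phi_xi qs]]]] := uniform_natural_map A1 uD uA.
    exists (hyperbolicity_cst A), eps, (boundary_gauge (uniform_cst A) eps).
    split => //; first by apply: gauge_boundary => //; case: adm.
    exists phi, xi; split => //.
    have [z Dz] := domain_neq0 uD; pose b := busemann xi (SigSub (mem_set Dz) : D).
    have bb : busemann_functions xi b by exists (SigSub (mem_set Dz)).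
    by exists b => //; exact: qs.
  move=> [delta [eps [eta [d0 adm ge hyp [phi [xi [nat_phi phi_xi [_ [z _ <-] qs]]]]]]]].
  have [A1 uA] := uniform_of_boundary_qs uD dE adm ge hyp nat_phi phi_xi qs.
  by exists (domain_cst delta eps eta).
- move=> A A1; exists (hyperbolicity_cst A), (fun eps => boundary_gauge (uniform_cst A) eps).
  split; first exact: hyperbolicity_cst_ge0.
    by move=> eps [e0 _]; exact: gauge_boundary.
  by move=> E D _ uD uA; exact: uniform_natural_map.
(* [A] has to be chosen before the domain, while [1 <= domain_cst] is only established in the
   presence of one; the maximum collapses once [D] is given. *)
- move=> delta eps eta d0 adm ge; exists (Num.max 1 (domain_cst delta eps eta)).
    by rewrite le_max lexx.
  move=> E D dE uD hyp [phi [xi [nat_phi phi_xi [_ [z _ <-] qs]]]].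
  have [A1 uA] := uniform_of_boundary_qs uD dE adm ge hyp nat_phi phi_xi qs.
  by rewrite max_r.
Qed.
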